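(* Let $f:X\dashrightarrow X$ be a birational self-map of a smooth projective surface $X$ over $\mathbb{C}$. If there exists a superattracting periodic point $P\in X$ of $f$, then $f$ does not admit an invariant fibration.
   Context: For a rational map $f:X\dashrightarrow X$ with indeterminacy set $\mathcal I(f)$, a fixed point $P\in X\setminus\mathcal I(f)$ is superattracting if the differential of $f$ at $P$ is zero (i.e. in an analytic chart centered at $P$, the induced holomorphic map germ $F$ fixing $0$ has $DF_0=0$). $P$ is a superattracting periodic point of $f$ if it is a superattracting fixed point of the iterate $f^n$ for some $n\in\mathbb{Z}_{>0}$. An invariant fibration of $f$ is a triple $(Y,\rho,g)$ where $Y$ is a projective curve, $\rho:X\dashrightarrow Y$ is a dominant rational map and $g:Y\to Y$ is a regular map such that $\rho\circ f=g\circ\rho$ at each point where the compositions are defined. (Generic fibers of $\rho$ are not required to be irreducible.) *)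

(* Defs.v *)
From mathcomp Require Import all_boot all_order all_algebra.
From mathcomp Require Import reals complex mpoly.

Set Implicit Arguments.
Unset Strict Implicit.
Unset Printing Implicit Defensive.

Import GRing.Theory.
Local Open Scope ring_scope.

(* Complex projective varieties, classically: a point of P^n is given by
   homogeneous coordinates, i.e. a nonzero row vector of length n + 1 up to
   scaling, and a subset of P^n by a predicate on row vectors (for the closed
   sets below it is scaling-invariant and excludes 0).  The field of complex
   numbers is R[i] for R : realType. *)

Section ProjectiveSets.
Variables (R : realType) (n : nat).
Local Notation vec := 'rV[R[i]]_n.+1.
Local Notation pol := {mpoly R[i][n.+1]}.
Implicit Types (X Y Z : vec -> Prop) (x y P v : vec) (p : pol).

Definition same_point x y := exists2 c : R[i], c != 0 & y = c *: x.

Definition homogeneous p := exists d : nat, p \is d.-homog.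

Definition included X Y := forall x, X x -> Y x.

Definition zariski_closed Z :=
  exists S : pol -> Prop, (forall p, S p -> homogeneous p) /\
    forall x, Z x <-> x != 0 /\ forall p, S p -> p.@[x 0] = 0.

Definition irreducible Z :=
  (exists x, Z x) /\
  forall Z1 Z2, zariski_closed Z1 -> zariski_closed Z2 ->
    (forall x, Z x -> Z1 x \/ Z2 x) -> included Z Z1 \/ included Z Z2.

Definition chain_in Z (d : nat) :=
  exists W : nat -> vec -> Prop,
    [/\ forall i, (i <= d)%N -> zariski_closed (W i) /\ irreducible (W i),
        forall i, (i < d)%N -> included (W i) (W i.+1) /\ ~ included (W i.+1) (W i)
      & included (W d) Z].

Definition has_dim Z (d : nat) := chain_in Z d /\ ~ chain_in Z d.+1.

Definition projective_variety X := zariski_closed X /\ irreducible X.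

(* The tangent space at P to the affine cone over X; the tangent space of X at
   the point [P] is its quotient by the line spanned by P. *)
Definition cone_tangent X P v :=
  forall p, homogeneous p -> (forall x, X x -> p.@[x 0] = 0) ->
    \sum_(i < n.+1) v 0 i * (p^`M(i)).@[P 0] = 0.

Definition smooth_of_dim X (d : nat) :=
  forall P, X P ->
    exists2 V : {vspace vec}, \dim V = d.+1
                            & forall v, cone_tangent X P v <-> v \in V.

Definition smooth_projective_surface X :=
  [/\ projective_variety X, has_dim X 2 & smooth_of_dim X 2].

Definition projective_curve X := projective_variety X /\ has_dim X 1.

End ProjectiveSets.

(* A rational map from X in P^n to P^m is represented by m + 1 forms of the same
   degree that do not all vanish identically on X; two representatives give the
   same map when they are proportional at every point of X. *)

Definition forms (R : realType) (n m : nat) :=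
  m.+1.-tuple {mpoly R[i][n.+1]}.

Definition eval_forms (R : realType) (n m : nat) (F : forms R n m)
  (x : 'rV[R[i]]_n.+1) : 'rV[R[i]]_m.+1 := \row_j (tnth F j).@[x 0].

Definition id_forms (R : realType) (n : nat) : forms R n n :=
  [tuple 'X_i | i < n.+1].

Definition comp_forms (R : realType) (n m k : nat)
  (G : forms R m k) (F : forms R n m) : forms R n k :=
  [tuple tnth G j \mPo F | j < k.+1].

Definition iter_forms (R : realType) (n k : nat) (F : forms R n n) :
  forms R n n := iter k (comp_forms F) (id_forms R n).

Section RationalMaps.
Variables (R : realType) (n m : nat).
Local Notation src := 'rV[R[i]]_n.+1.
Local Notation tgt := 'rV[R[i]]_m.+1.
Implicit Types (X : src -> Prop) (Y : tgt -> Prop) (F G : forms R n m).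

Definition represents_map X F :=
  (exists d : nat, forall j, tnth F j \is d.-homog) /\
  exists2 x, X x & eval_forms F x != 0.

Definition same_map X F G :=
  [/\ represents_map X F, represents_map X G
    & forall x, X x -> forall i j,
        eval_forms F x 0 i * eval_forms G x 0 j =
        eval_forms F x 0 j * eval_forms G x 0 i].

(* [map_graph X F x y]: the rational map is regular at x (some representative does
   not vanish there), and its value at x is the point y. *)
Definition map_graph X F (x : src) (y : tgt) :=
  X x /\ exists G, [/\ same_map X F G, eval_forms G x != 0
                     & same_point (eval_forms G x) y].

Definition defined_at X F (x : src) := exists y, map_graph X F x y.

Definition rational_map X Y F :=
  represents_map X F /\ forall x y, map_graph X F x y -> Y y.

(* On a (reduced, irreducible) variety, a morphism to a projective variety is a
   rational map with empty indeterminacy set. *)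
Definition regular_map X Y F :=
  rational_map X Y F /\ forall x, X x -> defined_at X F x.

Definition dominant X Y F :=
  forall Z, zariski_closed Z -> (forall x y, map_graph X F x y -> Z y) ->
    included Y Z.

Definition jacobian F (x : src) : 'M[R[i]]_(n.+1, m.+1) :=
  \matrix_(i, j) ((tnth F j)^`M(i)).@[x 0].

(* If the representative G does not vanish at P, the differential at [P] is the
   map induced by the Jacobian matrix of G from (cone tangent space at P) / <P>
   to C^(m+1) / <G(P)>: it vanishes when the Jacobian sends the cone tangent
   space into the line <G(P)>. *)
Definition differential_zero X F (P : src) :=
  exists G, [/\ same_map X F G, eval_forms G P != 0
              & forall v, cone_tangent X P v ->
                  (v *m jacobian G P <= eval_forms G P)%MS].

End RationalMaps.

Definition birational_map (R : realType) (n m : nat)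
  (X : 'rV[R[i]]_n.+1 -> Prop) (Y : 'rV[R[i]]_m.+1 -> Prop)
  (F : forms R n m) :=
  rational_map X Y F /\
  exists G : forms R m n,
    [/\ rational_map Y X G, same_map X (comp_forms G F) (id_forms R n)
      & same_map Y (comp_forms F G) (id_forms R m)].

Section Dynamics.
Variables (R : realType) (n : nat).
Implicit Types (X : 'rV[R[i]]_n.+1 -> Prop) (f : forms R n n).

Definition superattracting_fixed X f (P : 'rV[R[i]]_n.+1) :=
  map_graph X f P P /\ differential_zero X f P.

Definition superattracting_periodic X f (P : 'rV[R[i]]_n.+1) :=
  exists2 k : nat, (0 < k)%N & superattracting_fixed X (iter_forms k f) P.

Definition invariant_fibration X f (m : nat) (Y : 'rV[R[i]]_m.+1 -> Prop)
  (rho : forms R n m) (g : forms R m m) :=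
  [/\ projective_curve Y, rational_map X Y rho, dominant X Y rho,
      regular_map Y Y g
    & forall x x' y y' z,
        map_graph X f x x' -> map_graph X rho x' y' ->
        map_graph X rho x y -> map_graph Y g y z -> same_point y' z].

End Dynamics.

(* Main.v *)
Require Import Defs.
From mathcomp Require Import all_boot all_order all_algebra.
From mathcomp Require Import reals complex mpoly.
From HB Require Import structures.
From mathcomp Require Import perm generic_quotient ring_quotient fraction boolp ring zify.
From mathcomp Require classical_sets.

Set Implicit Arguments.
Unset Strict Implicit.
Unset Printing Implicit Defensive.

Import Order.TTheory GRing.Theory Num.Theory Pdiv.CommonRing Pdiv.ComRing.
Local Open Scope ring_scope.

(** Let [K] be the function field of [X], with field of constants [C], let [phi] be the
    automorphism of [K] induced by [f], and let [Phi] be its iterate for which [P] is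
    a superattracting fixed point.  Superattraction says that [Phi] preserves the
    local ring [O] of [P] and maps its maximal ideal [m] into [m^2]
    ([superattracting_contraction]); hence [Phi^N] maps [m] into [m^(2^N)].

    Suppose that a fibration is preserved.  A nonconstant coordinate [t] of the
    fibration is then a function on a curve, and so is [phi t]; thus [phi t] is
    algebraic over [C(t)] ([fibration_dependent]).  The algebraic closure [L] of [C(t)]
    in [K] is a field of transcendence degree one with [Phi L = L], and these data are
    contradictory ([no_contracting_automorphism]), for the following reasons.

    - Take [a] in [m] outside [L], and let [D] bound the degree of [K] over [C(t, a)].
      Any [D + 1] elements of [O] are [Phi^N]-images of elements linearly dependent
      over [C(t, a)]; since [Phi^N a] lies in [m^(2^N)], they are dependent over [L]
      modulo arbitrarily high powers of [m] ([dependence_modulo_powers]).  So the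
      spaces [L m^i] cannot decrease strictly [D + 1] times, and Nakayama's
      argument turns an equality [L m^i = L m^(i+1)] into an expression
      [1 = sum_i l_i a_i] with [l_i] in [L] and [a_i] in [m] ([one_in_lspan]).
    - Choose a discrete valuation [u] of [K], trivial on [C], nonnegative on [O] and
      positive on [m].  Then [u (Phi^N a_i) >= 2^N], whereas [u (Phi^N l_i)] is bounded
      below independently of [N] ([bounded_valuation]): a pole of [Phi^N l_i] of large
      order would be independent of the powers of a fixed element of [L].  Applying
      [Phi^N] to [1 = sum_i l_i a_i] for large [N] is absurd.

    The geometry enters through three constructions.  Dimension, defined by chains of
    closed sets, bounds transcendence degree, because a generic point with [d]
    algebraically independent functions can be specialized [d] times in a row, one
    function at a time ([dependent_of_no_chain]).  The valuation is the order of
    vanishing along a formal curve through [P] on which no nonzero rational function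
    vanishes: the integral curve of a vector field [D] with [D x = 1] and [D z = z],
    along which [x] is an affine parameter and [z] an exponential
    ([curve_valuation_exists]); smoothness provides the vector field
    ([tangent_vector_field]).  Smoothness also shows that a function whose value and
    differential vanish at [P] lies in [m^2] ([second_order]), which converts the
    vanishing of the differential of the iterate into [Phi m] inside [m^2]. *)

(** * Residue fields of prime ideals *)

Section ResidueField.
Variables (A : comNzRingType) (I : A -> Prop).
Hypotheses (I0 : I 0) (ID : forall a b, I a -> I b -> I (a + b)).
Hypotheses (IM : forall a b, I b -> I (a * b)) (I1 : ~ I 1).
Hypothesis Ipr : forall a b, I (a * b) -> I a \/ I b.

Definition in_ideal : A -> bool := fun a => `[<I a>].
Local Notation S := in_ideal.

Let S_idealr : idealr_closed S.
Proof.
split; first exact/asboolP.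
  by apply/negP=> /asboolP.
by move=> a u v /asboolP Iu /asboolP Iv; apply/asboolP/ID => //; apply: IM.
Qed.

Let S_prime : prime_idealr_closed S.
Proof.
by move=> u v /asboolP/Ipr[] ?; apply/orP; [left|right]; apply/asboolP.
Qed.

HB.instance Definition _ := isIdealr.Build A S S_idealr.
HB.instance Definition _ := isPrimeIdealrClosed.Build A S S_prime.

Definition ideal_quotient : Type := Quotient.quot (S : idealr A).
Local Notation Q := ideal_quotient.
HB.instance Definition _ := GRing.ComNzRing.copy Q (Quotient.quot (S : idealr A)).

Let qunit : pred Q := fun x => `[<exists y : Q, y * x = 1>].
(* Inverses are chosen classically, as divisibility in the quotient is not decidable. *)
Let qinv (x : Q) : Q :=
  match pselect (exists y : Q, y * x = 1) with
  | left h => sval (cid h)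
  | right _ => x
  end.

Let qmulV : {in qunit, left_inverse 1 qinv *%R}.
Proof.
move=> x /asboolP h; rewrite /qinv; case: pselect => // h'.
by case: (cid h').
Qed.

Let qunitP (x y : Q) : y * x = 1 -> qunit x.
Proof. by move=> h; apply/asboolP; exists y. Qed.

Let qinv_out : {in [predC qunit], qinv =1 id}.
Proof.
move=> x /negP h; rewrite /qinv; case: pselect => // h'.
by case: h; apply/asboolP.
Qed.

HB.instance Definition _ :=
  GRing.ComNzRing_hasMulInverse.Build Q qmulV qunitP qinv_out.

Let qdom : GRing.integral_domain_axiom Q.
Proof. exact: (@Quotient.rquot_IdomainAxiom A S). Qed.

HB.instance Definition _ := GRing.ComUnitRing_isIntegral.Build Q qdom.

(** Used twice: for the ideal of a variety, where the field is its function field, and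
    for an ideal produced by Zorn's lemma, where it carries the specialized generic
    point of a smaller variety. *)
Lemma residue_field_exists :
  exists (K : fieldType) (pi : {rmorphism A -> K}),
    (forall a, pi a = 0 <-> I a) /\
    forall z, exists a b, pi b != 0 /\ z = pi a / pi b.
Proof.
pose pi0 : {rmorphism A -> Q} := (\pi_(Quotient.quot (S : idealr A)))%qT.
pose tf : {rmorphism Q -> {fraction Q}} := @FracField.tofrac Q.
exists {fraction Q}, (tf \o pi0)%FUN; split=> [a|z].
  rewrite /=; split=> [/eqP|Ia]; last apply/eqP.
    rewrite tofrac_eq0; have -> : (0 : Q) = pi0 0 by rewrite rmorph0.
    by rewrite -Quotient.idealrBE subr0 => /asboolP.
  rewrite tofrac_eq0; have -> : (0 : Q) = pi0 0 by rewrite rmorph0.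
  by rewrite -Quotient.idealrBE subr0; apply/asboolP.
exists (repr (frac (repr z)).1), (repr (frac (repr z)).2).
rewrite /= !reprK; split; first by rewrite tofrac_eq0 denom_ratioP.
apply: (canRL (mulfK _)); first by rewrite tofrac_eq0 denom_ratioP.
rewrite -{1}[z]reprK; unlock FracField.tofrac; rewrite -[LHS]FracField.pi_mul.
apply/eqmodP; rewrite /= FracField.equivfE /FracField.mulf.
by rewrite !numden_Ratio ?mulf_neq0 ?denom_ratioP ?oner_eq0 // !mulr1 mulrC.
Qed.
End ResidueField.

(** * Extension of specializations *)

Lemma classical_minimum (T : Type) (P : T -> Prop) (m : T -> nat) :
  (exists x, P x) -> exists2 x, P x & forall y, P y -> (m x <= m y)%N.
Proof.
move=> [x0 Px0].
have ex : exists n, `[<exists2 x, P x & m x = n>].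
  by exists (m x0); apply/asboolP; exists x0.
case: (ex_minnP ex) => n /asboolP[x Px <-] hmin.
by exists x => // y Py; apply: hmin; apply/asboolP; exists y.
Qed.

(** The degree over [A] may exceed the degree over [K]; dropping the coefficients
    killed by [j] makes the two agree. *)
Lemma truncate_poly (A : comNzRingType) (K : fieldType) (j : {rmorphism A -> K})
    (r : {poly A}) :
  map_poly j r != 0 -> exists r' : {poly A},
    [/\ map_poly j r' = map_poly j r, j (lead_coef r') != 0
      & (size r' <= size r)%N].
Proof.
move=> nz; set s := size (map_poly j r).
have s0 : (0 < s)%N by rewrite size_poly_gt0.
have js : j r`_s.-1 != 0.
  by rewrite -coef_map -lead_coefE lead_coef_eq0.
have rs : r`_s.-1 != 0 by apply: contraNneq js => ->; rewrite rmorph0.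
have sz : size (\poly_(i < s) r`_i) = s by apply: size_poly_eq.
exists (\poly_(i < s) r`_i); split.
- apply/polyP=> i; rewrite coef_map coef_poly; case: ltnP => [_|h].
    by rewrite coef_map.
  by rewrite [RHS]nth_default; first exact: rmorph0.
- by rewrite lead_coefE sz coef_poly prednK // leqnn.
- by rewrite sz size_poly.
Qed.

Section Step.
Variables (F : closedFieldType) (A : comNzRingType) (K : fieldType).
Variables (j : {rmorphism A -> K}) (x : K).

Local Notation ev := (fun r : {poly A} => (map_poly j r).[x]).

Lemma map_poly_kernel (h : {rmorphism A -> F}) (r : {poly A}) :
  (forall a, j a = 0 -> h a = 0) -> map_poly j r = 0 -> map_poly h r = 0.
Proof.
move=> kjh jr; apply/polyP=> i; rewrite coef_map coef0; apply: kjh.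
by rewrite -coef_map jr coef0.
Qed.

(** If no nonzero polynomial kills [x], any value of [x] that is not a root of [b] will
    do.  Otherwise let [p] be the smallest polynomial killing [x].  By the Euclidean
    algorithm the ideal generated by [b] and [p] contains, up to coefficients in the
    kernel of [j], a nonzero constant; hence a root of the specialization of [p] is not a
    root of that of [b], as long as that constant and the leading coefficient of [p]
    survive the specialization. *)
Lemma extend_specialization_step (b : {poly A}) :
  ev b != 0 ->
  exists2 a, j a != 0 &
    forall h : {rmorphism A -> F}, (forall a', j a' = 0 -> h a' = 0) ->
      h a != 0 ->
      exists y, (forall r, ev r = 0 -> (map_poly h r).[y] = 0) /\
                (map_poly h b).[y] != 0.
Proof.
move=> bx.
have ev0 (r : {poly A}) : map_poly j r = 0 -> ev r = 0.
  by move=> ->; rewrite horner0.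
have nzb : map_poly j b != 0 by apply: contraNneq bx => /ev0 ->.
have [alg|trans] := pselect (exists p, j (lead_coef p) != 0 /\ ev p = 0);
  last first.
  have [b' [jb' lb' _]] := truncate_poly nzb.
  exists (lead_coef b') => // h kjh hb.
  have hb0 : map_poly h b' != 0.
    by apply: contraNneq hb => hb0; rewrite lead_coefE -coef_map hb0 coef0.
  have -> : map_poly h b = map_poly h b'.
    apply/eqP; rewrite -subr_eq0 -rmorphB; apply/eqP.
    by apply: map_poly_kernel => //; rewrite rmorphB /= jb' subrr.
  have /closed_nonrootP[y ny] := hb0; exists y; split => // r rx.
  rewrite (map_poly_kernel kjh) ?horner0 //.
  apply/eqP; apply: contrapT => /negP nr; apply: trans.
  have [r' [jr' lr' _]] := truncate_poly nr.
  by exists r'; rewrite lr' jr' rx.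
have [p [lp px] pmin] := classical_minimum (fun p : {poly A} => size p) alg.
have smaller (r : {poly A}) : ev r = 0 -> (size r < size p)%N -> map_poly j r = 0.
  move=> rx sr; apply/eqP; apply: contrapT => /negP nr.
  have [r' [jr' lr' sr']] := truncate_poly nr.
  have : (size p <= size r')%N by apply: pmin; rewrite lr' jr' rx.
  by rewrite leqNgt (leq_ltn_trans sr' sr).
have nzjp : map_poly j p != 0.
  by apply: contraNneq lp => jp0; rewrite lead_coefE -coef_map jp0 coef0.
have nzp : p != 0 by apply: contraNneq nzjp => ->; rewrite rmorph0.
(* The combinations of [b] and [p], up to coefficients in the kernel of [j]. *)
pose comb g := exists UV : {poly A} * {poly A},
  map_poly j g = map_poly j (UV.1 * b + UV.2 * p).
have [g [lg [[V U] /= gE]] gmin] :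
  exists2 g, j (lead_coef g) != 0 /\ comb g &
    forall g', j (lead_coef g') != 0 /\ comb g' -> (size g <= size g')%N.
  apply: classical_minimum; exists p; split=> //; exists (0, 1).
  by rewrite mul0r add0r mul1r.
have nzjg : map_poly j g != 0.
  by apply: contraNneq lg => jp0; rewrite lead_coefE -coef_map jp0 coef0.
have nzg : g != 0 by apply: contraNneq nzjg => ->; rewrite rmorph0.
have divg (r : {poly A}) : comb r -> exists2 k, exists q,
    map_poly j (lead_coef g ^+ k *: r) = map_poly j (q * g) & True.
  move=> [[V' U'] /= rE].
  exists (rscalp r g) => //; exists (rdivp r g).
  rewrite rdivp_eq rmorphD /= [map_poly j (rmodp r g)](_ : _ = 0) ?addr0 //.
  apply/eqP; apply: contrapT => /negP nr.
  have [r' [jr' lr' sr']] := truncate_poly nr.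
  have : (size g <= size r')%N.
    apply: gmin; split=> //.
    exists ((lead_coef g ^+ rscalp r g) *: V' - rdivp r g * V,
            (lead_coef g ^+ rscalp r g) *: U' - rdivp r g * U).
    rewrite jr' /=.
    have -> : rmodp r g = (lead_coef g ^+ rscalp r g) *: r - rdivp r g * g.
      by rewrite rdivp_eq addrC addKr.
    rewrite rmorphB /= -mul_polyC !rmorphM /= rE gE -!rmorphM -rmorphB /=.
    by congr map_poly; rewrite -!mul_polyC; ring.
  by rewrite leqNgt (leq_ltn_trans sr') // ltn_rmodp.
have nlc k : j (lead_coef g ^+ k) != 0 by rewrite rmorphXn expf_neq0.
have gx : ev g != 0.
  have [|k [q qE] _] := divg b; first by exists (1, 0); rewrite mul1r mul0r addr0.
  apply: contraNneq bx => gx0; apply/eqP/(mulfI (nlc k)); rewrite mulr0.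
  have := congr1 (fun r => r.[x]) qE.
  by rewrite map_polyZ hornerZ rmorphM hornerM gx0 mulr0.
(* As [g] divides [p] and does not kill [x], minimality of [p] makes [g] constant. *)
have sg : map_poly j g = (j (lead_coef g))%:P.
  have [|k [q qE] _] := divg p; first by exists (0, 1); rewrite mul1r mul0r add0r.
  have qx : ev q = 0.
    apply: (mulIf gx); rewrite mul0r.
    have := congr1 (fun r => r.[x]) qE.
    by rewrite map_polyZ hornerZ rmorphM hornerM px mulr0.
  have nq : map_poly j q != 0.
    apply/negP => /eqP q0; move: qE; rewrite rmorphM /= q0 mul0r map_polyZ /=.
    by move=> /eqP; rewrite scaler_eq0 (negPf (nlc k)) (negPf nzjp).
  have szp : size (map_poly j p) = size p by rewrite size_map_poly_id0.
  have szg : size (map_poly j g) = size g by rewrite size_map_poly_id0.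
  have sq : (size p <= size (map_poly j q))%N.
    have [r' [jr' lr' sr']] := truncate_poly nq.
    rewrite -jr' size_map_poly_id0 //; apply: pmin; rewrite lr' jr' qx //.
  have /eqP := congr1 (fun r : {poly K} => size r) qE.
  rewrite map_polyZ rmorphM size_mul // size_scale ?nlc // szp szg.
  have sg0 : (0 < size g)%N by rewrite size_poly_gt0.
  move=> /eqP sE; have sg1 : size g = 1%N.
    apply/eqP; rewrite eqn_leq sg0 andbT.
    have : (size (map_poly j q) + size g <= (size p).+1)%N.
      by rewrite sE; case: (size g) sg0 => // s _; rewrite addnS.
    move=> h; rewrite -(leq_add2l (size p)) addn1 (leq_trans _ h) //.
    by rewrite leq_add2r.
  have -> : g = (lead_coef g)%:P by rewrite lead_coefE sg1 /=; apply/size1_polyC/eq_leq.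
  by rewrite map_polyC lead_coefC.
exists (lead_coef p * lead_coef g); first by rewrite rmorphM mulf_neq0.
move=> h kjh; rewrite rmorphM mulf_eq0 negb_or => /andP[hp hg].
have szhp : size (map_poly h p) = size p by rewrite size_map_poly_id0.
have sp1 : size (map_poly h p) != 1%N.
  rewrite szhp; apply/negP => /eqP s1.
  move: px; have -> : p = (lead_coef p)%:P.
    by rewrite lead_coefE s1 /=; apply/size1_polyC/eq_leq.
  by rewrite map_polyC hornerC => /eqP; rewrite (negPf lp).
have /closed_rootP[y /rootP py] := sp1.
exists y; split=> [r rx|].
  have rE := rdivp_eq p r.
  have m0 : map_poly j (rmodp r p) = 0.
    apply: smaller; last by rewrite ltn_rmodp.
    have -> : rmodp r p = (lead_coef p ^+ rscalp r p) *: r - rdivp r p * p.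
      by rewrite rE addrC addKr.
    by rewrite rmorphB /= map_polyZ rmorphM /= hornerD hornerN hornerZ hornerM rx px !mulr0 subr0.
  have /(congr1 (fun q => (map_poly h q).[y])) := rE.
  rewrite rmorphD /= map_polyZ rmorphM /= (map_poly_kernel kjh m0) addr0.
  rewrite hornerZ hornerM py mulr0 => /eqP.
  by rewrite mulf_eq0 rmorphXn expf_eq0 (negPf hp) andbF /= => /eqP.
apply: contraNneq hg => hb0.
have : map_poly h (g - (V * b + U * p)) = 0.
  by apply: map_poly_kernel => //; rewrite rmorphB /= gE subrr.
have : map_poly h (g - (lead_coef g)%:P) = 0.
  by apply: map_poly_kernel => //; rewrite rmorphB /= sg map_polyC /= subrr.
move=> /eqP; rewrite rmorphB /= subr_eq0 map_polyC /= => /eqP e1 /eqP.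
rewrite rmorphB /= subr_eq0 e1 /= => /eqP/(congr1 (fun q => q.[y])).
rewrite rmorphD /= !rmorphM /= hornerD !hornerM hornerC hb0 py !mulr0 addr0.
by move=> ->.
Qed.
End Step.

(** The last variable is the one singled out by [muni]. *)
Lemma mmap_muni (A S : comNzRingType) (N : nat) (j : {rmorphism A -> S})
    (e : 'I_N.+1 -> S) (p : {mpoly A[N.+1]}) :
  mmap j e p =
  (map_poly (mmap j (fun i => e (widen_ord (leqnSn N) i))) (muni p)).[e ord_max].
Proof.
set e' := fun i => _.
rewrite muniE rmorph_sum horner_sum /mmap; apply: eq_bigr => m _ /=.
rewrite map_polyZ /= map_polyXn hornerZ hornerXn mmapZ mmapX -mulrA.
congr (_ * _); rewrite /mmap1 big_ord_recr /=; congr (_ * _).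
by apply: eq_bigr => i _; rewrite mnmE.
Qed.

(** A relative Nullstellensatz, by induction on the number of variables: the last one
    is specialized over the polynomial ring in the others, which is why the ring [A]
    of coefficients is arbitrary. *)
Lemma extend_specialization (F : closedFieldType) (K : fieldType) (N : nat) :
  forall (A : comNzRingType) (j : {rmorphism A -> K}) (e : 'I_N -> K)
    (b : {mpoly A[N]}), mmap j e b != 0 ->
  exists2 a, j a != 0 &
    forall h : {rmorphism A -> F}, (forall a', j a' = 0 -> h a' = 0) ->
      h a != 0 ->
      exists c : 'I_N -> F, (forall r, mmap j e r = 0 -> mmap h c r = 0) /\
                mmap h c b != 0.
Proof.
elim: N => [|N IH] A j e b be.
  have bC : forall r : {mpoly A[0]}, r = (r@_0%MM)%:MP.
    move=> r; apply/mpolyP => m; rewrite mcoeffC.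
    have -> : m = 0%MM by apply/mnmP; case.
    by rewrite eqxx mulr1.
  exists b@_0%MM; first by rewrite [b]bC mmapC in be.
  move=> h kjh hb; exists (fun=> 0); split=> [r|]; rewrite [X in mmap _ _ X]bC mmapC //.
  rewrite (bC r) mmapC mcoeffC eqxx mulr1; exact: kjh.
pose w := widen_ord (leqnSn N).
pose j' : {rmorphism {mpoly A[N]} -> K} := mmap j (fun i => e (w i)).
move: be; rewrite mmap_muni => be.
have [a' ja' ha'] := @extend_specialization_step F _ _ j' (e ord_max) (muni b) be.
have [a ja ha] := IH A j _ a' ja'.
exists a => // h kjh hna; have [c' [c'r c'a]] := ha h kjh hna.
pose h' : {rmorphism {mpoly A[N]} -> F} := mmap h c'.
have [y [yr yb]] := ha' h' c'r c'a.
pose c i := if unlift ord_max i is Some i' then c' i' else y.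
have cE (r : {mpoly A[N.+1]}) : mmap h c r = (map_poly h' (muni r)).[y].
  rewrite mmap_muni /c unlift_none; congr (map_poly _ _).[_].
  apply: funext => q; congr (mmap _ _ q); apply: funext => i.
  have -> : widen_ord (leqnSn N) i = lift ord_max i.
    by apply: val_inj; rewrite /= /bump leqNgt ltn_ord.
  by rewrite liftK.
exists c; split=> [r rx|]; rewrite cE //.
by apply: yr; rewrite -mmap_muni.
Qed.

Lemma rmorph_mmap (A S : comNzRingType) (N : nat)
    (pi : {rmorphism {mpoly A[N]} -> S}) (r : {mpoly A[N]}) :
  pi r = mmap (pi \o @mpolyC N A) (fun i => pi 'X_i) r.
Proof.
rewrite [in LHS](mpolyE r) rmorph_sum; apply: eq_bigr => m _ /=.
rewrite -mul_mpolyC rmorphM; congr (_ * _).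
by rewrite mpolyXE_id rmorph_prod; apply: eq_bigr => i _; rewrite rmorphXn.
Qed.

Lemma rmorph_mpoly_eq (A S : comNzRingType) (N : nat)
    (f g : {rmorphism {mpoly A[N]} -> S}) :
  (forall a, f a%:MP = g a%:MP) -> (forall i, f 'X_i = g 'X_i) -> f =1 g.
Proof.
move=> fgC fgX r; rewrite [LHS]rmorph_mmap [RHS]rmorph_mmap.
rewrite /mmap; apply: eq_bigr => m _ /=; rewrite fgC; congr (_ * mmap1 _ _).
exact: funext.
Qed.

Lemma mpoly_ring_ind (A : comNzRingType) (N : nat) (S : {mpoly A[N]} -> Prop) :
  (forall c, S c%:MP) -> (forall i, S 'X_i) ->
  (forall p q, S p -> S q -> S (p + q)) -> (forall p q, S p -> S q -> S (p * q)) ->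
  forall p, S p.
Proof.
move=> SC SX SD SM p; rewrite (mpolyE p); apply: (big_ind S) => [|//|m _].
  by rewrite -mpolyC0.
rewrite -mul_mpolyC; apply: (SM _ _) => //.
rewrite mpolyXE_id; apply: (big_ind S) => [|//|i _]; first by rewrite -mpolyC1.
elim: (m i) => [|k IH]; first by rewrite expr0 -mpolyC1.
by rewrite exprS; apply: (SM _ _).
Qed.

Section PrimeAvoidance.
Variables (R : comNzRingType) (J0 S : R -> Prop).
Hypotheses (J00 : J0 0) (J0D : forall a b, J0 a -> J0 b -> J0 (a + b)).
Hypothesis J0M : forall a b, J0 b -> J0 (a * b).
Hypothesis SM : forall a b, S a -> S b -> S (a * b).
Hypothesis J0S : forall a, J0 a -> ~ S a.

(** An ideal maximal among those that contain [J0] and avoid the multiplicative set [S]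
    is prime. *)
Lemma prime_avoiding_exists :
  exists J : R -> Prop,
    [/\ [/\ J 0, forall a b, J a -> J b -> J (a + b) &
            forall a b, J b -> J (a * b)],
        forall a, J0 a -> J a, forall a, J a -> ~ S a &
        forall a b, J (a * b) -> J a \/ J b].
Proof.
(* Zorn's lemma is applied to sets [B] such that the union of [J0] and [B] is an ideal,
   so that the empty chain is bounded. *)
pose T (B : R -> Prop) := fun r => J0 r \/ B r.
pose P (B : R -> Prop) := [/\ forall a b, T B a -> T B b -> T B (a + b),
  forall a b, T B b -> T B (a * b) & forall a, T B a -> ~ S a].
have [|B [[BD BM BS] Bmax]] := @classical_sets.Zorn_bigcup R P.
  move=> C CP Ctot.
  have big2 a b : T (classical_sets.bigcup C id) a -> T (classical_sets.bigcup C id) b ->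
      (J0 a /\ J0 b) \/ exists2 X, C X & T X a /\ T X b.
    case=> [Ja|[X CX Xa]]; case=> [Jb|[Y CY Yb]].
    - by left.
    - by right; exists Y => //; split; [left|right].
    - by right; exists X => //; split; [right|left].
    - have [XY|YX] := Ctot X Y CX CY.
        by right; exists Y => //; split; right => //; apply: XY.
      by right; exists X => //; split; right => //; apply: YX.
  have up X a : C X -> T X a -> T (classical_sets.bigcup C id) a.
    by move=> CX [Ja|Xa]; [left|right; exists X].
  split=> [a b Ta Tb|a b Tb|a Ta].
  - have [[Ja Jb]|[X CX [Xa Xb]]] := big2 a b Ta Tb; first by left; apply: J0D.
    by have [XD _ _] := CP X CX; apply: (up X) => //; apply: XD.
  - have [[Jb _]|[X CX [Xb _]]] := big2 b b Tb Tb; first by left; apply: J0M.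
    by have [_ XM _] := CP X CX; apply: (up X) => //; apply: XM.
  - have [[Ja _]|[X CX [Xa _]]] := big2 a a Ta Ta; first exact: J0S.
    by have [_ _ XS] := CP X CX; apply: XS.
exists (T B); split=> [||//|a b Tab]; [by split=> //; left | by left |].
apply: contrapT => /not_orP[nTa nTb].
have meet x : ~ T B x -> exists t u, T B t /\ S (t + u * x).
  move=> nTx; pose Tx r := exists t u, T B t /\ r = t + u * x.
  apply: contrapT => nS.
  have TTx r : T Tx r -> Tx r.
    by case=> // Jr; exists r, 0; rewrite mul0r addr0; split=> //; left.
  apply: (Bmax Tx).
    split=> [r Br|sub]; first by exists r, 0; rewrite mul0r addr0; split=> //; right.
    apply: nTx; right; apply: sub; exists 0, 1; rewrite mul1r add0r; split=> //.
    by left.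
  split=> [r r' /TTx[t [u [Tt ->]]] /TTx[t' [u' [Tt' ->]]]|r r' /TTx[t [u [Tt ->]]]|].
  - right; exists (t + t'), (u + u'); split; first exact: BD.
    by rewrite mulrDl addrACA.
  - right; exists (r * t), (r * u); split; first exact: BM.
    by rewrite mulrDr mulrA.
  - by move=> r /TTx[t [u [Tt ->]]] St; apply: nS; exists t, u.
have [t [u [Tt St]]] := meet a nTa; have [t' [u' [Tt' St']]] := meet b nTb.
apply: (BS ((t + u * a) * (t' + u' * b))); last exact: SM.
have -> : (t + u * a) * (t' + u' * b) =
   (t' + u' * b) * t + ((u * a) * t' + (u * u') * (a * b)) by ring.
by apply: (BD _ _); [apply: BM | apply: (BD _ _); apply: (BM _ _)].
Qed.
End PrimeAvoidance.

Section SpecializeTranscendental.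
Variables (F : closedFieldType) (N : nat) (K : fieldType).
Variables (iota : {rmorphism F -> K}) (e : 'I_N -> K).
Variables (B : idomainType) (iB : {rmorphism F -> B}).
Variable s : {rmorphism {poly B} -> {mpoly F[N]}}.
Hypothesis sC : forall c, s (iB c)%:P = c%:MP.
Hypothesis s_inj : forall p, mmap iota e (s p) = 0 -> p = 0.
Hypothesis pts : forall b : B, b != 0 ->
  exists2 h : {rmorphism B -> F}, forall c, h (iB c) = c & h b != 0.

(** A hyperplane section.  The generic point [e] carries a function [s 'X] that is
    transcendental over the domain [B] of functions; for a suitable constant [c], imposing
    [s 'X = c] leaves no relation among the elements of [B].  A relation [b] would put
    [s b] in the ideal of [s 'X - c], hence make [b a(c)] vanish at every point of [B],
    where [a] is the exceptional element of [extend_specialization]; so [c] is taken off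
    the roots of [a], and a prime ideal containing [s 'X - c] and avoiding the nonzero
    elements of [B] gives the new generic point. *)
Lemma specialize_transcendental :
  exists (c : F) (K' : fieldType) (iota' : {rmorphism F -> K'}) (e' : 'I_N -> K'),
    [/\ forall r, mmap iota e r = 0 -> mmap iota' e' r = 0,
        mmap iota' e' (s 'X) = iota' c
      & forall b : B, mmap iota' e' (s b%:P) = 0 -> b = 0].
Proof.
pose pi : {rmorphism {mpoly F[N]} -> K} := mmap iota e.
pose j : {rmorphism {poly B} -> K} := pi \o s.
have [|a ja ha] := @extend_specialization F K N {poly B} j e 1.
  by rewrite rmorph1 oner_eq0.
have a0 : a != 0 by apply: contraNneq ja => ->; rewrite rmorph0.
have horn (h : {rmorphism B -> F}) c p : (forall c, h (iB c) = c) ->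
    (map_poly h p).[c] = h p.[iB c].
  by move=> hc; rewrite -horner_map hc.
have [c ac] : exists c, a.[iB c] != 0.
  have [|h hc hl] := pts (b := lead_coef a); first by rewrite lead_coef_eq0.
  have : map_poly h a != 0.
    by apply: contraNneq hl => h0; rewrite lead_coefE -coef_map h0 coef0.
  case/closed_nonrootP => c nr; exists c.
  by apply: contraNneq nr => ac0; rewrite rootE horn // ac0 rmorph0.
pose x : {mpoly F[N]} := s 'X - c%:MP.
pose J0 r := exists u, pi r = pi (u * x).
pose S r := exists2 b : B, b != 0 & pi r = pi (s b%:P).
have J0S r : J0 r -> ~ S r.
  move=> [u ru] [b b0 rb].
  have [|h hc hb] := pts (b := b * a.[iB c]); first by rewrite mulf_neq0.
  pose hA : {rmorphism {poly B} -> F} := horner_eval c \o map_poly h.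
  have hAE p : hA p = h p.[iB c] by rewrite /hA /= /horner_eval horn.
  have hAker p : j p = 0 -> hA p = 0 by move/s_inj => ->; rewrite rmorph0.
  have [|c' [c'r _]] := ha hA hAker.
    by rewrite hAE; apply: contraNneq hb => h0; rewrite rmorphM h0 mulr0.
  pose mu (p : {mpoly F[N]}) : {mpoly {poly B}[N]} :=
    map_mpoly (polyC \o iB) p.
  have muC (p : F) : mu p%:MP = ((iB p)%:P)%:MP by rewrite /mu map_mpolyC.
  have muX i : mu 'X_i = 'X_i by rewrite /mu map_mpolyX.
  have jmu r0 : mmap j e (mu r0) = pi r0.
    pose g : {rmorphism {mpoly F[N]} -> K} := mmap j e \o (map_mpoly (polyC \o iB)).
    apply: (@rmorph_mpoly_eq _ _ _ g) => [p|i]; rewrite /g /=.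
      by rewrite map_mpolyC /= mmapC /j /= sC.
    by rewrite map_mpolyX /pi /= !mmapX !mmap1U.
  pose hmu : {rmorphism {mpoly F[N]} -> F} := mmap hA c' \o (map_mpoly (polyC \o iB)).
  have hC p : hmu p%:MP = p.
    by rewrite /hmu /= map_mpolyC mmapC [LHS]hAE /= hornerC hc.
  have hs p : hmu (s p) = hA p.
    apply/eqP; rewrite -subr_eq0; apply/eqP; rewrite /hmu /=.
    rewrite -[X in _ - X](mmapC c' hA) -rmorphB; apply: c'r.
    rewrite rmorphB /= mmapC jmu; exact: subrr.
  have hpi r0 : pi r0 = 0 -> hmu r0 = 0 by move=> pr0; apply: c'r; rewrite jmu.
  have : hmu (s b%:P - u * x) = 0.
    by apply: hpi; rewrite rmorphB -rb ru subrr.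
  rewrite rmorphB rmorphM [hmu x]rmorphB hC !hs !hAE hornerX hc subrr mulr0 subr0.
  by rewrite hornerC => hb0; move: hb; rewrite rmorphM hb0 mul0r eqxx.
have [|||||J [[J'0 J'D J'M] J0J JS Jpr]] := @prime_avoiding_exists _ J0 S.
- by exists 0; rewrite mul0r.
- by move=> a1 b1 [u1 E1] [u2 E2]; exists (u1 + u2); rewrite mulrDl [LHS]rmorphD [RHS]rmorphD E1 E2.
- by move=> a1 b1 [u1 E1]; exists (a1 * u1); rewrite -mulrA [LHS]rmorphM [RHS]rmorphM E1.
- move=> a1 b1 [u1 n1 E1] [u2 n2 E2]; exists (u1 * u2); first by rewrite mulf_neq0.
  by rewrite polyCM [LHS]rmorphM E1 E2 -!rmorphM.
- exact: J0S.
have [|K' [pi' [kpi' _]]] := residue_field_exists J'0 J'D J'M _ Jpr.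
  move=> J1; apply: (JS 1) => //; exists 1; first exact: oner_neq0.
  by rewrite [s _]rmorph1.
have piE r : mmap (pi' \o @mpolyC N F) (fun i => pi' 'X_i) r = pi' r.
  by rewrite [RHS]rmorph_mmap.
exists c, K', (pi' \o @mpolyC N F), (fun i => pi' 'X_i); split=> [r r0||b b0].
- by rewrite piE; apply/kpi'/J0J; exists 0; rewrite mul0r rmorph0.
- rewrite piE; apply/eqP; rewrite /= -subr_eq0 -rmorphB; apply/eqP/kpi'/J0J.
  by exists 1; rewrite mul1r.
- move: b0; rewrite piE => /kpi' Jb; apply/eqP; apply: contrapT => /negP nb.
  by apply: (JS _ Jb); exists b.
Qed.
End SpecializeTranscendental.

(** * Generic points and chains *)

Section Tower.
Variable F : closedFieldType.

(** Polynomials in [d] variables, nested because the variables are specialized one at a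
    time, starting with the last. *)
Fixpoint tower (d : nat) : idomainType :=
  if d is d'.+1 then {poly (tower d')} : idomainType else F : idomainType.

Fixpoint tower_const (d : nat) : {rmorphism F -> tower d} :=
  match d return {rmorphism F -> tower d} with
  | 0 => (@idfun F : {rmorphism F -> F})
  | d'.+1 => ((polyC : {rmorphism tower d' -> {poly tower d'}}) \o tower_const d')
  end.

Fixpoint tower_eval (T : comNzRingType) (f : {rmorphism F -> T}) (u : nat -> T)
    (d : nat) : {rmorphism tower d -> T} :=
  match d return {rmorphism tower d -> T} with
  | 0 => f
  | d'.+1 => (horner_eval (u d') \o map_poly (tower_eval f u d') :
               {rmorphism {poly tower d'} -> T})
  end.

Lemma tower_eval_const T f u d c :
  @tower_eval T f u d (tower_const d c) = f c.
Proof.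
by elim: d => //= d IH; rewrite map_polyC /horner_eval hornerC.
Qed.

Lemma tower_eval_comp (T T' : comNzRingType) (g : {rmorphism T -> T'}) f u d b :
  g (@tower_eval T f u d b) = @tower_eval T' (g \o f) (g \o u) d b.
Proof.
elim: d b => //= d IH b; rewrite /horner_eval -horner_map; congr (_.[_]).
by apply/polyP => i; rewrite !coef_map /=.
Qed.

Lemma eq_tower_eval (T : comNzRingType) (f f' : {rmorphism F -> T}) u u' d b :
  f =1 f' -> (forall k, (k < d)%N -> u k = u' k) ->
  tower_eval f u d b = tower_eval f' u' d b.
Proof.
move=> ff'; elim: d b => [|d IH] b uu' /=; first exact: ff'.
rewrite /horner_eval uu' //; congr (_.[_]).
by apply/polyP => i; rewrite !coef_map /= IH // => k kd; apply: uu'; apply: ltnW.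
Qed.

Lemma tower_point d (b : tower d) : b != 0 ->
  exists2 h : {rmorphism tower d -> F}, forall c, h (tower_const d c) = c
    & h b != 0.
Proof.
elim: d b => [|d IH] b b0; first by exists (@idfun F : {rmorphism F -> F}).
have [|h hc hb] := IH (lead_coef (b : {poly tower d})); first by rewrite lead_coef_eq0.
have : map_poly h b != 0.
  by apply: contraNneq hb => h0; rewrite lead_coefE -coef_map h0 coef0.
case/closed_nonrootP => y ny.
exists (horner_eval y \o map_poly h : {rmorphism {poly tower d} -> F}) => //.
by move=> c /=; rewrite map_polyC /horner_eval hornerC; apply: hc.
Qed.
End Tower.

Lemma mmap_comp (A T : comNzRingType) (n N : nat) (f : {rmorphism A -> T})
    (g : {rmorphism {mpoly A[N]} -> T}) (x : 'I_n -> {mpoly A[N]}) p :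
  (forall a, g a%:MP = f a) ->
  g (mmap (@mpolyC N A) x p) = mmap f (fun i => g (x i)) p.
Proof.
move=> gC; rewrite /mmap rmorph_sum; apply: eq_bigr => m _.
rewrite rmorphM gC /mmap1 rmorph_prod; congr (_ * _).
by apply: eq_bigr => i _; rewrite rmorphXn.
Qed.

Section Homogenize.
Variables (F : fieldType) (n : nat) (i0 : 'I_n) (kappa : F).
Hypothesis kappa0 : kappa != 0.

(** The chart is [x_i0 = kappa] rather than [x_i0 = 1] so that the coordinates of a
    given point can be used as they are. *)
Definition homogenize (p : {mpoly F[n]}) : {mpoly F[n]} :=
  \sum_(m <- msupp p) p@_m *: 'X_[m] * (kappa^-1 *: 'X_i0) ^+ (msize p - mdeg m).

Lemma homogenize_homog p : homogenize p \is (msize p).-homog.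
Proof.
rewrite /homogenize big_seq; apply: rpred_sum => m mp.
rewrite -scalerAl; apply: rpredZ.
set k := (msize p - mdeg m)%N.
have -> : msize p = (mdeg m + 1 * k)%N.
  by rewrite mul1n subnKC // ltnW // msize_mdeg_lt.
apply: dhomogM; first by rewrite dhomogX.
apply: dhomogMn; apply: rpredZ.
by rewrite dhomogX /= mdeg1.
Qed.

Lemma homogenizeE (T : comNzRingType) (f : {rmorphism F -> T}) (x : 'I_n -> T) p :
  x i0 = f kappa -> mmap f x (homogenize p) = mmap f x p.
Proof.
move=> xi0; rewrite rmorph_sum /= [in RHS](mpolyE p) [RHS]rmorph_sum /=.
apply: eq_bigr => m _; rewrite rmorphM rmorphXn /= [X in _ * X ^+ _](_ : _ = 1).
  by rewrite expr1n mulr1.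
by rewrite mmapZ mmapX mmap1U xi0 -rmorphM mulVf // rmorph1.
Qed.

End Homogenize.

Section Locus.
Variables (R : realType) (n : nat).
Local Notation F := R[i].
Implicit Types (K : fieldType).

(** The closure of a point with coordinates in an extension field. *)
Definition locus K (iota : {rmorphism F -> K}) (tau : 'I_n.+1 -> K) :
    'rV[F]_n.+1 -> Prop :=
  fun y => y != 0 /\
    forall p : {mpoly F[n.+1]}, homogeneous p -> mmap iota tau p = 0 -> p.@[y 0] = 0.

Lemma locus_closed K (iota : {rmorphism F -> K}) tau :
  zariski_closed (locus iota tau).
Proof.
exists (fun p => homogeneous p /\ mmap iota tau p = 0); split=> [p []//|x].
by split=> [[x0 hx]|[x0 hx]]; split=> // p; [case; apply: hx|move=> hp p0; apply: hx].
Qed.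

Variables (i0 : 'I_n.+1) (kappa : F).
Hypothesis kappa0 : kappa != 0.

(** The Nullstellensatz: the generic point specializes to a point of the chart off any
    hypersurface that does not contain it. *)
Lemma locus_point K (iota : {rmorphism F -> K}) (tau : 'I_n.+1 -> K) p :
  tau i0 = iota kappa -> mmap iota tau p != 0 ->
  exists y : 'rV[F]_n.+1, [/\ locus iota tau y, y 0 i0 = kappa & p.@[y 0] != 0].
Proof.
move=> ti0 /(@extend_specialization F)[a ja].
have kid a' : iota a' = 0 -> (@idfun F) a' = 0.
  by move=> /eqP; rewrite fmorph_eq0 => /eqP.
move=> /(_ (@idfun F) kid)[|c [cr cp]].
  by apply: contraNneq ja => /= ->; rewrite rmorph0.
have cE q : q.@[(\row_i c i) 0] = mmap idfun c q.
  by rewrite /meval; congr (mmap _ _ q); apply: funext => i; rewrite mxE.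
have ci0 : c i0 = kappa.
  have := cr ('X_i0 - kappa%:MP); rewrite !rmorphB /= !mmapX !mmapC !mmap1U ti0.
  by rewrite subrr => /(_ erefl)/eqP; rewrite subr_eq0 => /eqP.
exists (\row_i c i); split; rewrite ?mxE ?cE //; split=> [|q _ q0].
  by apply: contraNneq kappa0 => /rowP/(_ i0); rewrite !mxE ci0 => ->.
by rewrite cE; apply: cr.
Qed.

Lemma homogenize_homogeneous (p : {mpoly F[n.+1]}) :
  homogeneous (homogenize i0 kappa p).
Proof. by exists (msize p); apply: homogenize_homog. Qed.

Lemma locus_vanish K (iota : {rmorphism F -> K}) (tau : 'I_n.+1 -> K) p y :
  tau i0 = iota kappa -> mmap iota tau p = 0 -> locus iota tau y ->
  y 0 i0 = kappa -> p.@[y 0] = 0.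
Proof.
move=> ti0 p0 [_ Ly] yi0.
rewrite /meval -(@homogenizeE _ _ i0 kappa _ F idfun) //.
by apply: Ly; [exact: homogenize_homogeneous | rewrite homogenizeE].
Qed.

Lemma locus_irreducible K (iota : {rmorphism F -> K}) tau :
  tau i0 = iota kappa -> irreducible (locus iota tau).
Proof.
move=> ti0; split=> [|Z1 Z2 [S1 [S1h Z1E]] [S2 [S2h Z2E]] cov].
  have [|y [Ly _ _]] := @locus_point K iota tau 1 ti0; last by exists y.
  by rewrite rmorph1 oner_eq0.
have get (Z : 'rV[F]_n.+1 -> Prop) (S : {mpoly F[n.+1]} -> Prop) : (forall p, S p -> homogeneous p) ->
    (forall x, Z x <-> x != 0 /\ forall p, S p -> p.@[x 0] = 0) ->
    ~ included (locus iota tau) Z -> exists2 p, S p & mmap iota tau p != 0.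
  move=> Sh ZE nZ; apply: contrapT => nS; apply: nZ => x [x0 Lx].
  apply/ZE; split=> // p Sp; apply: Lx; first exact: Sh.
  by apply/eqP; apply: contrapT => /negP np; apply: nS; exists p.
apply: contrapT => /not_orP[/(get _ _ S1h Z1E)[p S1p p0] /(get _ _ S2h Z2E)[q S2q q0]].
have [|y [Ly _ pq]] := @locus_point K iota tau (p * q) ti0.
  by rewrite rmorphM mulf_neq0.
move: pq; rewrite mevalM mulf_eq0 negb_or => /andP[py qy].
by case: (cov _ Ly) => [/Z1E[_ /(_ _ S1p)]|/Z2E[_ /(_ _ S2q)]] /eqP;
  rewrite ?(negPf py) ?(negPf qy).
Qed.

(** Each step imposes the value [c] on the last of the independent functions.  The locus
    of the new generic point is strictly smaller because it satisfies [p = c q], where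
    [p / q] is the function specialized; the element [v], an inverse of [q] that survives
    the specialization, guarantees that [q] does not vanish on it. *)
Lemma chain_of_tower d : forall (N : nat) (K : fieldType) (iota : {rmorphism F -> K})
    (e : 'I_N -> K) (x : 'I_n.+1 -> {mpoly F[N]}) (u : nat -> {mpoly F[N]}),
  mmap iota e (x i0) = iota kappa ->
  (forall b, mmap iota e (tower_eval (@mpolyC N F) u d b) = 0 -> b = 0) ->
  (forall k, (k < d)%N -> exists p q v,
     mmap iota e (u k * mmap (@mpolyC N F) x q - mmap (@mpolyC N F) x p) = 0 /\
     mmap iota e (mmap (@mpolyC N F) x q * v - 1) = 0) ->
  chain_in (locus iota (fun i => mmap iota e (x i))) d.
Proof.
elim: d => [|d IH] N K iota e x u xi0 uinj ufrac.
  exists (fun=> locus iota (fun i => mmap iota e (x i))); split=> //= i _.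
  by split; [apply: locus_closed | apply: locus_irreducible].
have [|c [K' [iota' [e' [ker uc inj']]]]] :=
  @specialize_transcendental F N K iota e (tower F d) (tower_const F d)
    (tower_eval (@mpolyC N F) u d.+1) _ uinj (@tower_point F d).
  by move=> c /=; rewrite map_polyC /horner_eval hornerC; apply: tower_eval_const.
rewrite /= map_polyX /horner_eval hornerX in uc.
have xi0' : mmap iota' e' (x i0) = iota' kappa.
  have := ker (x i0 - kappa%:MP); rewrite !rmorphB /= !mmapC xi0 subrr => /(_ erefl)/eqP.
  by rewrite subr_eq0 => /eqP.
have [|k kd|W' [W'ci W'inc W'top]] := IH N K' iota' e' x u xi0'.
- by move=> b b0; apply: inj'; rewrite /= map_polyC /horner_eval hornerC.
- have [p [q [v [h1 h2]]]] := ufrac k (ltnW kd).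
  by exists p, q, v; split; apply: ker.
set tau := fun i => _; pose tau' i := mmap iota' e' (x i).
have xE (T : fieldType) (f : {rmorphism F -> T}) y p :
   mmap f y (mmap (@mpolyC N F) x p) = mmap f (fun i => mmap f y (x i)) p.
  pose g : {rmorphism {mpoly F[N]} -> T} := mmap f y.
  by apply: (@mmap_comp _ _ _ _ f g) => a; apply: mmapC.
have sub : included (locus iota' tau') (locus iota tau).
  by move=> y [y0 Ly]; split=> // p hp p0; apply: Ly => //; rewrite -xE; apply: ker; rewrite xE.
have nsub : ~ included (locus iota tau) (locus iota' tau').
  have [p [q [v [h1 h2]]]] := ufrac d (ltnSn d).
  have r'0 : mmap iota' tau' (p - c *: q) = 0.
    move: (ker _ h1); rewrite rmorphB rmorphM /= uc => /eqP.
    by rewrite subr_eq0 rmorphB /= mmapZ -!xE => /eqP ->; rewrite subrr.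
  have r0 : mmap iota tau (p - c *: q) != 0.
    apply/negP => /eqP r0.
    have udq : mmap iota e (u d - c%:MP) * mmap iota e (mmap (@mpolyC N F) x q) = 0.
      move: r0; rewrite rmorphB /= mmapZ -!xE => r0.
      move: h1; rewrite rmorphB rmorphM /= => /eqP; rewrite subr_eq0 => /eqP h1.
      by rewrite rmorphB /= mulrBl h1 mmapC.
    have qv : mmap iota e (mmap (@mpolyC N F) x q) != 0.
      apply/negP => /eqP q0; move: h2; rewrite rmorphB rmorphM rmorph1 /= q0 mul0r sub0r.
      by move=> /eqP; rewrite oppr_eq0 oner_eq0.
    pose b : {poly (tower F d)} := 'X - (tower_const F d c)%:P.
    have bE : tower_eval (@mpolyC N F) u d.+1 b = u d - c%:MP.
      rewrite /b rmorphB /= map_polyX map_polyC /horner_eval hornerX hornerC.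
      by congr (_ - _); apply: tower_eval_const.
    have := uinj b; rewrite bE => H.
    have /H/eqP : mmap iota e (u d - c%:MP) = 0 by apply: (mulIf qv); rewrite mul0r.
    by rewrite polyXsubC_eq0.
  move=> inc; have [y [Ly yi0 ry]] := locus_point xi0 r0.
  by move: ry; rewrite (locus_vanish xi0' r'0 (inc _ Ly) yi0) eqxx.
exists (fun i => if (i <= d)%N then W' i else locus iota tau); split.
- move=> i id1; case: ifP => [id|_]; first exact: W'ci.
  by split; [apply: locus_closed | apply: locus_irreducible].
- move=> i id; rewrite -ltnS id; case: ltnP => [lt|ge]; first exact: W'inc.
  have -> : i = d by apply/eqP; rewrite eqn_leq -ltnS id ge.
  split=> [y /W'top/sub //|inc]; apply: nsub => y /inc; exact: W'top.
- by rewrite ltnn.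
Qed.

(** The dimension of a variety bounds the transcendence degree of its function field. *)
Lemma dependent_of_no_chain d K (iota : {rmorphism F -> K})
    (tau : 'I_n.+1 -> K) (z : nat -> K) :
  tau i0 = iota kappa -> ~ chain_in (locus iota tau) d ->
  (forall k, (k < d)%N -> exists p q : {mpoly F[n.+1]},
     mmap iota tau q != 0 /\ z k = mmap iota tau p / mmap iota tau q) ->
  exists2 b : tower F d, b != 0 & tower_eval iota z d b = 0.
Proof.
move=> ti0 nch zfrac; apply: contrapT => nb; apply: nch.
have [q q0 zq] : exists2 q : {mpoly F[n.+1]}, mmap iota tau q != 0 &
    forall k, (k < d)%N -> exists p, z k = mmap iota tau p / mmap iota tau q.
  elim: d {nb} zfrac => [|d IH] zfrac; first by exists 1; rewrite ?rmorph1 ?oner_eq0.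
  have [k kd|q q0 zq] := IH; first by apply: zfrac; apply: ltnW.
  have [p' [q' [q'0 zd]]] := zfrac d (ltnSn d).
  exists (q * q'); first by rewrite rmorphM mulf_neq0.
  move=> k; rewrite ltnS leq_eqVlt => /predU1P[->|/zq[p ->]].
    by exists (p' * q); rewrite zd !rmorphM /= (mulrC (mmap iota tau q)) -mulf_div divff ?mulr1.
  by exists (p * q'); rewrite !rmorphM /= -mulf_div divff ?mulr1.
have [p pE] : exists p : nat -> {mpoly F[n.+1]}, forall k, (k < d)%N ->
    z k = mmap iota tau (p k) / mmap iota tau q.
  have [k|p pE] := @choice _ _ (fun k (p : {mpoly F[n.+1]}) => (k < d)%N ->
    z k = mmap iota tau p / mmap iota tau q); last by exists p.
  by case: (ltnP k d) => [/zq[p pE]|_]; [exists p | exists 0].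
(* An extra coordinate, the inverse of a common denominator [q], makes every [z k] a
   polynomial function of the generic point. *)
pose w := widen_ord (leqnSn n.+1).
pose e i := if unlift ord_max i is Some i' then tau i' else (mmap iota tau q)^-1.
pose x i : {mpoly F[n.+2]} := 'X_(w i).
have ew i : e (w i) = tau i.
  have -> : w i = lift ord_max i.
    by apply: val_inj; rewrite /= /bump leqNgt ltn_ord.
  by rewrite /e liftK.
pose u k := mmap (@mpolyC n.+2 F) x (p k) * 'X_ord_max.
pose pi : {rmorphism {mpoly F[n.+2]} -> K} := mmap iota e.
have piC c : pi c%:MP = iota c by apply: mmapC.
have pix i : pi (x i) = tau i by rewrite /pi /= mmapX mmap1U ew.
have pip r : pi (mmap (@mpolyC n.+2 F) x r) = mmap iota tau r.
  rewrite (@mmap_comp _ _ _ _ iota pi) //; congr (mmap _ _ r); apply: funext => i.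
  exact: pix.
have piy : pi 'X_ord_max = (mmap iota tau q)^-1.
  by rewrite /pi /= mmapX mmap1U /e unlift_none.
have piu k : (k < d)%N -> pi (u k) = z k.
  by move=> kd; rewrite [LHS]rmorphM pip piy pE.
have -> : tau = fun i => mmap iota e (x i) by apply: funext => i; rewrite -pix.
apply: (@chain_of_tower d n.+2 K iota e x u).
- by rewrite -[LHS]/(pi _) pix.
- move=> b; rewrite -[mmap _ _ _]/(pi _) tower_eval_comp => b0.
  apply: contrapT => nb0; apply: nb; exists b; first exact/eqP.
  rewrite -b0; apply: eq_tower_eval => [c|k kd] /=; first exact/esym/piC.
  exact/esym/piu.
- move=> k kd; exists (p k), q, 'X_ord_max.
  split.
    have: pi (u k * mmap (@mpolyC _ F) x q - mmap (@mpolyC _ F) x (p k)) = 0.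
      rewrite rmorphB rmorphM (piu k kd) [X in _ - X]pip [X in _ * X - _]pip.
      by rewrite (pE k kd) divfK // subrr.
    exact.
  rewrite -[LHS]/(pi (mmap (@mpolyC _ F) x q * 'X_ord_max - 1)).
  by rewrite rmorphB rmorphM rmorph1 !pip piy divff // subrr.
Qed.
End Locus.

(** * Subfields and homomorphisms *)

Section Subfield.
Variables (K : fieldType) (P : K -> Prop).
Hypotheses (P1 : P 1) (PB : forall x y, P x -> P y -> P (x - y)).
Hypothesis PV : forall x y, P x -> P y -> P (x / y).

Definition in_subfield : {pred K} := fun x => `[<P x>].
Local Notation S := in_subfield.

Let S_closed : divring_closed S.
Proof.
split; first exact/asboolP.
- by move=> x y /asboolP Px /asboolP Py; apply/asboolP/PB.
- by move=> x y /asboolP Px /asboolP Py; apply/asboolP/PV.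
Qed.

HB.instance Definition _ := GRing.isDivringClosed.Build K S S_closed.

Record subfield_of := SubfieldOf { subfield_val : K; _ : subfield_val \in S }.
HB.instance Definition _ := [isSub for subfield_val].
HB.instance Definition _ := [Choice of subfield_of by <:].
HB.instance Definition _ := [SubChoice_isSubIntegralDomain of subfield_of by <:].
HB.instance Definition _ := [SubIntegralDomain_isSubField of subfield_of by <:].

Lemma subfield_type_exists :
  exists (E : fieldType) (j : {rmorphism E -> K}), forall x, (exists e, j e = x) <-> P x.
Proof.
exists (subfield_of : fieldType), (val : {rmorphism subfield_of -> K}) => x.
split=> [[e <-]|Px]; first exact/asboolP/(valP e).
by exists (SubfieldOf (asboolT Px)).
Qed.
End Subfield.

Lemma lift_to_fractions (A : comNzRingType) (E K : fieldType)
    (pi : {rmorphism A -> E}) (f : {rmorphism A -> K}) :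
  (forall z, exists a b, pi b != 0 /\ z = pi a / pi b) ->
  (forall a, pi a = 0 <-> f a = 0) ->
  exists g : {rmorphism E -> K}, forall a, g (pi a) = f a.
Proof.
move=> frac ker.
have kn a : pi a != 0 -> f a != 0 by apply: contra_neq; apply: (ker a).2.
have [g gE] : exists g : E -> K, forall a b, pi b != 0 -> g (pi a / pi b) = f a / f b.
  have [z|g gP] := @choice _ _ (fun z y => exists a b, [/\ pi b != 0, z = pi a / pi b &
     y = f a / f b]).
    by have [a [b [b0 ->]]] := frac z; exists (f a / f b), a, b.
  exists g => a b b0; have [a' [b' [b'0 e ->]]] := gP (pi a / pi b).
  apply/eqP; rewrite eqr_div ?kn // -!rmorphM -subr_eq0 -rmorphB; apply/eqP/ker/eqP.
  by rewrite rmorphB subr_eq0 !rmorphM -eqr_div // -e.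
have g1 a : g (pi a) = f a.
  by rewrite -[pi a]divr1 -(rmorph1 pi) gE ?rmorph1 ?divr1 ?oner_eq0.
have gB : zmod_morphism g.
  move=> x y; have [a [b [b0 ->]]] := frac x; have [a' [b' [b'0 ->]]] := frac y.
  have -> : pi a / pi b - pi a' / pi b' = pi (a * b' - a' * b) / pi (b * b').
    by rewrite rmorphM rmorphB !rmorphM /=; field; rewrite b0 b'0.
  have bb : pi (b * b') != 0 by rewrite rmorphM mulf_neq0.
  rewrite (gE _ _ bb) (gE _ _ b0) (gE _ _ b'0) rmorphB !rmorphM /=.
  by field; rewrite !kn.
have gM : monoid_morphism g.
  split=> [|x y]; first by rewrite -(rmorph1 pi) g1 rmorph1.
  have [a [b [b0 ->]]] := frac x; have [a' [b' [b'0 ->]]] := frac y.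
  by rewrite mulf_div -!rmorphM !gE ?rmorphM ?mulf_neq0 // mulf_div.
pose h : {rmorphism E -> K} := HB.pack g
  (GRing.isZmodMorphism.Build E K g gB) (GRing.isMonoidMorphism.Build E K g gM).
by exists h.
Qed.

(** * Algebraic dependence in a field of transcendence degree two *)

Section FractionSubfield.
Variables (A : comNzRingType) (K : fieldType) (f : {rmorphism A -> K}).

Lemma fraction_subfield_exists :
  exists (E : fieldType) (j : {rmorphism E -> K}),
    (forall a, exists e, j e = f a) /\
    (forall e, exists a b, f b != 0 /\ j e = f a / f b).
Proof.
pose P x := exists a b, f b != 0 /\ x = f a / f b.
have [|x y [a [b [b0 ->]]] [c [d [d0 ->]]]|x y [a [b [b0 ->]]] [c [d [d0 ->]]]|E [j jE]] :=
  @subfield_type_exists K P.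
- by exists 1, 1; rewrite rmorph1 oner_eq0 divr1.
- exists (a * d - c * b), (b * d); rewrite rmorphM mulf_neq0 //; split=> //.
  by rewrite rmorphB !rmorphM /=; field; rewrite b0 d0.
- have [c0|c0] := eqVneq (f c) 0.
    by exists 0, 1; rewrite c0 mul0r invr0 mulr0 rmorph0 rmorph1 oner_eq0 mul0r.
  exists (a * d), (b * c); rewrite rmorphM mulf_neq0 //; split=> //.
  by rewrite !rmorphM /=; field; rewrite b0 d0 c0.
exists E, j; split=> [a|e]; last by apply/jE; exists e.
by apply/jE; exists a, 1; rewrite rmorph1 oner_eq0 divr1.
Qed.

Variables (E : fieldType) (j : {rmorphism E -> K}).
Hypothesis jf : forall a, exists e, j e = f a.
Hypothesis jfrac : forall e, exists a b, f b != 0 /\ j e = f a / f b.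

Lemma common_denominator (D : nat) (e : 'I_D -> E) :
  exists2 d, f d != 0 & exists a, forall i, j (e i) * f d = f (a i).
Proof.
have [a /choice[b ab]] := @choice _ _ (fun e a => exists b, f b != 0 /\ j e = f a / f b) jfrac.
exists (\prod_i b (e i)).
  by rewrite rmorph_prod; apply/prodf_neq0 => i _; case: (ab (e i)).
exists (fun i => a (e i) * \prod_(k | k != i) b (e k)) => i.
have [b0 ->] := ab (e i).
by rewrite [in LHS](bigD1 i) //= [in LHS]rmorphM mulrA divfK // rmorphM.
Qed.

Lemma fraction_algebraic x :
  algebraicOver j x <-> exists2 b, map_poly f b != 0 & (map_poly f b).[x] = 0.
Proof.
split=> [[p p0 px]|[b b0 bx]].
  have [d d0 [a aE]] := common_denominator (fun i : 'I_(size p) => p`_i).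
  pose b := \poly_(i < size p) (if insub i is Some k then a k else 0).
  have bE : map_poly f b = f d *: map_poly j p.
    apply/polyP => i; rewrite coef_map coefZ coef_map coef_poly.
    case: ltnP => [ip|ip]; first by rewrite insubT /= -aE mulrC.
    by rewrite [p`_i]nth_default // !raddf0 mulr0.
  exists b; first by rewrite bE scaler_eq0 negb_or d0 map_poly_eq0.
  by rewrite bE hornerZ (rootP px) mulr0.
have [g gE] := choice jf.
exists (\poly_(i < size b) g b`_i).
  apply: contraNneq b0 => p0; apply/eqP/polyP => i; rewrite coef_map coef0.
  have := congr1 (fun q : {poly E} => j q`_i) p0; rewrite coef_poly coef0 raddf0.
  case: ltnP => [_|ib]; first by rewrite gE.
  by rewrite [b`_i]nth_default // raddf0.
rewrite /root -bx; apply/eqP; congr (_.[x]); apply/polyP => i.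
rewrite !coef_map coef_poly; case: ltnP => [_|ib]; first exact: gE.
by rewrite [b`_i]nth_default // !raddf0.
Qed.
End FractionSubfield.

Section FiniteExtension.
Variables (E K : fieldType) (j : {rmorphism E -> K}).

(** Monomials whose exponents are smaller than the degrees of the equations of the [xi i]
    suffice; the last variable is reduced modulo its equation. *)
Lemma finite_spanning (n : nat) (xi : 'I_n -> K) :
  (forall i, algebraicOver j (xi i)) ->
  exists (T : finType) (w : T -> K), forall p : {mpoly E[n]},
    exists c : T -> E, mmap j xi p = \sum_i j (c i) * w i.
Proof.
elim: n xi => [|n IH] xi alg.
  exists unit, (fun=> 1) => p; exists (fun=> p@_0%MM).
  rewrite (big_pred1 tt) ?mulr1; last by case.
  have -> : p = (p@_0%MM)%:MP.
    apply/mpolyP => m; rewrite mcoeffC.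
    have -> : m = 0%MM by apply/mnmP; case.
    by rewrite eqxx mulr1.
  by rewrite mmapC mcoeffC eqxx mulr1.
pose e' (i : 'I_n) := xi (widen_ord (leqnSn n) i).
have [i|T [w wE]] := IH e'; first exact: alg.
set x := xi ord_max; have [q q0 qx] := alg ord_max.
exists (T * 'I_(size q))%type, (fun s : T * 'I_(size q) => w s.1 * x ^+ s.2) => p.
rewrite mmap_muni -/e' -/x.
have [c cE] := choice wE.
pose C i := \poly_(k < size (muni p)) c ((muni p)`_k) i.
exists (fun s : T * 'I_(size q) => (C s.1 %% q)`_s.2).
have modq (r : {poly E}) : (map_poly j r).[x] = (map_poly j (r %% q)).[x].
  rewrite [in LHS](divp_eq r q) rmorphD rmorphM /= hornerD hornerM.
  by rewrite (rootP qx) mulr0 add0r.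
have -> : (map_poly (mmap j e') (muni p)).[x] = \sum_i (map_poly j (C i)).[x] * w i.
  rewrite (horner_coef_wide _ (size_poly _ _)).
  rewrite [RHS](eq_bigr (fun i => \sum_(k < size (muni p)) j (c (muni p)`_k i) * x ^+ k * w i)).
    rewrite exchange_big /=; apply: eq_bigr => k _.
    rewrite coef_map [X in X * _](cE (muni p)`_k) mulr_suml.
    by apply: eq_bigr => i _; rewrite mulrAC.
  move=> i _; rewrite (@horner_coef_wide _ (size (muni p))); last first.
    by rewrite size_map_poly size_poly.
  rewrite mulr_suml; apply: eq_bigr => k _.
  by rewrite coef_map coef_poly ltn_ord.
rewrite -(pair_bigA _ (fun i (k : 'I_(size q)) => j (C i %% q)`_k * (w i * x ^+ k))) /=.
apply: eq_bigr => i _; rewrite modq (@horner_coef_wide _ (size q)); last first.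
  by rewrite size_map_poly ltnW // ltn_modp.
rewrite mulr_suml; apply: eq_bigr => k _; rewrite coef_map -mulrA.
by congr (_ * _); rewrite mulrC.
Qed.

Lemma linear_dependence (n : nat) (xi : 'I_n -> K) :
  (forall i, algebraicOver j (xi i)) ->
  exists D : nat, forall p : 'I_D.+1 -> {mpoly E[n]},
    exists2 c : 'I_D.+1 -> E, exists k, c k != 0
      & \sum_k j (c k) * mmap j xi (p k) = 0.
Proof.
move=> /finite_spanning[T [w wE]]; exists #|T| => p.
have [c cE] := choice wE.
pose M := \matrix_(k < #|T|.+1, t < #|T|) c (p k) (enum_val t).
have : kermx M != 0.
  rewrite -mxrank_eq0 mxrank_ker subn_eq0 -ltnNge ltnS.
  exact: rank_leq_col.
case/rowV0Pn => v /sub_kermxP vM v0; exists (v 0).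
  by apply/existsP; apply: contraNT v0 => /existsPn h; apply/eqP/rowP => k;
     rewrite mxE; apply/eqP; move: (h k); rewrite negbK.
transitivity (\sum_t j ((v *m M) 0 t) * w (enum_val t)); last first.
  by apply: big1 => t _; rewrite vM mxE rmorph0 mul0r.
transitivity (\sum_k \sum_t j (v 0 k * M k t) * w (enum_val t)).
  apply: eq_bigr => k _; rewrite cE mulr_sumr.
  rewrite (reindex (@enum_val T T)) /=; last by apply/onW_bij/enum_val_bij.
  by apply: eq_bigr => t _; rewrite mulrA -rmorphM mxE.
rewrite exchange_big; apply: eq_bigr => t _.
by rewrite -mulr_suml -rmorph_sum mxE.
Qed.
End FiniteExtension.

Section Dependence.
Variables (F : closedFieldType) (K : fieldType) (iota : {rmorphism F -> K}).

Definition hev (t : K) : {rmorphism {poly F} -> K} :=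
  horner_eval t \o map_poly iota.
Definition hev2 (t x : K) : {rmorphism {poly {poly F}} -> K} :=
  horner_eval x \o map_poly (hev t).

Definition is_constant (t : K) := exists c, t = iota c.

(** When [t] is not constant, this says that [x] is algebraic over the field [F(t)];
    the polynomial form makes the roles of [t] and [x] symmetric. *)
Definition dependent (t x : K) := exists2 b, b != 0 & hev2 t x b = 0.

Lemma hev2E t x b : hev2 t x b = (map_poly (hev t) b).[x].
Proof. by []. Qed.

Lemma hevC t c : hev t c%:P = iota c.
Proof. by rewrite /hev /= map_polyC /horner_eval hornerC. Qed.

Lemma hevX t : hev t 'X = t.
Proof. by rewrite /hev /= map_polyX /horner_eval hornerX. Qed.

Lemma hev2C t x p : hev2 t x p%:P = hev t p.
Proof. by rewrite hev2E map_polyC hornerC. Qed.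

Lemma hev2X t x : hev2 t x 'X = x.
Proof. by rewrite hev2E map_polyX hornerX. Qed.

(** Over an algebraically closed field a polynomial splits, and a root of it is a root
    of one of the linear factors. *)
Lemma constant_or_transcendental t :
  is_constant t \/ forall p, hev t p = 0 -> p = 0.
Proof.
apply: contrapT => /not_orP[nc /existsNP[p /not_implyP[p0 np]]]; apply: nc.
have [r pE] := closed_field_poly_normal p.
have : \prod_(z <- r) (t - iota z) = 0.
  move: p0; rewrite pE /hev /= map_polyZ /horner_eval hornerZ => /eqP.
  rewrite mulf_eq0 fmorph_eq0 lead_coef_eq0 (introF eqP np) /= => /eqP.
  rewrite rmorph_prod horner_prod => e; rewrite -[RHS]e; apply: eq_bigr => z _.
  by rewrite rmorphB /= map_polyX map_polyC hornerXsubC.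
move=> /eqP; rewrite prodf_seq_eq0 => /hasP[z _]; rewrite subr_eq0 => /eqP ->.
by exists z.
Qed.

Lemma hev_inj t p : ~ is_constant t -> hev t p = 0 -> p = 0.
Proof. by case: (constant_or_transcendental t) => // h _; apply: h. Qed.

Lemma map_hev_inj t b : ~ is_constant t -> map_poly (hev t) b = 0 -> b = 0.
Proof.
move=> nt e; apply/polyP => i; rewrite coef0; apply: (hev_inj nt).
by rewrite -coef_map e coef0.
Qed.

Lemma dependent_algebraic t : ~ is_constant t ->
  exists (E : fieldType) (j : {rmorphism E -> K}),
    [/\ forall p, exists e, j e = hev t p,
        forall e, exists p q, hev t q != 0 /\ j e = hev t p / hev t q
      & forall x, dependent t x <-> algebraicOver j x].
Proof.
move=> nt; have [E [j [jf jfrac]]] := fraction_subfield_exists (hev t).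
exists E, j; split=> // x; rewrite (fraction_algebraic jf jfrac).
split=> [[b b0 bx]|[b b0 bx]]; exists b => //.
  by apply: contraNneq b0 => /(map_hev_inj nt) ->.
by apply: contraNneq b0 => ->; rewrite rmorph0.
Qed.

Lemma dependent_subfield t : ~ is_constant t ->
  [/\ forall c, dependent t (iota c), dependent t t,
      forall x y, dependent t x -> dependent t y -> dependent t (x + y),
      forall x y, dependent t x -> dependent t y -> dependent t (x * y) &
      forall x, dependent t x -> dependent t x^-1].
Proof.
move=> nt; have [E [j [jf jfrac dE]]] := dependent_algebraic nt.
split=> [c||x y /dE dx /dE dy|x y /dE dx /dE dy|x /dE dx]; apply/dE.
- by rewrite -(hevC t); have [e <-] := jf c%:P; apply: algebraic_id.
- by rewrite -[X in algebraicOver _ X]hevX; have [e' <-] := jf 'X; apply: algebraic_id.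
- exact: algebraic_add.
- exact: algebraic_mul.
- exact: algebraic_inv.
Qed.

(** The algebraic closure of [F(t)] in [K] is algebraically closed in [K]. *)
Lemma dependent_root t (p : {poly K}) x : ~ is_constant t -> p != 0 ->
  (forall i, dependent t p`_i) -> p.[x] = 0 -> dependent t x.
Proof.
move=> nt p0 pL /rootP px; have [E [j [jf jfrac dE]]] := dependent_algebraic nt.
apply/dE/integral_algebraic; apply: (integral_root p0 px).
by apply/integral_poly => i; apply/integral_algebraic/dE.
Qed.

Lemma dependent_hev t x p : ~ is_constant t -> dependent t x -> dependent t (hev x p).
Proof.
move=> nt dx; have [LC _ LD LM _] := dependent_subfield nt.
elim/poly_ind: p => [|p c IH]; first by rewrite rmorph0 -(rmorph0 iota).
by rewrite rmorphD rmorphM hevC hevX; apply: LD => //; apply: LM.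
Qed.

(** The relation is read as a polynomial in [t] with coefficients in [F[s]]. *)
Lemma dependent_sym s t : dependent t s -> dependent s t.
Proof.
move=> [b b0 bs]; exists (swapXY b); first by rewrite swapXY_eq0.
rewrite -bs !hev2E.
have E (u : {poly {poly F}}) x y :
    (map_poly (hev x) u).[y] = (map_poly (map_poly iota) u).[y%:P].[x].
  set U := map_poly (map_poly iota) u.
  transitivity ((map_poly (horner_eval x) U).[horner_eval x y%:P]); last exact: horner_map.
  rewrite [horner_eval x y%:P]hornerC; congr (_.[_]); apply/polyP => i.
  by rewrite /U !coef_map.
by rewrite !E -swapXY_map horner2_swapXY.
Qed.

Lemma dependent_trans s t x : ~ is_constant t -> ~ is_constant s ->
  dependent t s -> dependent s x -> dependent t x.
Proof.
move=> nt ns dts [b b0 bx].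
apply: (@dependent_root t (map_poly (hev s) b)) => // [|i].
  by apply: contraNneq b0 => /(map_hev_inj ns) ->.
by rewrite coef_map; apply: dependent_hev.
Qed.

Section Rank.
Hypothesis dep3 : forall l a x : K, exists2 b : tower F 3, b != 0 &
  tower_eval iota (nth 0 [:: l; a; x]) 3 b = 0.
Variables (n : nat) (xi : 'I_n -> K).
Hypothesis gen : forall z, exists p q : {mpoly F[n]},
  mmap iota xi q != 0 /\ z = mmap iota xi p / mmap iota xi q.

Lemma hev2_inj l a b : ~ is_constant l -> ~ dependent l a -> hev2 l a b = 0 -> b = 0.
Proof.
move=> nl na b0; apply: contrapT => nb; apply: na; exists b => //; exact/eqP.
Qed.

Lemma algebraic_over_pair l a x : ~ is_constant l -> ~ dependent l a ->
  exists2 b : {poly {poly {poly F}}}, map_poly (hev2 l a) b != 0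
    & (map_poly (hev2 l a) b).[x] = 0.
Proof.
move=> nl na; have [b b0 bx] := dep3 l a x; exists b => //.
apply: contraNneq b0 => e; apply/eqP/polyP => i; rewrite coef0.
by apply: (hev2_inj nl na); rewrite -coef_map e coef0.
Qed.

(** [K] is generated by finitely many elements, each algebraic over [F(l, a)], so it is a
    finite extension; [D] bounds its degree, and relations are stated with cleared
    denominators. *)
Lemma bounded_rank l a : ~ is_constant l -> ~ dependent l a ->
  exists D : nat, forall b : 'I_D.+1 -> K,
    exists2 c : 'I_D.+1 -> {poly {poly F}}, exists k, c k != 0
      & \sum_k hev2 l a (c k) * b k = 0.
Proof.
move=> nl na; have [E [j [jf jfrac]]] := fraction_subfield_exists (hev2 l a).
have alg i : algebraicOver j (xi i).
  by apply/(fraction_algebraic jf jfrac)/algebraic_over_pair.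
have [D HD] := linear_dependence alg; exists D => b.
have [iE iEE] : exists iE : F -> E, forall c, j (iE c) = iota c.
  have [g gE] := choice jf; exists (fun c => g (c%:P)%:P) => c.
  by rewrite gE hev2C hevC.
have iEB : zmod_morphism iE.
  by move=> x y; apply: (fmorph_inj j); rewrite rmorphB !iEE rmorphB.
have iEM : monoid_morphism iE.
  split=> [|x y]; apply: (fmorph_inj j); rewrite ?rmorph1 ?rmorphM !iEE ?rmorph1 //.
  by rewrite rmorphM.
pose iEr : {rmorphism F -> E} := HB.pack iE
  (GRing.isZmodMorphism.Build F E iE iEB) (GRing.isMonoidMorphism.Build F E iE iEM).
have mE p : mmap j xi (map_mpoly iEr p) = mmap iota xi p.
  pose g : {rmorphism {mpoly F[n]} -> K} := mmap j xi \o map_mpoly iEr.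
  pose g' : {rmorphism {mpoly F[n]} -> K} := mmap iota xi.
  apply: (@rmorph_mpoly_eq _ _ _ g g') => [c|i].
    rewrite -[LHS]/(mmap j xi (map_mpoly iEr c%:MP)) -[RHS]/(mmap iota xi c%:MP).
    by rewrite map_mpolyC !mmapC; apply: iEE.
  rewrite -[LHS]/(mmap j xi (map_mpoly iEr 'X_i)) -[RHS]/(mmap iota xi 'X_i).
  by rewrite map_mpolyX !mmapX !mmap1U.
have [q q0 [p pE]] : exists2 q, mmap iota xi q != 0 &
    exists p : 'I_D.+1 -> {mpoly F[n]}, forall k, b k * mmap iota xi q = mmap iota xi (p k).
  have [p /choice[q pq]] := choice gen.
  exists (\prod_k q (b k)).
    by rewrite rmorph_prod; apply/prodf_neq0 => k _; case: (pq (b k)).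
  exists (fun k => p (b k) * \prod_(k' | k' != k) q (b k')) => k.
  have [qk e] := pq (b k).
  rewrite [in LHS](bigD1 k) //= [in LHS]rmorphM mulrA {1}e divfK //.
  by rewrite rmorphM.
have [c [k ck] cE] := HD (fun k => map_mpoly iEr (p k)).
have [d d0 [a' aE]] := common_denominator jfrac c.
exists a'.
  exists k; apply: contraNneq ck => a0; rewrite -(fmorph_eq0 j).
  by apply/eqP/(mulIf d0); rewrite aE a0 rmorph0 mul0r.
apply: (mulIf q0); rewrite mul0r.
transitivity ((\sum_k j (c k) * mmap j xi (map_mpoly iEr (p k))) * hev2 l a d); last first.
  by rewrite cE mul0r.
rewrite !mulr_suml.
by apply: eq_bigr => k' _; rewrite -aE mE -pE; ring.
Qed.
End Rank.
End Dependence.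

(** * The algebraic contradiction *)

Lemma det_congruent_one (K : fieldType) (B I : K -> Prop) (r : nat) (A : 'M[K]_r) :
  B 0 -> B 1 -> (forall x y, B x -> B y -> B (x * y)) ->
  I 0 -> (forall x y, I x -> I y -> I (x + y)) ->
  (forall x, I x -> I (- x)) ->
  (forall x y, B x -> I y -> I (x * y)) ->
  (forall i k, B (A i k)) -> (forall i k, I (A i k - (i == k)%:R)) ->
  I (\det A - 1).
Proof.
move=> B0 B1 BM I0 ID IN IM AB AI.
rewrite -[X in _ - X](det1 K r) /determinant -sumrB.
apply: (big_ind I) => // s _.
rewrite -mulrBr; have sgn (b : bool) x : I x -> I ((-1) ^+ b * x).
  by case: b; rewrite ?expr0 ?expr1 ?mul1r ?mulN1r //; apply: IN.
apply: sgn.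
have [] // : [/\ I (\prod_i A i (s i) - \prod_i (1%:M : 'M[K]_r) i (s i)),
    B (\prod_i A i (s i)) & B (\prod_i (1%:M : 'M[K]_r) i (s i))].
apply: (big_ind2 (fun a b => [/\ I (a - b), B a & B b])) =>
  [|x1 x2 y1 y2 [Ix Bx1 Bx2] [Iy By1 By2]|i _].
- by rewrite subrr.
- split; [|exact: BM|exact: BM].
  have -> : x1 * y1 - x2 * y2 = x2 * (y1 - y2) + y1 * (x1 - x2) by ring.
  by apply: ID; apply: IM.
- by rewrite [(1%:M : 'M[K]_r) _ _]mxE; split=> //; case: eqP.
Qed.

(** The difference of the two multiples of [c] is smaller than [v] in absolute value. *)
Lemma multiple_separation (v c : int) (D k k' e e' : nat) :
  v < - (c *+ D) -> 0 < c -> (k <= D)%N -> (k' <= D)%N ->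
  v *+ e + c *+ k = v *+ e' + c *+ k' -> k = k'.
Proof.
rewrite !pmulrn !mulrzz => vD c0 kD k'D.
case: (ltngtP e e') => [lt|lt|->] E; last by nia.
  have : v * (e'%:Z - e%:Z) <= v by nia.
  have : c * k%:Z <= c * D%:Z by nia.
  have : 0 <= c * k'%:Z by nia.
  by nia.
have : v * (e%:Z - e'%:Z) <= v by nia.
have : c * k'%:Z <= c * D%:Z by nia.
have : 0 <= c * k%:Z by nia.
by nia.
Qed.

Section Core.
Variables (F : closedFieldType) (K : fieldType) (iota : {rmorphism F -> K}).
Hypothesis dep3 : forall l a x : K, exists2 b : tower F 3, b != 0 &
  tower_eval iota (nth 0 [:: l; a; x]) 3 b = 0.
Variables (n : nat) (xi : 'I_n -> K).
Hypothesis gen : forall z, exists p q : {mpoly F[n]},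
  mmap iota xi q != 0 /\ z = mmap iota xi p / mmap iota xi q.

Variable t : K.
Hypothesis nt : ~ is_constant iota t.
Local Notation L := (dependent iota t).

Variable Phi : {rmorphism K -> K}.
Hypothesis Phi_iota : forall c, Phi (iota c) = iota c.
Hypothesis Phi_surj : forall x, exists y, Phi y = x.
Hypothesis LPhi : forall x, L (Phi x) <-> L x.

Variables (O : K -> Prop) (g : nat) (w : 'I_g -> K).
Hypotheses (Oiota : forall c, O (iota c)).
Hypotheses (OD : forall x y, O x -> O y -> O (x + y)).
Hypotheses (OM : forall x y, O x -> O y -> O (x * y)).
Hypotheses (Ow : forall i, O (w i)).

(** The powers of the ideal of [O] generated by the [w i]; in the application [O] is a local
    ring and this ideal is its maximal ideal. *)
Fixpoint mpow (k : nat) (x : K) : Prop :=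
  if k is k'.+1 then
    exists2 o : 'I_g -> K, forall i, mpow k' (o i) & x = \sum_i o i * w i
  else O x.

Hypothesis PhiO : forall x, O x -> O (Phi x).
Hypothesis Phiw : forall i, mpow 2 (Phi (w i)).
Hypothesis wL : exists i, ~ L (w i).

Variable u : K -> int.
Hypothesis uM : forall x y, x != 0 -> y != 0 -> u (x * y) = u x + u y.
Hypothesis uD : forall k x y, x != 0 -> y != 0 -> x + y != 0 ->
  k <= u x -> k <= u y -> k <= u (x + y).
Hypothesis u_iota : forall c, c != 0 -> u (iota c) = 0.
Hypothesis uO : forall x, O x -> x != 0 -> 0 <= u x.
Hypothesis uw : forall i, w i != 0 -> 1 <= u (w i).

Let O0 : O 0. Proof. by rewrite -(rmorph0 iota). Qed.
Let O1 : O 1. Proof. by rewrite -(rmorph1 iota). Qed.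

Lemma mpow_add k x y : mpow k x -> mpow k y -> mpow k (x + y).
Proof.
elim: k x y => [|k IH] x y; first exact: OD.
case=> o ho -> [o' ho' ->]; exists (fun i => o i + o' i) => [i|].
  by apply: IH; [apply: ho | apply: ho'].
by rewrite -big_split; apply: eq_bigr => i _; rewrite mulrDl.
Qed.

Lemma mpow_scale k c x : O c -> mpow k x -> mpow k (c * x).
Proof.
elim: k x => [|k IH] x Oc; first exact: OM.
case=> o ho ->; exists (fun i => c * o i) => [i|].
  by apply: IH => //; apply: ho.
by rewrite mulr_sumr; apply: eq_bigr => i _; rewrite mulrA.
Qed.

Lemma mpow0 k : mpow k 0.
Proof.
elim: k => [|k IH]; first exact: O0.
by exists (fun=> 0) => //; rewrite big1 // => i _; rewrite mul0r.
Qed.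

Lemma mpow_sum k (I : Type) (s : seq I) (P : pred I) (f : I -> K) :
  (forall i, mpow k (f i)) -> mpow k (\sum_(i <- s | P i) f i).
Proof.
by move=> h; apply: big_ind => // [|x y]; [apply: mpow0 | apply: mpow_add].
Qed.

Lemma mpow_w k i x : mpow k x -> mpow k.+1 (x * w i).
Proof.
move=> hx; exists (fun i' => if i' == i then x else 0) => [i'|].
  by case: eqP => // _; apply: mpow0.
rewrite (bigD1 i) //= eqxx big1 ?addr0 // => i' /negPf ->; exact: mul0r.
Qed.

Lemma mpow_mul k l x y : mpow k x -> mpow l y -> mpow (k + l) (x * y).
Proof.
elim: k x => [|k IH] x; first exact: mpow_scale.
case=> o ho -> hy; rewrite mulr_suml addSn; apply: mpow_sum => i.
by rewrite mulrAC; apply: mpow_w; apply: IH => //; apply: ho.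
Qed.

Lemma mpowS k x : mpow k.+1 x -> mpow k x.
Proof.
case=> o ho ->; apply: mpow_sum => i; rewrite mulrC.
by apply: mpow_scale; [apply: Ow | apply: ho].
Qed.

Lemma mpow_le k l x : (k <= l)%N -> mpow l x -> mpow k x.
Proof. by move/subnK <-; elim: (l - k)%N => // d IH /mpowS. Qed.

Lemma Phi_mpow k x : mpow k x -> mpow k.*2 (Phi x).
Proof.
elim: k x => [|k IH] x; first exact: PhiO.
case=> o ho ->; rewrite rmorph_sum; apply: mpow_sum => i.
by rewrite rmorphM doubleS -addn2; apply: mpow_mul; [apply: IH; apply: ho | apply: Phiw].
Qed.

Fixpoint PhiN (N : nat) : {rmorphism K -> K} :=
  if N is N'.+1 then Phi \o PhiN N' else @idfun K.

Lemma PhiN_iota N c : PhiN N (iota c) = iota c.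
Proof. by elim: N => //= N ->. Qed.

Lemma PhiN_surj N x : exists y, PhiN N y = x.
Proof.
elim: N x => [|N IH] x; first by exists x.
by have [y <-] := Phi_surj x; have [z <-] := IH y; exists z.
Qed.

Lemma PhiN_L N x : L (PhiN N x) <-> L x.
Proof. by elim: N => //= N IH; rewrite LPhi. Qed.

Lemma PhiN_mpow N x : mpow 1 x -> mpow (2 ^ N) (PhiN N x).
Proof.
move=> hx; elim: N => //= N IH; rewrite expnS mul2n; exact: Phi_mpow.
Qed.

(** The alternative [x = 0] stands for an infinite valuation, as [u 0] is arbitrary. *)
Definition uge (k : int) (x : K) := x = 0 \/ k <= u x.

Lemma uge_add k x y : uge k x -> uge k y -> uge k (x + y).
Proof.
move=> [->|hx] [->|hy]; rewrite ?add0r ?addr0; try by [left | right].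
have [->|x0] := eqVneq x 0; first by rewrite add0r; right.
have [->|y0] := eqVneq y 0; first by rewrite addr0; right.
by have [->|xy0] := eqVneq (x + y) 0; [left | right; apply: uD].
Qed.

Lemma uge_sum k (I : Type) (s : seq I) (P : pred I) (f : I -> K) :
  (forall i, P i -> uge k (f i)) -> uge k (\sum_(i <- s | P i) f i).
Proof. by move=> h; apply: big_ind => //; [left | apply: uge_add]. Qed.

Lemma u_mpow k x : mpow k x -> uge k%:Z x.
Proof.
elim: k x => [|k IH] x hx.
  by have [->|x0] := eqVneq x 0; [left | right; apply: uO].
case: hx => o ho ->; apply: uge_sum => i _.
have [->|o0] := eqVneq (o i) 0; first by left; rewrite mul0r.
have [->|w0] := eqVneq (w i) 0; first by left; rewrite mulr0.
right; rewrite uM //; have := uw w0; have [e|] := IH _ (ho i); last by lia.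
by rewrite e eqxx in o0.
Qed.

Let Lsub := dependent_subfield nt.
Let Liota c : L (iota c). Proof. by case: Lsub. Qed.
Let L0 : L 0. Proof. by rewrite -(rmorph0 iota). Qed.
Let L1 : L 1. Proof. by rewrite -(rmorph1 iota). Qed.
Let LD x y : L x -> L y -> L (x + y). Proof. by case: Lsub => _ _ h _ _; apply: h. Qed.
Let LM x y : L x -> L y -> L (x * y). Proof. by case: Lsub => _ _ _ h _; apply: h. Qed.
Let LV x : L x -> L x^-1. Proof. by case: Lsub => _ _ _ _; apply. Qed.

(** The span over [L] of the [k]-th power of the ideal generated by the [w i]. *)
Inductive lspan (k : nat) : K -> Prop :=
| lspan0 : lspan k 0
| lspan_cons l a x : L l -> mpow k a -> lspan k x -> lspan k (l * a + x).

Lemma lspan_add k x y : lspan k x -> lspan k y -> lspan k (x + y).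
Proof.
elim=> [|l a z Ll ha _ IH] hy; first by rewrite add0r.
by rewrite -addrA; apply: lspan_cons => //; apply: IH.
Qed.

Lemma lspan_single k l a : L l -> mpow k a -> lspan k (l * a).
Proof. by move=> Ll ha; rewrite -[_ * _]addr0; apply: lspan_cons => //; left. Qed.

Lemma lspan_mpow k a : mpow k a -> lspan k a.
Proof. by move=> ha; rewrite -[a]mul1r; apply: lspan_single. Qed.

Lemma lspan_mul k l x y : lspan k x -> lspan l y -> lspan (k + l) (x * y).
Proof.
elim=> [|c a z Lc ha _ IH] hy; first by rewrite mul0r; left.
rewrite mulrDl; apply: lspan_add; last exact: IH.
elim: hy => [|c' a' z' Lc' ha' _ IH']; first by rewrite mulr0; left.
rewrite mulrDr mulrACA; apply: lspan_cons => //; first exact: LM.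
exact: mpow_mul.
Qed.

Lemma lspan_scale k c x : L c -> lspan k x -> lspan k (c * x).
Proof.
move=> Lc hx; rewrite -[k]add0n; apply: lspan_mul => //.
by rewrite -[c]mulr1; apply: lspan_single.
Qed.

Lemma lspan_opp k x : lspan k x -> lspan k (- x).
Proof.
rewrite -mulN1r; apply: lspan_scale.
by rewrite -(rmorph1 iota) -rmorphN.
Qed.

Lemma lspan_le k l x : (k <= l)%N -> lspan l x -> lspan k x.
Proof.
move=> kl; elim=> [|c a z Lc ha _ IH]; first by left.
by apply: lspan_cons => //; apply: mpow_le ha.
Qed.

Lemma lspan_sum k (I : Type) (s : seq I) (P : pred I) (f : I -> K) :
  (forall i, P i -> lspan k (f i)) -> lspan k (\sum_(i <- s | P i) f i).
Proof. by move=> h; apply: big_ind => //; [left | apply: lspan_add]. Qed.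

Lemma lspan_horner k (q : {poly K}) y z : (forall i, L q`_i) -> O y ->
  mpow k z -> lspan k (q.[y] * z).
Proof.
move=> Lq Oy hz; rewrite horner_coef mulr_suml; apply: lspan_sum => i _.
rewrite -mulrA; apply: lspan_single => //; apply: mpow_scale => //.
by elim: (i : nat) => [|e IH]; rewrite ?expr0 // exprS; apply: OM.
Qed.

(** Divide by the highest power of the variable that divides all the [P k]. *)
Lemma remove_common_X (D : nat) (P : 'I_D -> {poly K}) (a : K) (b : 'I_D -> K) :
  a != 0 -> (exists k, P k != 0) -> (forall k i, L (P k)`_i) ->
  \sum_k (P k).[a] * b k = 0 ->
  exists Q : 'I_D -> {poly K},
    [/\ exists k, (Q k)`_0 != 0, forall k i, L (Q k)`_i
      & \sum_k (Q k).[a] * b k = 0].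
Proof.
move=> a0 [k0 Pk0] PL Pab.
have ex : exists s, [exists k, (P k)`_s != 0].
  by exists (size (P k0)).-1; apply/existsP; exists k0; rewrite -lead_coefE lead_coef_eq0.
case: (ex_minnP ex) => s /existsP[k ks] smin.
exists (fun k => drop_poly s (P k)); split=> [|k' i|].
- by exists k; rewrite coef_drop_poly add0n.
- by rewrite coef_drop_poly.
have PE k' : P k' = drop_poly s (P k') * 'X^s.
  rewrite -[LHS](poly_take_drop s) [take_poly s _](_ : _ = 0) ?add0r //.
  apply/polyP => i; rewrite coef_take_poly coef0; case: ltnP => // is_.
  apply/eqP; apply: contraTT is_ => ni; rewrite -leqNgt; apply: smin.
  by apply/existsP; exists k'.
apply: (mulIf (expf_neq0 s a0)); rewrite mul0r mulr_suml -[RHS]Pab.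
by apply: eq_bigr => k' _; rewrite [in RHS]PE hornerM hornerXn mulrAC.
Qed.

(** With [a] in the ideal but not in [L], the preimages of the [b k] under [Phi^M] satisfy a
    relation whose coefficients are polynomials [Q k] in [a] over [L], not all of them
    divisible by the variable.  Under [Phi^M] the element [a] goes into the [M]-th power of
    the ideal, so modulo that power only the constant terms remain. *)
Lemma dependence_modulo_powers :
  exists D : nat, forall b : 'I_D.+1 -> K, (forall k, O (b k)) -> forall M,
    exists2 l : 'I_D.+1 -> K, (forall k, L (l k)) /\ (exists k, l k != 0)
      & lspan M (\sum_k l k * b k).
Proof.
have [i0] := wL; set a := w i0 => nLa.
have a0 : a != 0 by apply/eqP => e; apply: nLa; rewrite e.
have [D HD] := bounded_rank dep3 gen nt nLa.
exists D => b Ob M; pose N := M.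
have [b' b'E] := choice (PhiN_surj N).
have [c [k0 ck0] cE] := HD (fun k => b' (b k)).
have [|k i|Q [[k Qk] QL Qab]] := @remove_common_X D.+1 (fun k => map_poly (hev iota t) (c k)) a
    (fun k => b' (b k)) a0 _ _ cE.
- by exists k0; apply: contra_neq ck0; apply: map_hev_inj.
- by rewrite coef_map; apply: dependent_hev => //; case: Lsub.
pose l k := PhiN N (Q k)`_0.
have Ll k' : L (PhiN N (Q k)`_k') by apply/PhiN_L.
exists l; first by split=> [k'|]; [apply/PhiN_L | exists k; rewrite fmorph_eq0].
set y := PhiN N a.
have hy : mpow M y.
  apply: (@mpow_le _ (2 ^ N)); first by rewrite ltnW // ltn_expl.
  by apply: PhiN_mpow; rewrite -[a]mul1r; apply: mpow_w.
have Oy : O y by apply: (@mpow_le 0 M).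
have sum0 : \sum_k' (map_poly (PhiN N) (Q k')).[y] * b k' = 0.
  transitivity (PhiN N (\sum_k' (Q k').[a] * b' (b k'))); last by rewrite Qab rmorph0.
  rewrite rmorph_sum; apply: eq_bigr => k' _.
  by rewrite rmorphM b'E horner_map.
have -> : \sum_k' l k' * b k' =
    \sum_k' (l k' * b k' - (map_poly (PhiN N) (Q k')).[y] * b k').
  by rewrite sumrB sum0 subr0.
apply: lspan_sum => k' _.
rewrite -mulrBl -[_ - _]opprB mulNr; apply: lspan_opp.
have coefL i : L (map_poly (PhiN N) (Q k'))`_i by rewrite coef_map; apply/PhiN_L.
rewrite /l -coef_map; move: coefL; set q := map_poly _ _.
elim/poly_ind: q => [|q e _] coefL; first by rewrite horner0 coef0 subrr mul0r; left.
rewrite hornerMXaddC coefD coefMX coefC eqxx add0r addrK -mulrA.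
apply: lspan_horner => // [i|]; last by rewrite mulrC; apply: mpow_scale.
by have := coefL i.+1; rewrite coefD coefMX coefC addr0.
Qed.

(** The generators are indexed by a finite type, as Nakayama's argument below needs a
    square matrix. *)
Lemma mpow_generated i :
  exists (T : finType) (v : T -> K), [/\ forall s, mpow i (v s), exists s, v s != 0
    & forall x, mpow i x -> exists2 o : T -> K, forall s, O (o s) & x = \sum_s o s * v s].
Proof.
elim: i => [|i [T [v [vi [s0 vs0] vg]]]].
  exists unit, (fun=> 1); split=> [//||x Ox]; first by exists tt; apply: oner_neq0.
  by exists (fun=> x) => //; rewrite (big_pred1 tt) ?mulr1 //; case.
exists (T * 'I_g)%type, (fun s : T * 'I_g => v s.1 * w s.2); split.
- by move=> s; apply: mpow_w.
- have [i0 nL] := wL; exists (s0, i0); rewrite mulf_neq0 //.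
  by apply/eqP => e; apply: nL; rewrite e.
move=> x [o ho ->].
have [j|c cE] := @choice _ _ (fun j c => (forall s, O (c s)) /\ o j = \sum_s c s * v s).
  by have [c h e] := vg _ (ho j); exists c.
exists (fun s : T * 'I_g => c s.2 s.1) => [s|]; first by case: (cE s.2).
rewrite -(pair_bigA _ (fun s j => c j s * (v s * w j))) exchange_big /=.
apply: eq_bigr => j _; rewrite (cE j).2 mulr_suml.
by apply: eq_bigr => s _; rewrite mulrA.
Qed.

Lemma lspan_generated i (T : finType) (v : T -> K) x :
  (forall x, mpow i x -> exists2 o : T -> K, forall s, O (o s) & x = \sum_s o s * v s) ->
  lspan i.+1 x ->
  exists2 c : T -> K, forall s, lspan 1 (c s) & x = \sum_s c s * v s.
Proof.
move=> vg; elim=> [|l a y Ll [o ho ->] _ [c hc ->]].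
  by exists (fun=> 0) => [s|]; [left | rewrite big1 // => s _; rewrite mul0r].
have [j|o' o'E] := @choice _ _ (fun j c => (forall s, O (c s)) /\ o j = \sum_s c s * v s).
  by have [o' h e] := vg _ (ho j); exists o'.
exists (fun s => \sum_j l * (o' j s * w j) + c s) => [s|].
  apply: lspan_add => //; apply: lspan_sum => j _; apply: lspan_single => //.
  by apply: (@mpow_w 0); case: (o'E j) => h _; apply: h.
rewrite [RHS](eq_bigr (fun s => \sum_j l * (o' j s * w j) * v s + c s * v s)); last first.
  by move=> s _; rewrite mulrDl mulr_suml.
rewrite big_split exchange_big; congr (_ + _); rewrite mulr_sumr.
apply: eq_bigr => j _; rewrite (o'E j).2 mulr_suml mulr_sumr.
by apply: eq_bigr => s _; ring.
Qed.

(** If every [L m^i] were larger than [L m^(i+1)], elements [b k] of [m^k] outside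
    [L m^(k+1)] would be independent over [L] modulo [L m^(D+1)], contradicting
    [dependence_modulo_powers].  So some [m^i] lies in [L m^(i+1)], and the determinant
    trick applies: the generators of [m^i] are annihilated by a matrix congruent to the
    identity modulo [L m]. *)
Lemma one_in_lspan : lspan 1 1.
Proof.
have [D HD] := dependence_modulo_powers.
have [i hi] : exists i, forall x, mpow i x -> lspan i.+1 x.
  apply: contrapT => none.
  have [k|b bE] := @choice _ _ (fun (k : 'I_D.+1) b => mpow k b /\ ~ lspan k.+1 b).
    apply: contrapT => nk; apply: none; exists k => x hx.
    by apply: contrapT => nx; apply: nk; exists x.
  have [|l [lL [k0 lk0]] lb] := HD b _ D.+1.
    by move=> k; apply: (@mpow_le 0 k) => //; case: (bE k).
  (* The term of least index in the relation is a combination of the later ones. *)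
  have [k lk kmin] := @arg_minnP _ k0 (fun k => l k != 0) (fun k => k : nat) lk0.
  case: (bE k) => _; apply.
  have -> : b k = (l k)^-1 * (\sum_k' l k' * b k' - \sum_(k' | k' != k) l k' * b k').
    by rewrite [X in X - _](bigD1 k) //= addrK mulKf.
  apply: lspan_scale; first exact: LV.
  apply: lspan_add; first by apply: lspan_le lb; apply: ltn_ord.
  apply: lspan_opp; apply: lspan_sum => k' k'k.
  have [->|lk'] := eqVneq (l k') 0; first by rewrite mul0r; left.
  apply: lspan_single => //; apply: (@mpow_le _ k'); last by case: (bE k').
  by rewrite ltn_neqAle eq_sym k'k kmin.
have [T [v [vi [s0 vs0] vg]]] := mpow_generated i.
have [s|C CE] := @choice _ _ (fun s c => (forall s', lspan 1 (c s')) /\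
    v s = \sum_s' c s' * v s').
  have [c h e] := lspan_generated vg (hi _ (vi s)).
  by exists c.
pose A : 'M[K]_#|T| := \matrix_(k, k') ((k == k')%:R - C (enum_val k') (enum_val k)).
have l01 x : lspan 1 x -> lspan 0 x by apply: lspan_le.
have l0 c : lspan 0 (iota c) by apply: lspan_mpow; apply: Oiota.
have delta (b : bool) : lspan 0 b%:R.
  by case: b; [have := l0 1; rewrite rmorph1 | have := l0 0; rewrite rmorph0].
have /eqP detA : \det A == 0.
  apply/det0P; exists (\row_k v (enum_val k)).
    apply: contraNneq vs0 => /rowP/(_ (enum_rank s0)).
    by rewrite !mxE enum_rankK => ->.
  apply/rowP => k; rewrite !mxE.
  rewrite (eq_bigr (fun k' => v (enum_val k') * (k' == k)%:R -
     C (enum_val k) (enum_val k') * v (enum_val k'))); last first.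
    by move=> k' _; rewrite !mxE mulrBr [in X in _ - X]mulrC.
  rewrite sumrB (bigD1 k) //= eqxx mulr1 big1 ?addr0; last first.
    by move=> k' /negPf ->; rewrite mulr0.
  rewrite [X in X - _](CE (enum_val k)).2.
  rewrite (reindex (@enum_val T T)) ?subrr //=; exact/onW_bij/enum_val_bij.
rewrite -[1]opprK; apply: lspan_opp; rewrite -[- 1]add0r -detA.
apply: (@det_congruent_one K (lspan 0) (lspan 1)).
- by left.
- exact: (delta true).
- by move=> x y; apply: lspan_mul.
- by left.
- exact: lspan_add.
- exact: lspan_opp.
- by move=> x y; apply: (@lspan_mul 0 1).
- move=> k k'; rewrite mxE; apply: lspan_add => //; apply: lspan_opp; apply: l01.
  by case: (CE (enum_val k')) => h _; apply: h.
- move=> k k'; rewrite mxE addrAC subrr add0r; apply: lspan_opp.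
  by case: (CE (enum_val k')) => h _; apply: h.
Qed.

Lemma u1 : u 1 = 0.
Proof. by rewrite -(rmorph1 iota) u_iota ?oner_eq0. Qed.

Lemma u_opp x : x != 0 -> u (- x) = u x.
Proof.
move=> x0; rewrite -mulN1r uM ?oppr_eq0 ?oner_eq0 //.
by rewrite -(rmorph1 iota) -rmorphN u_iota ?oppr_eq0 ?oner_eq0 // add0r.
Qed.

Lemma u_exp x k : x != 0 -> u (x ^+ k) = u x *+ k.
Proof.
move=> x0; elim: k => [|k IH]; first by rewrite expr0 u1.
by rewrite exprS uM ?expf_neq0 // IH mulrS.
Qed.

Lemma u_inv x : x != 0 -> u x^-1 = - u x.
Proof.
move=> x0; apply/eqP; rewrite -addr_eq0 addrC -uM ?invr_eq0 //.
by rewrite divff // u1.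
Qed.

Lemma u_add_lt x y : x != 0 -> y != 0 -> u x < u y ->
  x + y != 0 /\ u (x + y) = u x.
Proof.
move=> x0 y0 xy.
have xy0 : x + y != 0.
  apply: contraTneq xy => /eqP; rewrite addr_eq0 => /eqP ->.
  by rewrite u_opp // ltxx.
split=> //; apply/eqP; rewrite eq_le; apply/andP; split; last first.
  by apply: uD => //; apply: ltW.
rewrite leNgt; apply/negP => lt.
have e : x = (x + y) + - y by rewrite addrK.
have : u x + 1 <= u x.
  rewrite {2}e; apply: uD; rewrite ?oppr_eq0 -?e //; first lia.
  by rewrite u_opp //; lia.
lia.
Qed.

(** A pole of [l] makes the leading term of a polynomial in [l] dominant. *)
Lemma u_hev l q : l != 0 -> u l < 0 -> q != 0 ->
  hev iota l q != 0 /\ u (hev iota l q) = u l *+ (size q).-1.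
Proof.
move=> l0 ul; elim/poly_ind: q => [|q c IH]; first by rewrite eqxx.
rewrite rmorphD rmorphM hevC hevX.
have [->|q0 _] := eqVneq q 0.
  rewrite mul0r add0r rmorph0 mul0r add0r polyC_eq0 => c0.
  by rewrite fmorph_eq0 u_iota // size_polyC c0 mulr0n.
have [hq uq] := IH q0; rewrite size_MXaddC (negPf q0) /=.
have u2 : u (hev iota l q * l) = u l *+ size q.
  rewrite uM // uq -mulrSr prednK // size_poly_gt0 //.
have [->|c0] := eqVneq c 0; first by rewrite rmorph0 addr0 mulf_neq0.
rewrite -u2; apply: u_add_lt; rewrite ?mulf_neq0 ?fmorph_eq0 //.
by rewrite u2 u_iota // -mulr_natr pmulr_llt0 // ltr0n size_poly_gt0.
Qed.

(** The term of least valuation cannot be cancelled by the others. *)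
Lemma sum_distinct_valuations (D : nat) (x : 'I_D -> K) :
  (exists k, x k != 0) ->
  (forall k k', x k != 0 -> x k' != 0 -> u (x k) = u (x k') -> k = k') ->
  \sum_k x k != 0.
Proof.
move=> [k0 xk0] dist.
have [k xk kmin] := @arg_minP _ _ _ k0 (fun k => x k != 0) (fun k => u (x k)) xk0.
apply/negP => /eqP; rewrite (bigD1 k) //= => /eqP; rewrite addr_eq0 => /eqP xE.
set y := \sum_(k' | _) _ in xE.
have [y0|h] : uge (u (x k) + 1) y.
- apply: uge_sum => k' k'k; have [->|xk'] := eqVneq (x k') 0; [by left|right].
  have := kmin k' xk'; rewrite le_eqVlt => /predU1P[e|]; last lia.
  by rewrite (dist _ _ xk xk' e) eqxx in k'k.
- by rewrite xE y0 oppr0 eqxx in xk.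
have y0 : y != 0 by apply: contraNneq xk => y0; rewrite xE y0 oppr0.
by rewrite -(u_opp y0) -xE in h; lia.
Qed.

(** Let [pi] in [L] have positive valuation.  The preimages under [Phi^N] of
    [1, pi, ..., pi^D] lie in [L], hence satisfy a relation over [F[l]], where [D] bounds the
    degree of [K] over [F(l, a)] and thus does not depend on [N].  Its image under [Phi^N] is
    a relation among the powers of [pi] with coefficients in [F[l_N]], where
    [l_N = Phi^N l]; if the pole of [l_N] had order greater than [D u(pi)], its terms would
    have distinct valuations. *)
Lemma bounded_valuation l : L l -> l != 0 ->
  exists C : int, forall N, - C <= u (PhiN N l).
Proof.
move=> Ll l0.
have [[c ->]|nl] := pselect (is_constant iota l).
  by exists (- u (iota c)) => N; rewrite PhiN_iota opprK.
have [[pi [Lpi pi0 upi]]|triv] := pselect (exists pi, [/\ L pi, pi != 0 & 0 < u pi]);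
  last first.
  exists 0 => N; rewrite oppr0 leNgt; apply/negP => lt; apply: triv.
  exists (PhiN N l)^-1; rewrite invr_eq0 fmorph_eq0 l0; split=> //.
    by apply: LV; apply/PhiN_L.
  by rewrite u_inv ?fmorph_eq0 // oppr_gt0.
have [i0] := wL; set a := w i0 => nLa.
have nla : ~ dependent iota l a by move=> h; apply: nLa; apply: dependent_trans h.
have [D HD] := bounded_rank dep3 gen nl nla.
exists (u pi *+ D) => N; rewrite leNgt; apply/negP => lt.
set lN := PhiN N l in lt; have lN0 : lN != 0 by rewrite fmorph_eq0.
have ulN : u lN < 0 by apply: lt_le_trans lt _; rewrite oppr_le0 mulrn_wge0 // ltW.
have [y yE] := choice (PhiN_surj N).
pose b k := y (pi ^+ k).
have Lb k : L (b k).
  apply/(PhiN_L N); rewrite yE.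
  by elim: k => [|k IH]; [rewrite expr0 | rewrite exprS; apply: LM].
have [c [k0 ck0] cE] := HD (fun k => b k).
have Ll' p : L (hev iota l p) by apply: dependent_hev.
(* The relation over [F[l, a]] is a polynomial relation of [a] over [L]; as [a] is not in
   [L], it holds coefficientwise. *)
pose Q := \sum_(k < D.+1) (b k) *: map_poly (hev iota l) (c k).
have Qa : Q.[a] = 0.
  rewrite horner_sum -[RHS]cE; apply: eq_bigr => k _.
  by rewrite hornerZ mulrC.
have Q0 : Q = 0.
  apply/eqP; apply: contrapT => /negP nQ; apply: nLa.
  apply: (@dependent_root _ _ _ _ Q) => // i; rewrite coef_sum.
  apply: (big_ind L) => [||k _]; [exact: L0 | exact: LD | rewrite coefZ coef_map].
  by apply: LM; [apply: Lb | apply: Ll'].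
pose s := (size (c k0)).-1.
have sum0 : \sum_(k < D.+1) hev iota lN (c k)`_s * pi ^+ k = 0.
  transitivity (PhiN N (Q`_s)); last by rewrite Q0 coef0 rmorph0.
  rewrite coef_sum rmorph_sum; apply: eq_bigr => k _.
  rewrite coefZ coef_map rmorphM yE mulrC; congr (_ * _).
  rewrite /hev /= /horner_eval -horner_map -map_poly_comp; congr (_.[_]).
  by apply: eq_map_poly => e /=; rewrite PhiN_iota.
have := @sum_distinct_valuations D.+1 (fun k => hev iota lN (c k)`_s * pi ^+ k).
rewrite sum0 eqxx => H; apply: notF; apply: H.
  exists k0; rewrite mulf_neq0 ?expf_neq0 //.
  by case: (@u_hev lN (c k0)`_s) => //; rewrite -lead_coefE lead_coef_eq0.
have val (k : 'I_D.+1) : hev iota lN (c k)`_s * pi ^+ k != 0 ->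
    u (hev iota lN (c k)`_s * pi ^+ k) = u lN *+ (size (c k)`_s).-1 + u pi *+ k.
  rewrite mulf_eq0 negb_or => /andP[h1 h2]; rewrite uM // u_exp //.
  have [|_ ->] // := @u_hev lN (c k)`_s lN0 ulN.
  by apply: contraNneq h1 => ->; rewrite rmorph0.
move=> k k' /val -> /val ->.
by move/(multiple_separation lt upi (leq_ord k) (leq_ord k'))/ord_inj.
Qed.

Lemma lspan_valuation x : lspan 1 x ->
  exists C : int, forall N, uge ((2 ^ N)%N%:Z - C) (PhiN N x).
Proof.
elim=> [|l a y Ll ha _ [C hC]]; first by exists 0 => N; rewrite rmorph0; left.
have [->|l0] := eqVneq l 0; first by exists C => N; rewrite mul0r add0r.
have [C' hC'] := bounded_valuation Ll l0.
exists (Num.max C C') => N; rewrite rmorphD rmorphM; apply: uge_add; last first.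
  by case: (hC N) => [->|h]; [left | right; lia].
have [->|la] := u_mpow (PhiN_mpow N ha); first by rewrite mulr0; left.
have [->|a0] := eqVneq (PhiN N a) 0; first by rewrite mulr0; left.
right; rewrite uM // ?fmorph_eq0 //; have := hC' N; lia.
Qed.

Lemma no_contracting_automorphism : False.
Proof.
have [C hC] := lspan_valuation one_in_lspan.
have := hC `|C|%N; rewrite rmorph1 => -[/eqP|]; first by rewrite oner_eq0.
by rewrite u1; have := ltn_expl `|C|%N (isT : (1 < 2)%N); move: (2 ^ _)%N => M; lia.
Qed.
End Core.

(** * The function field of a projective variety *)

Lemma mmap_dhomog (A T : comNzRingType) (n d : nat) (f : {rmorphism A -> T})
    (c : T) (x : 'I_n -> T) (p : {mpoly A[n]}) :
  p \is d.-homog -> mmap f (fun i => c * x i) p = c ^+ d * mmap f x p.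
Proof.
move=> /dhomogP hp; rewrite /mmap big_seq [in RHS]big_seq mulr_sumr.
apply: eq_bigr => m mp; rewrite mulrCA; congr (_ * _).
rewrite /mmap1 -(hp m mp) /= mdegE.
rewrite -prodrXr -big_split; apply: eq_bigr => i _; exact: exprMn.
Qed.

Section FunctionField.
Variables (R : realType) (n : nat).
Local Notation F := R[i].
Implicit Types (X : 'rV[F]_n.+1 -> Prop).

Lemma meval_scale (d : nat) (p : {mpoly F[n.+1]}) (c : F) (x : 'rV[F]_n.+1) :
  p \is d.-homog -> p.@[(c *: x) 0] = c ^+ d * p.@[x 0].
Proof.
move=> hp; rewrite /meval -(mmap_dhomog _ _ _ hp); congr (mmap _ _ _).
by apply: funext => i; rewrite mxE.
Qed.

Lemma closed_scale X c x : zariski_closed X -> c != 0 -> X x -> X (c *: x).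
Proof.
move=> [S [Sh XE]] c0 /XE[x0 hx]; apply/XE; split; first by rewrite scaler_eq0 negb_or c0.
by move=> p Sp; have [d hd] := Sh p Sp; rewrite (meval_scale _ _ hd) hx // mulr0.
Qed.

Lemma closed_neq0 X x : zariski_closed X -> X x -> x != 0.
Proof. by move=> [S [Sh XE]] /XE[]. Qed.

Lemma irreducible_forms X (p q : {mpoly F[n.+1]}) :
  zariski_closed X -> irreducible X -> homogeneous p -> homogeneous q ->
  (forall x, X x -> p.@[x 0] * q.@[x 0] = 0) ->
  (forall x, X x -> p.@[x 0] = 0) \/ (forall x, X x -> q.@[x 0] = 0).
Proof.
move=> Xc [_ Xirr] hp hq pq.
pose Z (p : {mpoly F[n.+1]}) (x : 'rV[F]_n.+1) := x != 0 /\ p.@[x 0] = 0.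
have Zc r : homogeneous r -> zariski_closed (Z r).
  move=> hr; exists (fun r' => r' = r); split=> [r' ->//|x].
  by split=> [[x0 rx]|[x0 rx]]; split=> //; [move=> r' -> | apply: rx].
have [x Xx|h|h] := Xirr (Z p) (Z q) (Zc p hp) (Zc q hq).
- have x0 := closed_neq0 Xc Xx.
  have /eqP := pq x Xx; rewrite mulf_eq0 => /orP[/eqP px|/eqP qx]; [by left|by right].
- by left => x /h[].
- by right => x /h[].
Qed.

Section Chart.
Variables (X : 'rV[F]_n.+1 -> Prop) (i0 : 'I_n.+1) (kappa : F).
Hypotheses (Xc : zariski_closed X) (Xirr : irreducible X) (kappa0 : kappa != 0).
Hypothesis Xchart : exists2 x, X x & x 0 i0 = kappa.

(** Scaling reaches the points with [x_i0] nonzero; the others are covered by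
    irreducibility, applied to the product of the form with the coordinate [x_i0]. *)
Lemma vanish_on_chart p : homogeneous p ->
  (forall x, X x -> x 0 i0 = kappa -> p.@[x 0] = 0) -> forall x, X x -> p.@[x 0] = 0.
Proof.
move=> hp pX.
have hX : homogeneous ('X_i0 : {mpoly F[n.+1]}) by exists 1%N; rewrite dhomogX /= mdeg1.
have [x Xx|//|xi] := irreducible_forms Xc Xirr hp hX.
  rewrite mevalXU; have [->|x0] := eqVneq (x 0 i0) 0; first by rewrite mulr0.
  have [d hd] := hp.
  have c0 : kappa / x 0 i0 != 0 by rewrite mulf_neq0 ?invr_eq0.
  have := pX _ (closed_scale Xc c0 Xx); rewrite mxE divfK // => /(_ erefl).
  rewrite (meval_scale _ _ hd) => /eqP; rewrite mulf_eq0 expf_eq0 (negPf c0) andbF.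
  by move=> /eqP ->; rewrite mul0r.
by have [x Xx] := Xchart; move: (xi x Xx); rewrite mevalXU => -> /eqP; rewrite eq_sym (negPf kappa0).
Qed.

Lemma homogenize_meval p (x : 'rV[F]_n.+1) : x 0 i0 = kappa ->
  (homogenize i0 kappa p).@[x 0] = p.@[x 0].
Proof. by move=> xi0; rewrite /meval (@homogenizeE _ _ i0 kappa kappa0 _ idfun). Qed.

(** The residue field of the ideal of the affine chart [x_i0 = kappa]; [xi] is the generic
    point.  The ideal is prime because the homogenization of a polynomial vanishing on the
    chart vanishes on all of [X]. *)
Lemma function_field_exists :
  exists (K : fieldType) (iota : {rmorphism F -> K}) (xi : 'I_n.+1 -> K),
    [/\ xi i0 = iota kappa,
        forall p, mmap iota xi p = 0 <->
          forall x, X x -> x 0 i0 = kappa -> p.@[x 0] = 0 &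
        forall z, exists p q, mmap iota xi q != 0 /\
           z = mmap iota xi p / mmap iota xi q].
Proof.
pose I p := forall x, X x -> x 0 i0 = kappa -> p.@[x 0] = 0.
have [||||p q pq|K [pi [piI gen]]] := @residue_field_exists _ I.
- by move=> x _ _; rewrite meval0.
- by move=> p q Ip Iq x Xx xi0; rewrite mevalD Ip // Iq // addr0.
- by move=> p q Iq x Xx xi0; rewrite mevalM Iq // mulr0.
- have [x Xx xi0] := Xchart; move/(_ x Xx xi0)/eqP; rewrite meval1; apply/negP.
  exact: oner_neq0.
- have hh r : homogeneous (homogenize i0 kappa r) := homogenize_homogeneous i0 kappa r.
  have [x Xx|h|h] := irreducible_forms Xc Xirr (hh p) (hh q).
  + have hpq : homogeneous (homogenize i0 kappa p * homogenize i0 kappa q).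
      by exists (msize p + msize q)%N; apply: dhomogM; apply: homogenize_homog.
    rewrite -mevalM; apply: vanish_on_chart hpq _ x Xx => y Xy yi0.
    by rewrite mevalM !homogenize_meval // -mevalM pq.
  + by left => x Xx xi0; rewrite -homogenize_meval // h.
  + by right => x Xx xi0; rewrite -homogenize_meval // h.
have piE r : mmap (pi \o @mpolyC n.+1 F) (fun i => pi 'X_i) r = pi r.
  by rewrite [RHS]rmorph_mmap.
exists K, (pi \o @mpolyC n.+1 F), (fun i => pi 'X_i); split.
- apply/eqP; rewrite /= -subr_eq0 -rmorphB; apply/eqP/piI => x _ xi0.
  by rewrite mevalB mevalXU mevalC xi0 subrr.
- by move=> p; rewrite piE.
- by move=> z; have [a [b [b0 ->]]] := gen z; exists a, b; rewrite !piE.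
Qed.

Section GenericPoint.
Variables (K : fieldType) (iota : {rmorphism F -> K}) (xi : 'I_n.+1 -> K).
Hypothesis xi0 : xi i0 = iota kappa.
Hypothesis xiE : forall p, mmap iota xi p = 0 <->
  forall x, X x -> x 0 i0 = kappa -> p.@[x 0] = 0.

Lemma generic_form p : homogeneous p ->
  mmap iota xi p = 0 <-> forall x, X x -> p.@[x 0] = 0.
Proof.
move=> hp; rewrite xiE; split=> [h|h x Xx _]; last exact: h.
exact: vanish_on_chart.
Qed.

Lemma generic_homogenize p : mmap iota xi p = 0 ->
  forall x, X x -> (homogenize i0 kappa p).@[x 0] = 0.
Proof.
move=> p0; apply/(generic_form (homogenize_homogeneous i0 kappa p)).
by rewrite homogenizeE.
Qed.

Lemma locus_generic : included (locus iota xi) X.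
Proof.
have [S [Sh XE]] := Xc; move=> y [y0 Ly]; apply/XE; split=> // p Sp.
apply: Ly; first exact: Sh.
by apply/(generic_form (Sh p Sp)) => x /XE[_]; apply.
Qed.
End GenericPoint.
End Chart.
End FunctionField.

(** * The valuation of a formal integral curve *)

(** [O] is the local ring of a point, [val] the value at that point and [D] a derivation.  An
    element [h] of [O] restricts to the formal integral curve of [D] through the point as the
    power series whose coefficient of degree [k] is [val (D^k h) / k!]. *)
Section IntegralCurve.
Variables (F : numClosedFieldType) (K : fieldType) (iota : {rmorphism F -> K}).
Hypothesis dep3 : forall l a x : K, exists2 b : tower F 3, b != 0 &
  tower_eval iota (nth 0 [:: l; a; x]) 3 b = 0.
Variables (O : K -> Prop) (val : K -> F) (D : K -> K).
Hypothesis Oiota : forall c, O (iota c).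
Hypothesis OD : forall x y, O x -> O y -> O (x + y).
Hypothesis OM : forall x y, O x -> O y -> O (x * y).
Hypothesis Ofrac : forall z, exists a b, [/\ O a, O b, b != 0 & z = a / b].
Hypothesis val_iota : forall c, val (iota c) = c.
Hypothesis valD : forall x y, O x -> O y -> val (x + y) = val x + val y.
Hypothesis valM : forall x y, O x -> O y -> val (x * y) = val x * val y.
Hypothesis DO : forall x, O x -> O (D x).
Hypothesis DD : forall x y, D (x + y) = D x + D y.
Hypothesis DM : forall x y, D (x * y) = D x * y + x * D y.
Hypothesis Diota : forall c, D (iota c) = 0.

Let val0 : val 0 = 0. Proof. by rewrite -(rmorph0 iota) val_iota. Qed.
Let O0 : O 0. Proof. by rewrite -(rmorph0 iota). Qed.
Let O1 : O 1. Proof. by rewrite -(rmorph1 iota). Qed.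
Let D0 : D 0 = 0. Proof. by rewrite -[X in D X](rmorph0 iota) Diota. Qed.

Let OiterD k x : O x -> O (iter k D x).
Proof. by move=> Ox; elim: k => //= k; apply: DO. Qed.

Let iterDD k x y : iter k D (x + y) = iter k D x + iter k D y.
Proof. by elim: k => //= k ->; apply: DD. Qed.

(** The restriction of [h] to the integral curve has a zero of order at least [k]. *)
Definition order_ge (k : nat) (h : K) := forall i, (i < k)%N -> val (iter i D h) = 0.

Lemma order_ge_add k x y : O x -> O y ->
  order_ge k x -> order_ge k y -> order_ge k (x + y).
Proof.
move=> Ox Oy hx hy i ik; rewrite iterDD valD; try exact: OiterD.
by rewrite hx // hy // addr0.
Qed.

Lemma order_geD k x : order_ge k x -> order_ge k.-1 (D x).
Proof.
by move=> hx i ik; rewrite -iterSr; apply: hx; case: k ik.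
Qed.

Lemma order_ge_mul k l x y : O x -> O y ->
  order_ge k x -> order_ge l y -> order_ge (k + l) (x * y).
Proof.
move=> Ox Oy hx hy i; elim: i k l x y Ox Oy hx hy => [|i IH] k l x y Ox Oy hx hy ikl.
  rewrite /= valM //; case: k hx ikl => [|k] hx ikl; last by rewrite (hx 0%N) // mul0r.
  by rewrite (hy 0%N) // mulr0.
rewrite iterSr DM iterDD valD; try by apply: OiterD; apply: OM => //; apply: DO.
rewrite (IH k.-1 l) //; try by [apply: DO | apply: order_geD | lia].
rewrite (IH k l.-1) //; try by [apply: DO | apply: order_geD | lia].
exact: addr0.
Qed.

(** The lowest term of the Leibniz formula: the order of a product is the sum of the orders,
    as the binomial coefficient is nonzero in characteristic zero. *)
Lemma leading_mul k l x y : O x -> O y -> order_ge k x -> order_ge l y ->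
  val (iter (k + l) D (x * y)) =
  'C(k + l, k)%:R * (val (iter k D x) * val (iter l D y)).
Proof.
move=> Ox Oy; move: x y Ox Oy.
have [N le] := ubnP (k + l); elim: N k l le => // N IH k l le x y Ox Oy hx hy.
have step m : val (iter m.+1 D (x * y)) =
    val (iter m D (D x * y)) + val (iter m D (x * D y)).
  rewrite iterSr DM iterDD valD //; by apply: OiterD; apply: OM => //; apply: DO.
case: k l le hx hy => [|k] [|l] le hx hy.
- by rewrite /= bin0 mul1r valM.
- rewrite add0n step bin0 mul1r.
  have -> : val (iter l D (D x * y)) = 0.
    by apply: (@order_ge_mul 0 l.+1) => //; apply: DO.
  have l1 : (0 + l < N)%N by lia.
  have := IH 0%N l l1 x (D y) Ox (DO Oy) hx (order_geD hy).
  by rewrite add0n bin0 mul1r add0r -iterSr => ->.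
- rewrite addn0 step binn mul1r.
  have -> : val (iter k D (x * D y)) = 0.
    by apply: (@order_ge_mul k.+1 0) => //; [apply: DO | rewrite addn0].
  have l1 : (k + 0 < N)%N by lia.
  have := IH k 0%N l1 (D x) y (DO Ox) Oy (order_geD hx) hy.
  by rewrite addn0 binn mul1r addr0 -iterSr => ->.
- have l1 : (k + l.+1 < N)%N by lia.
  have l2 : (k.+1 + l < N)%N by lia.
  have := IH k l.+1 l1 (D x) y (DO Ox) Oy (order_geD hx) hy.
  have := IH k.+1 l l2 x (D y) Ox (DO Oy) hx (order_geD hy).
  rewrite (_ : (k.+1 + l = k + l.+1)%N); last by lia.
  rewrite -!iterSr => e1 e2.
  by rewrite addSn step e1 e2 binS natrD; ring.
Qed.

(** The kernel of restriction to the integral curve. *)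
Definition flat (h : K) := O h /\ forall k, val (iter k D h) = 0.

Lemma flat_add x y : flat x -> flat y -> flat (x + y).
Proof.
move=> [Ox hx] [Oy hy]; split=> [|k]; first exact: OD.
by rewrite iterDD valD ?hx ?hy ?addr0 //; apply: OiterD.
Qed.

Lemma flat_mul x y : O x -> flat y -> flat (x * y).
Proof.
move=> Ox [Oy hy]; split=> [|k]; first exact: OM.
by apply: (@order_ge_mul 0 k.+1) => // i _; apply: hy.
Qed.

Lemma flatD x : flat x -> flat (D x).
Proof. by move=> [Ox hx]; split=> [|k]; [apply: DO | rewrite -iterSr]. Qed.

Variables (x z : K).
Hypotheses (Ox : O x) (Oz : O z) (Dx : D x = 1) (Dz : D z = z) (valz : val z != 0).

Let Ohev (p : {poly F}) : O (hev iota x p).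
Proof.
elim/poly_ind: p => [|p c IH]; first by rewrite rmorph0.
by rewrite rmorphD rmorphM hevC hevX; apply: OD => //; apply: OM.
Qed.

Let Ohev2 (p : {poly {poly F}}) : O (hev2 iota x z p).
Proof.
elim/poly_ind: p => [|p c IH]; first by rewrite rmorph0.
by rewrite rmorphD rmorphM hev2C hev2X; apply: OD => //; apply: OM.
Qed.

Lemma D_hev p : D (hev iota x p) = hev iota x p^`().
Proof.
elim/poly_ind: p => [|p c IH]; first by rewrite deriv0 !rmorph0.
rewrite rmorphD rmorphM hevC hevX DD DM Diota addr0 Dx IH mulr1.
by rewrite derivD derivM derivX derivC addr0 mulr1 rmorphD rmorphM hevX.
Qed.

(** The derivation d/dx + z d/dz of [F[x, z]]; here the inner variable is [x] and the outer
    one is [z]. *)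
Definition delta (p : {poly {poly F}}) : {poly {poly F}} :=
  map_poly (@deriv F) p + p^`() * 'X.

Lemma coef_delta p j : (delta p)`_j = (p`_j)^`() + p`_j *+ j.
Proof.
rewrite coefD coef_map_id0 ?deriv0 // coefMX; case: j => [|j] /=; first by rewrite mulr0n.
by rewrite coef_deriv.
Qed.

Lemma D_hev2 p : D (hev2 iota x z p) = hev2 iota x z (delta p).
Proof.
elim/poly_ind: p => [|p c IH].
  have -> : delta 0 = 0 by apply/polyP => j; rewrite coef_delta !coef0 deriv0 mul0rn addr0.
  by rewrite rmorph0.
have -> : delta (p * 'X + c%:P) = delta p * 'X + p * 'X + c^`()%:P.
  apply/polyP => j; rewrite !coef_delta !coefD !coefMX !coefC.
  case: j => [|j] /=; first by rewrite !mulr0n !add0r addr0.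
  by rewrite !addr0 coef_delta mulrS addrA (addrAC _ p`_j).
rewrite !rmorphD !rmorphM !hev2C !hev2X DD DM IH Dz D_hev.
by rewrite ?mulrDl ?addrA.
Qed.

Definition total_size (p : {poly {poly F}}) : nat :=
  (\sum_(j < size p) size (p`_j)%R)%N.

(** The curve on which [x] is an affine parameter and [z] a multiple of its exponential is not
    algebraic.  If [p] of degree [J] in [z] vanishes on it, so does [delta p - J p], whose top
    coefficient has smaller degree in [x]; by induction this is zero, so [p] is a
    constant multiple of [z^J], which does not vanish at the point. *)
Lemma flat_polynomial (p : {poly {poly F}}) : flat (hev2 iota x z p) -> p = 0.
Proof.
have [N] := ubnP (total_size p); elim: N p => // N IH p le fp.
apply/eqP; apply: contrapT => /negP p0.
set J := (size p).-1; have sp : size p = J.+1 by rewrite prednK // size_poly_gt0.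
have pJ : p`_J != 0 by rewrite -lead_coefE lead_coef_eq0.
pose r : {poly {poly F}} := delta p - p *+ J.
have coefr j : r`_j = (p`_j)^`() + (p`_j *+ j - p`_j *+ J).
  by rewrite coefB coef_delta coefMn addrA.
have sder (q : {poly F}) : (size q^`() <= size q)%N.
  have [->|q0] := eqVneq q 0; first by rewrite deriv0.
  exact/ltnW/lt_size_deriv.
have sr : (size r <= J.+1)%N.
  apply/leq_sizeP => j jJ; rewrite coefr nth_default ?sp // deriv0.
  by rewrite !mul0rn subrr addr0.
have srj j : (size (r`_j)%R <= size (p`_j)%R)%N.
  rewrite coefr (leq_trans (size_polyD _ _)) // geq_max sder /=.
  by rewrite -2!scaler_nat -scalerBl; apply: size_scale_leq.
have r0 : r = 0.
  apply: IH.
    rewrite ltnS in le; apply: leq_trans le; rewrite /total_size sp.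
    have -> : (\sum_(j < size r) size (r`_j)%R = \sum_(j < J.+1) size (r`_j)%R)%N.
      rewrite (big_ord_widen J.+1 (fun j : nat => size (r`_j)%R)) // big_mkcond.
      by apply: eq_bigr => j _; case: ltnP => // h; rewrite nth_default // size_poly0.
    rewrite !big_ord_recr /= -addnS; apply: leq_add.
      by apply: leq_sum => j _; apply: srj.
    by rewrite coefr subrr addr0; apply: lt_size_deriv.
  rewrite /r rmorphB rmorphMn -D_hev2 -mulr_natl -mulNr; apply: flat_add.
    exact: flatD.
  by apply: flat_mul => //; have := Oiota (- J%:R); rewrite rmorphN rmorph_nat.
have pj j : (j < J)%N -> p`_j = 0.
  move=> jJ; apply/eqP; apply: contrapT => /negP nz.
  have := congr1 (fun q : {poly {poly F}} => q`_j) r0; rewrite coefr coef0.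
  move/eqP; rewrite addr_eq0 opprB => /eqP e.
  have := lt_size_deriv nz; rewrite e -mulrnBr ?(ltnW jJ) // -scaler_nat.
  by rewrite size_scale ?ltnn // pnatr_eq0 -lt0n subn_gt0.
have pJ' : (p`_J)^`() = 0.
  have := congr1 (fun q : {poly {poly F}} => q`_J) r0.
  by rewrite coefr coef0 subrr addr0.
have [c pc] : exists c, p`_J = c%:P.
  exists (p`_J)`_0; apply/polyP => -[|i]; rewrite coefC //=.
  have := congr1 (fun q : {poly F} => q`_i) pJ'; rewrite coef_deriv coef0 => /eqP.
  by rewrite mulrn_eq0 /= => /eqP.
have pE : p = c%:P *: 'X^J.
  apply/polyP => j; rewrite coefZ coefXn; case: (ltngtP j J) => [jJ|Jj|->].
  - by rewrite pj // mulr0.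
  - by rewrite nth_default ?sp // mulr0.
  - by rewrite mulr1.
have : val (hev2 iota x z p) = 0 by case: fp => _ /(_ 0%N).
rewrite pE -mul_polyC rmorphM rmorphXn hev2C hev2X hevC.
have Oz' k : O (z ^+ k) by elim: k => [|k Hk]; rewrite ?expr0 // exprS; apply: OM.
rewrite valM // val_iota => /eqP; rewrite mulf_eq0.
have -> /= : (c == 0) = false by apply: contraNF pJ => /eqP e; rewrite pc e.
suff -> : val (z ^+ J) = val z ^+ J by rewrite expf_eq0 (negPf valz) andbF.
elim: {+}J => [|k Hk]; first by rewrite !expr0 -(rmorph1 iota) val_iota.
by rewrite !exprS valM // Hk.
Qed.

Let flat0 : flat 0.
Proof. by split=> // k; elim: k => [|k IH]; rewrite ?iterSr ?D0. Qed.

Lemma curve_coordinates_independent : ~ is_constant iota x /\ ~ dependent iota x z.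
Proof.
split=> [[c xc]|[b b0 bz]].
  by move: Dx; rewrite xc Diota => /eqP; rewrite eq_sym oner_eq0.
have /flat_polynomial e : flat (hev2 iota x z b) by rewrite bz.
by rewrite e eqxx in b0.
Qed.

(** A nonzero [h] satisfies an equation over [F[x, z]] with nonzero constant term; if [h]
    vanishes on the curve, so does that constant term. *)
Lemma flat_zero h : flat h -> h = 0.
Proof.
move=> fh; apply/eqP; apply: contrapT => /negP h0.
have [nx nz] := curve_coordinates_independent.
have [b b0 bh] := algebraic_over_pair dep3 h nx nz.
have {}b0 : b != 0 by apply: contraNneq b0 => ->; rewrite rmorph0.
have ex : exists s, b`_s != 0 by exists (size b).-1; rewrite -lead_coefE lead_coef_eq0.
case: (ex_minnP ex) => s bs smin.
have bE : b = drop_poly s b * 'X^s.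
  rewrite -[LHS](poly_take_drop s) [take_poly s _](_ : _ = 0) ?add0r //.
  apply/polyP => i; rewrite coef_take_poly coef0; case: ltnP => // is_.
  by apply/eqP; apply: contraTT is_ => ni; rewrite -leqNgt; apply: smin.
have {}bh : (map_poly (hev2 iota x z) (drop_poly s b)).[h] = 0.
  apply: (mulIf (expf_neq0 s h0)); rewrite mul0r -[RHS]bh [in RHS]bE.
  by rewrite rmorphM /= map_polyXn hornerM hornerXn.
apply/negP: bs; rewrite negbK -[s]add0n -coef_drop_poly; apply/eqP.
apply: flat_polynomial; move: bh.
elim/poly_ind: (drop_poly s b) => [|q c _]; first by move=> _; rewrite coef0 rmorph0.
rewrite coefD coefMX coefC eqxx add0r => e.
have -> : hev2 iota x z c = - ((map_poly (hev2 iota x z) q).[h] * h).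
  move: e; rewrite rmorphD rmorphM /= map_polyX map_polyC hornerMXaddC => /eqP.
  by rewrite addrC addr_eq0 => /eqP.
rewrite -mulNr; apply: flat_mul => //.
have -> : - (map_poly (hev2 iota x z) q).[h] = iota (-1) * (map_poly (hev2 iota x z) q).[h].
  by rewrite rmorphN rmorph1 mulN1r.
apply: OM => //; elim/poly_ind: q {e} => [|q e IH]; first by rewrite rmorph0 horner0.
rewrite rmorphD rmorphM /= map_polyX map_polyC hornerMXaddC.
by apply: OD; [apply: OM => //; case: fh | apply: Ohev2].
Qed.

Definition order_is (k : nat) (h : K) := order_ge k h /\ val (iter k D h) != 0.

Lemma order_exists h : O h -> h != 0 -> exists k, order_is k h.
Proof.
move=> Oh h0.
have ex : exists k, val (iter k D h) != 0.
  apply: contrapT => none; apply/negP: h0; rewrite negbK; apply/eqP/flat_zero.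
  by split=> // k; apply/eqP; apply: contrapT => /negP nk; apply: none; exists k.
case: (ex_minnP ex) => k vk kmin; exists k; split=> // i ik.
by apply/eqP; apply: contraTT ik => ni; rewrite -leqNgt; apply: kmin.
Qed.

Lemma order_is_mul k l a b : O a -> O b -> order_is k a -> order_is l b ->
  order_is (k + l) (a * b).
Proof.
move=> Oa Ob [ha va] [hb vb]; split; first exact: order_ge_mul.
by rewrite leading_mul // !mulf_neq0 // pnatr_eq0 -lt0n bin_gt0 leq_addr.
Qed.

Lemma order_is_ge k l a : order_is k a -> order_ge l a -> (l <= k)%N.
Proof.
by move=> [_ vk] hl; rewrite leqNgt; apply/negP => /hl e; rewrite e eqxx in vk.
Qed.

Lemma order_ge_le k l a : (l <= k)%N -> order_ge k a -> order_ge l a.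
Proof. by move=> lk hk i il; apply: hk; apply: leq_trans lk. Qed.

Lemma order_is_uniq k l a : order_is k a -> order_is l a -> k = l.
Proof.
move=> hk hl; apply/eqP; rewrite eqn_leq.
by rewrite (order_is_ge hl) ?(order_is_ge hk); case: hk hl => [? ?] [].
Qed.

(** The order of vanishing along the integral curve, extended to fractions. *)
Lemma curve_valuation_exists :
  exists u : K -> int,
    [/\ forall a b, a != 0 -> b != 0 -> u (a * b) = u a + u b,
        forall k a b, a != 0 -> b != 0 -> a + b != 0 ->
          k <= u a -> k <= u b -> k <= u (a + b),
        forall c, c != 0 -> u (iota c) = 0,
        forall a, O a -> a != 0 -> 0 <= u a
      & forall a, O a -> val a = 0 -> a != 0 -> 1 <= u a].
Proof.
pose U y (k : int) := exists a b m l, [/\ O a, O b, b != 0, y = a / b &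
  [/\ order_is m a, order_is l b & k = m%:Z - l%:Z]].
have [y|u uP] := @choice _ _ (fun y k => y != 0 -> U y k).
  have [->|y0] := eqVneq y 0; first by exists 0 => /eqP.
  have [a [b [Oa Ob b0 yE]]] := Ofrac y.
  have a0 : a != 0 by apply: contraNneq y0 => a0; rewrite yE a0 mul0r.
  have [m hm] := order_exists Oa a0; have [l hl] := order_exists Ob b0.
  by exists (m%:Z - l%:Z) => _; exists a, b, m, l.
have uE a b m l : O a -> O b -> a != 0 -> b != 0 -> order_is m a -> order_is l b ->
    u (a / b) = m%:Z - l%:Z.
  move=> Oa Ob a0 b0 hm hl.
  have [|a' [b' [m' [l' [Oa' Ob' b'0 e [hm' hl' ->]]]]]] := uP (a / b).
    by rewrite mulf_neq0 ?invr_eq0.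
  have e' : a * b' = a' * b by apply/eqP; rewrite -eqr_div // e.
  have := order_is_mul Oa Ob' hm hl'; rewrite e' => h1.
  have := order_is_uniq h1 (order_is_mul Oa' Ob hm' hl); lia.
have order1 c : c != 0 -> order_is 0 (iota c).
  by move=> c0; split=> [i|] //=; rewrite val_iota.
have uO a m : O a -> a != 0 -> order_is m a -> u a = m%:Z.
  move=> Oa a0 hm; have h1 : order_is 0 1 by rewrite -(rmorph1 iota); apply: order1; apply: oner_neq0.
  by rewrite -[a]divr1 (uE _ _ m 0%N) ?oner_eq0 // subr0.
exists u; split.
- move=> y y' y0 y'0.
  have [a [b [m [l [Oa Ob b0 e [hm hl e1]]]]]] := uP y y0.
  have [a' [b' [m' [l' [Oa' Ob' b'0 e' [hm' hl' e1']]]]]] := uP y' y'0.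
  have a0 : a != 0 by apply: contraNneq y0 => a0; rewrite e a0 mul0r.
  have a'0 : a' != 0 by apply: contraNneq y'0 => a0'; rewrite e' a0' mul0r.
  rewrite e1 e1' e e' mulf_div (uE _ _ (m + m')%N (l + l')%N); try lia.
  all: try by [apply: OM | rewrite mulf_neq0 | apply: order_is_mul].
- move=> k y y' y0 y'0 yy0.
  have [a [b [m [l [Oa Ob b0 e [hm hl e1]]]]]] := uP y y0.
  have [a' [b' [m' [l' [Oa' Ob' b'0 e' [hm' hl' e1']]]]]] := uP y' y'0.
  rewrite e1 e1' => k1 k2.
  have eS : y + y' = (a * b' + a' * b) / (b * b') by rewrite e e' addf_div.
  have Os : O (a * b' + a' * b) by apply: OD; apply: OM.
  have s0 : a * b' + a' * b != 0 by apply: contraNneq yy0 => s0; rewrite eS s0 mul0r.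
  have [r hr] := order_exists Os s0.
  have rge : (minn (m + l') (m' + l) <= r)%N.
    apply: (order_is_ge hr); apply: order_ge_add; try exact: OM.
      apply: (@order_ge_le (m + l')); first exact: geq_minl.
      by apply: order_ge_mul => //; [case: hm | case: hl'].
    apply: (@order_ge_le (m' + l)); first exact: geq_minr.
    by apply: order_ge_mul => //; [case: hm' | case: hl].
  rewrite eS (uE _ _ r (l + l')%N) ?mulf_neq0 //; [lia | exact: OM | exact: order_is_mul].
- by move=> c c0; rewrite (uO _ 0%N) ?fmorph_eq0 //; apply: order1.
- by move=> a Oa a0; have [m hm] := order_exists Oa a0; rewrite (uO _ m).
- move=> a Oa va a0; have [[|m] hm] := order_exists Oa a0; last by rewrite (uO _ m.+1).
  by case: hm => _ /=; rewrite va eqxx.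
Qed.
End IntegralCurve.

(** * Vector fields and conormal vectors on a smooth variety *)

Lemma vspace_matrix (F : fieldType) (N : nat) (V : {vspace 'rV[F]_N}) :
  exists T : 'M[F]_(\dim V, N), row_free T /\ forall v, v \in V <-> (v <= T)%MS.
Proof.
pose T := \matrix_(i < \dim V) (vbasis V)`_i.
have rT i : row i T = (vbasis V)`_i by rewrite rowK.
exists T; split.
  rewrite -kermx_eq0.
  apply/eqP/row_matrixP => i; rewrite row0; apply/rowP => k; rewrite [RHS]mxE.
  have /eqP : row i (kermx T) *m T = 0 by rewrite -row_mul mulmx_ker row0.
  rewrite mulmx_sum_row => /eqP e.
  have /freeP free := basis_free (vbasisP V).
  by apply: free; rewrite -[RHS]e; apply: eq_bigr => j _; rewrite rT.
move=> v; split=> [/coord_vbasis ->|/submxP[c ->]].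
  by apply: summx_sub => k _; rewrite -rT; apply: scalemx_sub; apply: row_sub.
rewrite mulmx_sum_row; apply: rpred_sum => k _; rewrite rT.
by apply: rpredZ; apply: vbasis_mem; rewrite mem_nth ?size_tuple.
Qed.

Lemma dim_vspace_matrix (F : fieldType) (N m : nat) (V : {vspace 'rV[F]_N})
    (U : 'M[F]_(m, N)) :
  (forall v, v \in V <-> (v <= U)%MS) -> \dim V = \rank U.
Proof.
move=> VU; have [T [/eqP rT TV]] := vspace_matrix V.
suff TU : (T :=: U)%MS by rewrite -TU rT.
by apply/eqmxP/andP; split; apply/row_subP => i; [apply/VU/TV | apply/TV/VU]; apply: row_sub.
Qed.

Lemma basis_of_rank (F : fieldType) (m N r : nat) (U : 'M[F]_(m, N)) :
  \rank U = r -> exists B : 'M[F]_(r, N), (B :=: U)%MS.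
Proof. by move=> <-; exists (row_base U); apply: eq_row_base. Qed.

(** The row [x] kills the columns of [J] but not [a], so [a] is not in their span. *)
Lemma rank_row_mx_kernel (F : fieldType) (N k : nat) (x : 'rV[F]_N)
    (a : 'cV[F]_N) (J : 'M[F]_(N, k)) :
  x *m J = 0 -> x *m a != 0 -> \rank (row_mx a J) = (\rank J).+1.
Proof.
move=> xJ xa; rewrite -mxrank_tr tr_row_mx -addsmxE.
rewrite mxrank_disjoint_sum ?mxrank_tr.
  suff -> : \rank a = 1%N by [].
  apply/eqP; rewrite eqn_leq rank_leq_col lt0n mxrank_eq0.
  by apply: contraNneq xa => ->; rewrite mulmx0.
apply/eqP/rowV0P => v; rewrite sub_capmx => /andP[/sub_rVP[c ->] /submxP[E e]].
have [->|c0] := eqVneq c 0; first by rewrite scale0r.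
have := congr1 (fun u => x *m u^T) e.
rewrite trmx_mul trmxK mulmxA xJ mul0mx linearZ /= trmxK -scalemxAr => /eqP.
by rewrite scaler_eq0 (negPf c0) (negPf xa).
Qed.

Section Chart.
Variables (R : realType) (n : nat).
Local Notation F := R[i].
Local Notation pol := {mpoly F[n.+1]}.
Variable X : 'rV[F]_n.+1 -> Prop.

Definition ideal_form (p : pol) := homogeneous p /\ forall x, X x -> p.@[x 0] = 0.

Definition gradients k (s : 'I_k -> pol) (x : 'rV[F]_n.+1) : 'M[F]_(n.+1, k) :=
  \matrix_(i, j) ((s j)^`M(i)).@[x 0].

Lemma cone_tangentE x v : cone_tangent X x v <->
  forall p, ideal_form p -> v *m gradients (fun _ : 'I_1 => p) x = 0.
Proof.
split=> [hv p [hp Xp]|hv p hp Xp].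
  apply/rowP => i; rewrite !mxE -[RHS](hv p hp Xp).
  by apply: eq_bigr => j _; rewrite mxE.
have := congr1 (fun u : 'rV_1 => u 0 0) (hv p (conj hp Xp)); rewrite !mxE => e.
by rewrite -[RHS]e; apply: eq_bigr => j _; rewrite mxE.
Qed.

(** A family of forms of the ideal with linearly independent gradients at [x], of maximal
    size: the gradients of all other forms of the ideal are combinations of these. *)
Lemma independent_gradients x :
  exists k (s : 'I_k -> pol), [/\ forall j, ideal_form (s j), \rank (gradients s x) = k,
    forall v, cone_tangent X x v <-> v *m gradients s x = 0 &
    forall p, ideal_form p ->
      ((gradients (fun _ : 'I_1 => p) x)^T <= (gradients s x)^T)%MS].
Proof.
pose P (ks : {k & 'I_k -> pol}) := (forall j, ideal_form (projT2 ks j)) /\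
   \rank (gradients (projT2 ks) x) = projT1 ks.
have [|[k s] [/= sI rk] kmax] := @classical_minimum _ P (fun ks => n.+1 - projT1 ks)%N.
  exists (existT _ 0%N (fun _ => 0)); split=> [[]//|] /=.
  by apply/eqP; rewrite -leqn0 rank_leq_col.
have sub p : ideal_form p ->
    ((gradients (fun _ : 'I_1 => p) x)^T <= (gradients s x)^T)%MS.
  move=> hp; set g := gradients _ x; apply: contraT => ng.
  pose s' (j : 'I_(1 + k)) := match split j with inl _ => p | inr j' => s j' end.
  have gE : gradients s' x = row_mx g (gradients s x).
    by apply/matrixP => i j; rewrite !mxE /s'; case: (split j) => j'; rewrite mxE.
  have rk' : \rank (gradients s' x) = (1 + k)%N.
    rewrite gE -mxrank_tr tr_row_mx -addsmxE mxrank_disjoint_sum ?mxrank_tr ?rk.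
      congr (_ + _)%N; apply/eqP; rewrite eqn_leq rank_leq_col lt0n mxrank_eq0.
      by apply: contraNneq ng => ->; rewrite trmx0 sub0mx.
    apply/eqP/rowV0P => v; rewrite sub_capmx => /andP[/sub_rVP[c ->] h].
    have [->|c0] := eqVneq c 0; first by rewrite scale0r.
    by case/negP: ng; rewrite -(eqmx_scale _ c0).
  have := kmax (existT _ (1 + k)%N s'); rewrite /P /= => /(_ (conj _ rk')).
  have kn : (1 + k <= n.+1)%N by rewrite -rk' rank_leq_row.
  move=> H; suff : (n.+1 - k <= n.+1 - (1 + k))%N by lia.
  by apply: H => j; rewrite /s'; case: (split j).
exists k, s; split=> // v; rewrite cone_tangentE; split=> [h|h p Ip].
  apply/rowP => j; have := congr1 (fun u : 'rV_1 => u 0 0) (h _ (sI j)).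
  rewrite !mxE => e; rewrite -[RHS]e.
  by apply: eq_bigr => i _; rewrite !mxE.
have /submxP[E e] := sub p Ip.
by rewrite -[gradients _ x]trmxK e trmx_mul trmxK mulmxA h mul0mx.
Qed.

(** The annihilator of the tangent space is the span of the gradients defining it. *)
Lemma conormal_combination x (g : 'I_n.+1 -> F) :
  (forall v, cone_tangent X x v -> \sum_i v 0 i * g i = 0) ->
  exists k (s : 'I_k -> pol) (c : 'I_k -> F), (forall j, ideal_form (s j)) /\
    forall i, g i = \sum_j c j * ((s j)^`M(i)).@[x 0].
Proof.
move=> hg; have [k [s [sI rk tanE _]]] := independent_gradients x.
set J := gradients s x in rk tanE.
have : ((\row_i g i) <= J^T)%MS.
  rewrite submxE; apply/eqP/rowP => j; rewrite !mxE.
  have /tanE/hg e : (col j (cokermx J^T))^T *m J = 0.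
    by apply: trmx_inj; rewrite trmx_mul trmxK colE mulmxA mulmx_coker mul0mx trmx0.
  by rewrite -[RHS]e; apply: eq_bigr => i _; rewrite !mxE mulrC.
case/submxP => c e; exists k, s, (c 0); split=> // i.
have := congr1 (fun u : 'rV_n.+1 => u 0 i) e; rewrite !mxE => ->.
by apply: eq_bigr => j _; rewrite !mxE.
Qed.
End Chart.

Lemma euler_formula (F : comNzRingType) (n d : nat) (p : {mpoly F[n]}) (x : 'I_n -> F) :
  p \is d.-homog -> \sum_i x i * (p^`M(i)).@[x] = d%:R * p.@[x].
Proof.
move=> /dhomogP hp; rewrite [in RHS](mpolyE p).
transitivity (\sum_(m <- msupp p) \sum_i x i * p@_m * ('X_[m]^`M(i)).@[x]).
  rewrite exchange_big /=; apply: eq_bigr => i _.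
  rewrite [in LHS](mpolyE p) (raddf_sum (mderiv i)) (raddf_sum (meval x)) /= mulr_sumr.
  by apply: eq_bigr => m _; rewrite mderivZ mevalZ mulrA.
rewrite raddf_sum /= mulr_sumr big_seq [RHS]big_seq; apply: eq_bigr => m mp.
transitivity (\sum_i (m i)%:R * (p@_m * ('X_[m]).@[x])); last first.
  by rewrite -mulr_suml -natr_sum -mdegE (hp m mp) mevalZ.
apply: eq_bigr => i _; rewrite mderivX mevalZ.
case mi: (m i) => [|k]; first by rewrite !mul0r mulr0.
have -> : 'X_[m] = 'X_i * 'X_[(m - U_(i))] :> {mpoly F[n]}.
  rewrite -mpolyXD; congr 'X_[_]; apply/mnmP => j; rewrite mnmDE mnmBE mnm1E.
  by case: eqP => [<-|_] /=; rewrite ?mi; lia.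
by rewrite mevalM mevalXU; ring.
Qed.

(** At [P] the gradients of a maximal independent family [s], the coordinate vector of [i0]
    and two more vectors form a basis.  Cramer's rule solves the linear system
    prescribing zero for the derivatives of the forms [s] and of the coordinate [x_i0], and
    prescribing those of the two linear forms [l] and [l'], over the polynomials up to the
    determinant [d].  Where [d] is nonzero the gradients of the forms [s] span the conormal
    space, whose dimension is constant by smoothness, so the solution is tangent.
    The two values, after division by [d], are [D x = 1] and [D z = z] with
    [x = sum_i l_i x_i] and [z = 1 + sum_i l'_i (x_i - P_i)], a function with [z(P) = 1]. *)
Lemma tangent_vector_field (R : realType) (n : nat) (X : 'rV[R[i]]_n.+1 -> Prop)
    (i0 : 'I_n.+1) (P : 'rV[R[i]]_n.+1) :
  smooth_of_dim X 2 -> X P -> P 0 i0 != 0 ->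
  exists (v : 'I_n.+1 -> {mpoly R[i][n.+1]}) (d : {mpoly R[i][n.+1]})
         (l l' : 'I_n.+1 -> R[i]),
    [/\ d.@[P 0] != 0, v i0 = 0, \sum_i l i *: v i = d,
        \sum_i l' i *: v i = d * (1 + \sum_i l' i *: ('X_i - (P 0 i)%:MP))
      & forall p x, ideal_form X p -> X x ->
          d.@[x 0] * \sum_i (p^`M(i)).@[x 0] * (v i).@[x 0] = 0].
Proof.
move=> smooth XP P0; have [k [s [sI rk tanE _]]] := independent_gradients X P.
have rank_ker m (J : 'M[R[i]]_(n.+1, m)) x : X x ->
    (forall v, cone_tangent X x v <-> v *m J = 0) -> (n.+1 = \rank J + 3)%N.
  move=> Xx tJ; have [V dV VE] := smooth x Xx.
  have : \dim V = \rank (kermx J).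
    apply: dim_vspace_matrix => v; rewrite -VE tJ; split=> [vJ|/sub_kermxP //].
    exact/sub_kermxP.
  by rewrite dV mxrank_ker; have := rank_leq_row J; lia.
have nk : n = k.+2.
  by have := rank_ker _ _ _ XP tanE; rewrite rk; lia.
subst n.
set e : 'cV[R[i]]_k.+3 := \col_i (i == i0)%:R.
have eE (u : 'rV[R[i]]_k.+3) : (u *m e) 0 0 = u 0 i0.
  rewrite mxE (bigD1 i0) //= mxE eqxx mulr1 big1 ?addr0 // => i /negPf ni.
  by rewrite mxE ni mulr0.
have PJ : P *m gradients s P = 0.
  apply/rowP => j; rewrite !mxE; have [[d hd] Xs] := sI j.
  rewrite (eq_bigr (fun i => P 0 i * ((s j)^`M(i)).@[P 0])); last by move=> i _; rewrite mxE.
  by rewrite (euler_formula _ hd) Xs // mulr0.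
have Pe : P *m e != 0 by apply: contraNneq P0 => Pe; rewrite -eE Pe mxE.
have rkJ := rank_row_mx_kernel PJ Pe; rewrite rk in rkJ.
have [B BE] : exists B : 'M[R[i]]_(2, k.+3), (B :=: ((row_mx e (gradients s P))^T)^C)%MS.
  have r2 : \rank (((row_mx e (gradients s P))^T)^C)%MS = 2%N.
    by rewrite mxrank_compl mxrank_tr rkJ; lia.
  exact: basis_of_rank r2.
pose W x : 'M[R[i]]_(k.+3) := row_mx B^T (row_mx e (gradients s x)).
have trW x : (W x)^T = col_mx B (row_mx e (gradients s x))^T.
  exact: (etrans (tr_row_mx B^T (row_mx e (gradients s x)))
            (congr1 (fun M => col_mx M _) (trmxK B))).
have WP : W P \in unitmx.
  rewrite -unitmx_tr -row_full_unit -sub1mx trW.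
  have : (1%:M <= col_mx B (row_mx e (gradients s P))^T)%MS.
    rewrite -addsmxE (adds_eqmx BE (eqmx_refl _)) addsmxC.
    by rewrite sub1mx addsmx_compl_full.
  exact.
pose Bp : 'M[{mpoly R[i][k.+3]}]_(k.+3, 2) := map_mx (@mpolyC _ _) B^T.
pose ep : 'M[{mpoly R[i][k.+3]}]_(k.+3, 1) := map_mx (@mpolyC _ _) e.
pose Jp : 'M[{mpoly R[i][k.+3]}]_(k.+3, k) := \matrix_(i, j) ((s j)^`M(i)).
pose Wp : 'M[{mpoly R[i][k.+3]}]_(k.+3) := row_mx Bp (row_mx ep Jp).
have WpE (x : 'rV[R[i]]_k.+3) : map_mx (meval (x 0)) Wp = W x.
  apply/matrixP => i j; rewrite !mxE; case: (@split 2 (1 + k) j) => j'; rewrite !mxE ?mevalC //.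
  by case: (@split 1 k j') => j''; rewrite !mxE ?mevalC.
pose z : {mpoly R[i][k.+3]} := 1 + \sum_i B 1 i *: ('X_i - (P 0 i)%:MP).
pose rhs : 'rV[{mpoly R[i][k.+3]}]_(2 + (1 + k)) :=
  row_mx (\row_j if j == 0 then 1 else z) 0.
have [v vW] : exists v, v *m Wp = \det Wp *: rhs.
  by exists (rhs *m \adj Wp); rewrite -mulmxA mul_adj_mx mul_mx_scalar.
have vWsplit : v *m row_mx Bp (row_mx ep Jp) = \det Wp *: rhs by exact: vW.
rewrite mul_mx_row mul_mx_row scale_row_mx in vWsplit.
case/eq_row_mx: vWsplit => vB; rewrite scaler0 -row_mx0 => /eq_row_mx[ve vs].
have vBE j : \sum_i B j i *: v 0 i = (\det Wp *: (\row_(j < 2) if j == 0 then 1 else z)) 0 j.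
  rewrite -vB mxE; apply: eq_bigr => i _; rewrite !mxE mulrC mul_mpolyC //.
exists (v 0), (\det Wp), (B 0), (B 1); split.
- by rewrite -det_map_mx WpE -unitfE; move: WP; rewrite unitmxE.
- have := congr1 (fun u : 'rV_1 => u 0 0) ve; rewrite !mxE => <-.
  rewrite (bigD1 i0) //= !mxE eqxx mulr1 big1 ?addr0 // => i /negPf ni.
  by rewrite !mxE ni mulr0.
- by rewrite vBE !mxE mulr1.
- by rewrite vBE !mxE.
move=> p x Ip Xx.
have [->|dx] := eqVneq (\det Wp).@[x 0] 0; first by rewrite mul0r.
suff h : cone_tangent X x (map_mx (meval (x 0)) v).
  have [hp Xp] := Ip; have := h p hp Xp => h'.
  rewrite (eq_bigr (fun i => (map_mx (meval (x 0)) v) 0 i * (p^`M(i)).@[x 0])).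
    by rewrite h' mulr0.
  by move=> i _; rewrite mxE mulrC.
have [V dV VE] := smooth x Xx; apply/VE.
have [T [Tfree TV]] := vspace_matrix V; apply/TV.
have Tker : (T <= kermx (gradients s x))%MS.
  apply/row_subP => i; apply/sub_kermxP.
  have /TV/VE/cone_tangentE h : (row i T <= T)%MS by apply: row_sub.
  apply/rowP => j; have := congr1 (fun u : 'rV_1 => u 0 0) (h _ (sI j)).
  rewrite !mxE => e0; rewrite -[RHS]e0.
  by apply: eq_bigr => i' _; rewrite !mxE.
have kerT : (kermx (gradients s x) <= T)%MS.
  have [_ <-] := mxrank_leqif_sup Tker.
  rewrite (eqP Tfree) dV mxrank_ker.
  have : \rank (W x) = k.+3.
    by apply: mxrank_unit; rewrite -WpE unitmxE det_map_mx unitfE.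
  have le3 : (\rank (col_mx B (row_mx e (gradients s x))^T) <= 3 + \rank (gradients s x))%N.
    rewrite -addsmxE.
    apply: (leq_trans (leq_of_leqif (mxrank_adds_leqif _ _))); rewrite tr_row_mx -addsmxE.
    have := leq_of_leqif (mxrank_adds_leqif e^T (gradients s x)^T).
    have := rank_leq_row B; have := rank_leq_row e^T.
    rewrite (mxrank_tr (gradients s x)); lia.
  have : (\rank (W x) <= 3 + \rank (gradients s x))%N.
    by rewrite -mxrank_tr trW; exact: le3.
  by have := rank_leq_row (gradients s x); have := rank_leq_col (gradients s x); lia.
apply: submx_trans kerT; apply/sub_kermxP.
have := congr1 (map_mx (meval (x 0))) vs; rewrite map_mxM map_mx0 => <-.
by congr (_ *m _); apply/matrixP => i j; rewrite !mxE.
Qed.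

(** * The local ring at a smooth point *)

(** The quotient rule. *)
Lemma derivation_extends (A : comNzRingType) (K : fieldType)
    (pi : {rmorphism A -> K}) (delta : A -> K) :
  (forall z, exists a b, pi b != 0 /\ z = pi a / pi b) ->
  (forall a b, delta (a + b) = delta a + delta b) ->
  (forall a b, delta (a * b) = delta a * pi b + pi a * delta b) ->
  (forall a, pi a = 0 -> delta a = 0) ->
  exists D : K -> K, [/\ forall x y, D (x + y) = D x + D y,
    forall x y, D (x * y) = D x * y + x * D y, forall a, D (pi a) = delta a &
    forall a b, pi b != 0 -> D (pi a / pi b) = (delta a * pi b - pi a * delta b) / pi b ^+ 2].
Proof.
move=> frac dD dM dK.
have [z|D DP] := @choice _ _ (fun z y => exists a b, [/\ pi b != 0, z = pi a / pi b &
     y = (delta a * pi b - pi a * delta b) / pi b ^+ 2]).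
  have [a [b [b0 ->]]] := frac z.
  by exists ((delta a * pi b - pi a * delta b) / pi b ^+ 2), a, b.
have dB a b : delta (a - b) = delta a - delta b.
  by apply/eqP; rewrite eq_sym subr_eq -dD subrK.
have DE a b : pi b != 0 ->
    D (pi a / pi b) = (delta a * pi b - pi a * delta b) / pi b ^+ 2.
  move=> b0; have [a' [b' [b'0 e ->]]] := DP (pi a / pi b).
  have e0 : pi a * pi b' = pi a' * pi b by apply/eqP; rewrite -eqr_div // e.
  have : delta (a * b' - a' * b) = 0 by apply: dK; rewrite rmorphB !rmorphM e0 subrr.
  rewrite dB !dM => /eqP; rewrite subr_eq0 => /eqP e1.
  have a'E : pi a' = pi a * pi b' / pi b by rewrite e0 mulfK.
  have d'E : delta a' = (delta a * pi b' + pi a * delta b' - pi a' * delta b) / pi b.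
    by rewrite e1 addrK mulfK.
  by rewrite d'E a'E; field; rewrite b0 b'0.
have d1 : delta 1 = 0.
  have := dM 1 1; rewrite rmorph1 !mulr1 mul1r => /eqP.
  by rewrite eq_sym -subr_eq0 addrK => /eqP.
exists D; split=> //.
- move=> x y; have [a [b [b0 ->]]] := frac x; have [a' [b' [b'0 ->]]] := frac y.
  have -> : pi a / pi b + pi a' / pi b' = pi (a * b' + a' * b) / pi (b * b').
    by rewrite rmorphD !rmorphM /=; field; rewrite b0 b'0.
  have bb : pi (b * b') != 0 by rewrite rmorphM mulf_neq0.
  rewrite (DE _ _ bb) (DE _ _ b0) (DE _ _ b'0) dD !dM rmorphD !rmorphM /=.
  by field; rewrite b0 b'0.
- move=> x y; have [a [b [b0 ->]]] := frac x; have [a' [b' [b'0 ->]]] := frac y.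
  have -> : pi a / pi b * (pi a' / pi b') = pi (a * a') / pi (b * b').
    by rewrite !rmorphM /=; field; rewrite b0 b'0.
  have bb : pi (b * b') != 0 by rewrite rmorphM mulf_neq0.
  rewrite (DE _ _ bb) (DE _ _ b0) (DE _ _ b'0) !dM !rmorphM /=.
  by field; rewrite b0 b'0.
- move=> a; have e : pi a = pi a / pi 1 by rewrite rmorph1 divr1.
  by rewrite {1}e DE ?rmorph1 ?oner_eq0 // d1 mulr0 subr0 mulr1 expr1n divr1.
Qed.

Section LocalRing.
Variables (R : realType) (n : nat).
Local Notation F := R[i].
Variables (X : 'rV[F]_n.+1 -> Prop) (i0 : 'I_n.+1) (P : 'rV[F]_n.+1).
Hypotheses (Xc : zariski_closed X) (Xirr : irreducible X) (XP : X P).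
Local Notation kappa := (P 0 i0).
Hypothesis kappa0 : kappa != 0.
Variables (K : fieldType) (iota : {rmorphism F -> K}) (xi : 'I_n.+1 -> K).
Hypothesis xi0 : xi i0 = iota kappa.
Hypothesis xiE : forall p, mmap iota xi p = 0 <->
  forall x, X x -> x 0 i0 = kappa -> p.@[x 0] = 0.
Hypothesis gen : forall z, exists p q, mmap iota xi q != 0 /\
   z = mmap iota xi p / mmap iota xi q.
Hypothesis dep3 : forall l a x : K, exists2 b : tower F 3, b != 0 &
  tower_eval iota (nth 0 [:: l; a; x]) 3 b = 0.

Local Notation ev := (mmap iota xi).

Lemma ev_neq0 q : q.@[P 0] != 0 -> ev q != 0.
Proof. by apply: contraNneq => /xiE/(_ P XP erefl) ->. Qed.

Definition local_at (z : K) := exists p q, q.@[P 0] != 0 /\ z = ev p / ev q.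

Lemma local_value_exists : exists val : K -> F,
  forall p q, q.@[P 0] != 0 -> val (ev p / ev q) = p.@[P 0] / q.@[P 0].
Proof.
have [z|val vP] := @choice _ _ (fun z c => local_at z -> exists p q,
    [/\ q.@[P 0] != 0, z = ev p / ev q & c = p.@[P 0] / q.@[P 0]]).
  have [[p [q [q0 ->]]]|nz] := pselect (local_at z); last by exists 0.
  by exists (p.@[P 0] / q.@[P 0]) => _; exists p, q.
exists val => p q q0; have [|p' [q' [q'0 e ->]]] := vP (ev p / ev q); first by exists p, q.
have : ev (p * q' - p' * q) = 0.
  apply/eqP; rewrite rmorphB !rmorphM /= subr_eq0.
  by rewrite -eqr_div ?ev_neq0 // e.
move/xiE/(_ P XP erefl)/eqP; rewrite mevalB !mevalM subr_eq0.
by rewrite -eqr_div // => /eqP.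
Qed.

Section Value.
Variable val : K -> F.
Hypothesis valE : forall p q, q.@[P 0] != 0 -> val (ev p / ev q) = p.@[P 0] / q.@[P 0].

Lemma local_ev p : local_at (ev p).
Proof. by exists p, 1; rewrite meval1 oner_eq0 rmorph1 divr1. Qed.

Lemma val_ev p : val (ev p) = p.@[P 0].
Proof.
have := valE p (q := 1); rewrite meval1 rmorph1 !divr1; apply.
exact: oner_neq0.
Qed.

Lemma local_add_val x y : local_at x -> local_at y ->
  local_at (x + y) /\ val (x + y) = val x + val y.
Proof.
move=> [p [q [q0 ->]]] [p' [q' [q'0 ->]]].
have qq : (q * q').@[P 0] != 0 by rewrite mevalM mulf_neq0.
have -> : ev p / ev q + ev p' / ev q' = ev (p * q' + p' * q) / ev (q * q').
  by rewrite rmorphD !rmorphM /= addf_div ?ev_neq0.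
split; first by exists (p * q' + p' * q), (q * q').
by rewrite !valE // mevalD !mevalM addf_div.
Qed.

Lemma local_mul_val x y : local_at x -> local_at y ->
  local_at (x * y) /\ val (x * y) = val x * val y.
Proof.
move=> [p [q [q0 ->]]] [p' [q' [q'0 ->]]].
have qq : (q * q').@[P 0] != 0 by rewrite mevalM mulf_neq0.
have -> : ev p / ev q * (ev p' / ev q') = ev (p * p') / ev (q * q').
  by rewrite !rmorphM /= mulf_div.
split; first by exists (p * p'), (q * q').
by rewrite !valE // !mevalM mulf_div.
Qed.

Lemma local_iota c : local_at (iota c).
Proof. by rewrite -(mmapC xi iota); apply: local_ev. Qed.

Lemma val_iota c : val (iota c) = c.
Proof. by rewrite -[X in val X](mmapC xi iota) val_ev mevalC. Qed.

Lemma local_sum (I : Type) (s : seq I) (Q : pred I) (f : I -> K) :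
  (forall i, Q i -> local_at (f i)) -> local_at (\sum_(i <- s | Q i) f i).
Proof.
move=> h; apply: big_ind => // [|x y hx hy]; last by case: (local_add_val hx hy).
by rewrite -(rmorph0 iota); apply: local_iota.
Qed.

Lemma local_div_ev x q : q.@[P 0] != 0 -> local_at x -> local_at (x / ev q).
Proof.
move=> q0 [p' [q' [q'0 ->]]]; exists p', (q' * q).
by rewrite mevalM mulf_neq0 // rmorphM /= invfM mulrA.
Qed.

Hypothesis smooth : smooth_of_dim X 2.

(** The vector field [v / d] acts on polynomials.  It annihilates the ideal of the chart
    because it is tangent to the cone over [X], which handles homogenizations, and to the
    hyperplane [x_i0 = kappa], where homogenization changes nothing; so it descends to the
    function field. *)
Lemma local_derivation_exists : exists (D : K -> K) (x z : K),
  [/\ forall a, local_at a -> local_at (D a),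
      forall a b, D (a + b) = D a + D b,
      forall a b, D (a * b) = D a * b + a * D b,
      forall c, D (iota c) = 0 &
      [/\ local_at x, local_at z, D x = 1, D z = z & val z != 0]].
Proof.
have [v [d [l [l' [d0 vi0 ld l'd tang]]]]] := tangent_vector_field smooth XP kappa0.
have evd := ev_neq0 d0.
pose V i := ev (v i) / ev d.
pose delta p := \sum_i V i * ev (p^`M(i)).
have dD p q : delta (p + q) = delta p + delta q.
  rewrite /delta -big_split; apply: eq_bigr => i _.
  by rewrite mderivD rmorphD mulrDr.
have dM p q : delta (p * q) = delta p * ev q + ev p * delta q.
  rewrite /delta mulr_suml mulr_sumr -big_split; apply: eq_bigr => i _.
  by rewrite mderivM rmorphD !rmorphM /=; ring.
have dC c : delta c%:MP = 0.
  by rewrite /delta big1 // => i _; rewrite mderivC rmorph0 mulr0.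
have dX i : delta 'X_i = V i.
  rewrite /delta (bigD1 i) //= big1 => [|k ki].
    rewrite mderivX mnm1E eqxx addr0 scale1r.
    have -> : (U_(i) - U_(i))%MM = 0%MM by apply/mnmP => k; rewrite mnmBE subnn mnm0E.
    by rewrite mpolyX0 rmorph1 mulr1.
  by rewrite mderivX mnm1E eq_sym (negPf ki) scale0r rmorph0 mulr0.
have V0 : V i0 = 0 by rewrite /V vi0 rmorph0 mul0r.
have dZ c p : delta (c *: p) = iota c * delta p.
  by rewrite -mul_mpolyC dM dC mul0r add0r /= mmapC.
have dform p : ideal_form X p -> delta p = 0.
  move=> Ip.
  have : ev (d * \sum_i p^`M(i) * v i) = 0.
    apply/xiE => x Xx _; rewrite mevalM raddf_sum /= -[RHS](tang p x Ip Xx).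
    by congr (_ * _); apply: eq_bigr => i _; rewrite mevalM.
  move=> /eqP; rewrite rmorphM mulf_eq0 (negPf evd) /= => /eqP h.
  apply: (mulIf evd); rewrite mul0r -[RHS]h rmorph_sum mulr_suml.
  by apply: eq_bigr => i _; rewrite /V rmorphM /= mulrAC divfK // mulrC.
have dpow p k : delta p = 0 -> delta (p ^+ k) = 0.
  move=> dp; elim: k => [|k IH]; first by rewrite expr0 -mpolyC1 dC.
  by rewrite exprS dM dp IH mul0r mulr0 addr0.
have dsum (I : Type) (s : seq I) (f : I -> {mpoly F[n.+1]}) :
    delta (\sum_(i <- s) f i) = \sum_(i <- s) delta (f i).
  apply: (big_morph delta) => //; by rewrite -mpolyC0 dC.
have dhom p : delta (homogenize i0 kappa p) = delta p.
  rewrite /homogenize dsum [in RHS](mpolyE p) dsum; apply: eq_bigr => m _.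
  rewrite dM dpow ?mulr0 ?addr0; last by rewrite dZ dX V0 mulr0.
  rewrite rmorphXn /= mmapZ mmapX mmap1U xi0 -rmorphM mulVf // rmorph1 expr1n.
  by rewrite mulr1.
have dker p : ev p = 0 -> delta p = 0.
  move=> p0; rewrite -dhom; apply: dform; split.
    exact: homogenize_homogeneous.
  by apply: (@generic_homogenize R n X i0 kappa) p0 => //; exists P.
have [D [DD DM Dev Dfrac]] := @derivation_extends _ _ ev delta gen dD dM dker.
have Vloc i : local_at (V i) by exists (v i), d.
have deltaloc p : local_at (delta p).
  apply: local_sum => i _.
  by case: (local_mul_val (Vloc i) (local_ev (p^`M(i)))).
have Dlin (c : 'I_n.+1 -> F) : D (ev (\sum_i c i *: 'X_i)) = ev (\sum_i c i *: v i) / ev d.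
  rewrite Dev dsum rmorph_sum mulr_suml; apply: eq_bigr => i _.
  by rewrite dZ dX /= mmapZ mulrA.
have Di c : D (iota c) = 0 by rewrite -(mmapC xi iota) Dev dC.
pose x := \sum_i l i *: 'X_i : {mpoly F[n.+1]}.
pose z := 1 + \sum_i l' i *: ('X_i - (P 0 i)%:MP) : {mpoly F[n.+1]}.
exists D, (ev x), (ev z); split=> //.
- move=> _ [p [q [q0 ->]]]; rewrite Dfrac ?ev_neq0 // expr2 invfM mulrA.
  do 2 apply: local_div_ev => //.
  have [h1 _] := local_mul_val (deltaloc p) (local_ev q).
  have [h2 _] := local_mul_val (local_ev p) (deltaloc q).
  have [h3 _] := local_mul_val (local_iota (-1)) h2.
  rewrite rmorphN rmorph1 mulN1r in h3.
  by case: (local_add_val h1 h3).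
split; [exact: local_ev | exact: local_ev | | |].
- by rewrite Dlin ld divff.
- have zE : ev z = ev (\sum_i l' i *: 'X_i) + iota (1 - \sum_i l' i * P 0 i).
    rewrite /z rmorphD rmorph1 rmorphB rmorph1 [RHS]addrCA; congr (_ + _).
    rewrite !rmorph_sum -sumrB; apply: eq_bigr => i _ /=.
    by rewrite !mmapZ rmorphB /= mmapC mulrBr rmorphM.
  by rewrite {1}zE DD Di addr0 Dlin l'd rmorphM /= mulrAC divff // mul1r.
- rewrite val_ev /z mevalD meval1 raddf_sum /= big1 ?addr0 ?oner_eq0 // => i _.
  by rewrite mevalZ mevalB mevalXU mevalC subrr mulr0.
Qed.
End Value.
End LocalRing.

Section LocalGeometry.
Variables (R : realType) (n : nat).
Local Notation F := R[i].
Variables (X : 'rV[F]_n.+1 -> Prop) (i0 : 'I_n.+1) (P : 'rV[F]_n.+1).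
Hypotheses (Xc : zariski_closed X) (Xirr : irreducible X) (XP : X P).
Local Notation kappa := (P 0 i0).
Hypothesis kappa0 : kappa != 0.
Variables (K : fieldType) (iota : {rmorphism F -> K}) (xi : 'I_n.+1 -> K).
Hypothesis xi0 : xi i0 = iota kappa.
Hypothesis xiE : forall p, mmap iota xi p = 0 <->
  forall x, X x -> x 0 i0 = kappa -> p.@[x 0] = 0.
Hypothesis gen : forall z, exists p q, mmap iota xi q != 0 /\
   z = mmap iota xi p / mmap iota xi q.
Hypothesis dep3 : forall l a x : K, exists2 b : tower F 3, b != 0 &
  tower_eval iota (nth 0 [:: l; a; x]) 3 b = 0.
Hypothesis smooth : smooth_of_dim X 2.

Local Notation ev := (mmap iota xi).
Local Notation O := (local_at P iota xi).

Variable val : K -> F.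
Hypothesis valE : forall p q, q.@[P 0] != 0 -> val (ev p / ev q) = p.@[P 0] / q.@[P 0].

Lemma local_valuation_exists :
  (exists u : K -> int,
    [/\ forall a b, a != 0 -> b != 0 -> u (a * b) = u a + u b,
        forall k a b, a != 0 -> b != 0 -> a + b != 0 ->
          k <= u a -> k <= u b -> k <= u (a + b),
        forall c, c != 0 -> u (iota c) = 0,
        forall a, O a -> a != 0 -> 0 <= u a
      & forall a, O a -> val a = 0 -> a != 0 -> 1 <= u a]) /\
  exists x z, ~ is_constant iota x /\ ~ dependent iota x z.
Proof.
have [D [x [z [DO DD DM Di [Ox Oz Dx Dz vz]]]]] :=
  local_derivation_exists Xc Xirr XP kappa0 xi0 xiE gen valE smooth.
have OD a b : O a -> O b -> O (a + b).
  by move=> Oa Ob; case: (local_add_val XP xiE valE Oa Ob).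
have OM a b : O a -> O b -> O (a * b).
  by move=> Oa Ob; case: (local_mul_val valE Oa Ob).
have VD a b : O a -> O b -> val (a + b) = val a + val b.
  by move=> Oa Ob; case: (local_add_val XP xiE valE Oa Ob).
have VM a b : O a -> O b -> val (a * b) = val a * val b.
  by move=> Oa Ob; case: (local_mul_val valE Oa Ob).
have Vi := val_iota valE.
have Oi c : O (iota c) by apply: local_iota.
have frac y : exists a b, [/\ O a, O b, b != 0 & y = a / b].
  have [p [q [q0 ->]]] := gen y.
  by exists (ev p), (ev q); split=> //; apply: local_ev.
split.
  exact: (@curve_valuation_exists F K iota dep3 O val D Oi OD OM frac Vi VD VM DO DD DM Di
    x z Ox Oz Dx Dz vz).
exists x, z.
exact: (curve_coordinates_independent Oi OD OM Vi VD VM DO DD DM Di Oz Dx Dz vz).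
Qed.

Local Notation w := (fun i : 'I_n.+1 => xi i - iota (P 0 i)).
Local Notation m2 := (mpow O w 2).

Let Oi c : O (iota c). Proof. exact: local_iota. Qed.
Let OD a b : O a -> O b -> O (a + b).
Proof. by move=> Oa Ob; case: (local_add_val XP xiE valE Oa Ob). Qed.
Let OM a b : O a -> O b -> O (a * b).
Proof. by move=> Oa Ob; case: (local_mul_val valE Oa Ob). Qed.

Lemma local_coordinate i : O (w i).
Proof.
have := local_ev P iota xi ('X_i - (P 0 i)%:MP).
by rewrite rmorphB /= mmapX mmap1U mmapC.
Qed.

Let linear_part (p : {mpoly F[n.+1]}) := \sum_i iota (p^`M(i)).@[P 0] * w i.
Let remainder p := ev p - iota p.@[P 0] - linear_part p.

Let linear_part_m p : mpow O w 1 (linear_part p).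
Proof. by exists (fun i => iota (p^`M(i)).@[P 0]) => // i; apply: Oi. Qed.

(** Taylor's formula, in a form stable under sums and products of polynomials. *)
Lemma taylor_second_order p : m2 (remainder p).
Proof.
have m0 := @mpow0 _ _ iota O _ w Oi 2.
have mD := @mpow_add _ O _ w OD 2.
have mS := @mpow_scale _ O _ w OM 2.
have C c : remainder c%:MP = 0.
  rewrite /remainder mmapC mevalC subrr sub0r /linear_part big1 ?oppr0 // => i _.
  by rewrite mderivC meval0 rmorph0 mul0r.
have X_ i : remainder 'X_i = 0.
  rewrite /remainder mmapX mmap1U mevalXU /linear_part (bigD1 i) //= big1.
    rewrite mderivX mnm1E eqxx scale1r.
    have -> : (U_(i) - U_(i))%MM = 0%MM by apply/mnmP => k; rewrite mnmBE subnn mnm0E.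
    by rewrite mpolyX0 meval1 rmorph1 mul1r addr0 subrr.
  by move=> k ki; rewrite mderivX mnm1E eq_sym (negPf ki) scale0r meval0 rmorph0 mul0r.
have D p1 p2 : remainder (p1 + p2) = remainder p1 + remainder p2.
  suff E : linear_part (p1 + p2) = linear_part p1 + linear_part p2.
    by rewrite /remainder E mevalD !rmorphD /=; ring.
  rewrite /linear_part -big_split; apply: eq_bigr => i _.
  by rewrite mderivD mevalD rmorphD mulrDl.
have M p1 p2 : m2 (remainder p1) -> m2 (remainder p2) -> m2 (remainder (p1 * p2)).
  move=> h1 h2.
  have E : linear_part (p1 * p2) =
      iota p1.@[P 0] * linear_part p2 + iota p2.@[P 0] * linear_part p1.
    rewrite /linear_part !mulr_sumr -big_split; apply: eq_bigr => i _.
    by rewrite mderivM mevalD !mevalM rmorphD !rmorphM /=; ring.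
  have -> : remainder (p1 * p2) = linear_part p1 * linear_part p2 +
      (ev p2 * remainder p1 + (iota p1.@[P 0] + linear_part p1) * remainder p2).
    by rewrite /remainder E mevalM !rmorphM /=; ring.
  have Oev q : O (ev q) by apply: local_ev.
  apply: (mD _ _); first exact: (@mpow_mul _ _ iota O _ w Oi OD OM 1 1).
  apply: (mD _ _); first exact: (mS _ _).
  apply: (mS _ _) => //; apply: OD => //.
  case: (linear_part_m p1) => o ho ->; apply: (local_sum XP xiE valE) => i _.
  by apply: OM; [apply: ho | apply: local_coordinate].
apply: (@mpoly_ring_ind _ _ (fun q => m2 (remainder q))) => [c|i|p1 p2 h1 h2|].
- by rewrite C.
- by rewrite X_.
- by rewrite D; apply: (mD _ _).
- exact: M.
Qed.

(** The gradient of [p] at [P] is a combination of gradients of forms vanishing on [X]; these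
    forms vanish in [K], so their linear parts are opposite to their Taylor remainders. *)
Lemma second_order p : p.@[P 0] = 0 ->
  (forall v, cone_tangent X P v -> \sum_i v 0 i * (p^`M(i)).@[P 0] = 0) ->
  m2 (ev p).
Proof.
move=> p0 /conormal_combination[k [s [c [sI cE]]]].
have mD := @mpow_add _ O _ w OD 2.
have mS := @mpow_scale _ O _ w OM 2.
have -> : ev p = remainder p + linear_part p.
  by rewrite /remainder p0 rmorph0 subr0 subrK.
apply: (mD _ _); first exact: taylor_second_order.
have -> : linear_part p = \sum_j iota (c j) * linear_part (s j).
  rewrite (eq_bigr (fun j => \sum_i iota (c j * ((s j)^`M(i)).@[P 0]) * w i)).
    rewrite exchange_big; apply: eq_bigr => i _; rewrite cE rmorph_sum mulr_suml.
    by apply: eq_bigr => j _.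
  by move=> j _; rewrite mulr_sumr; apply: eq_bigr => i _; rewrite rmorphM mulrA.
apply: (@mpow_sum _ _ iota O _ w Oi OD 2) => j; apply: (mS _ _) => //.
have [hs Xs] := sI j.
have -> : linear_part (s j) = iota (-1) * remainder (s j).
  have e0 : ev (s j) = 0 by apply/xiE => x Xx _; apply: Xs.
  by rewrite /remainder e0 Xs // rmorph0 subr0 sub0r rmorphN rmorph1 mulrNN mul1r.
by apply: (mS _ _) => //; apply: taylor_second_order.
Qed.
End LocalGeometry.

(** * Rational maps and the function field *)

Lemma dhomog_comp (A : comNzRingType) (n m d e : nat) (p : {mpoly A[n]})
    (q : n.-tuple {mpoly A[m]}) :
  p \is d.-homog -> (forall i, tnth q i \is e.-homog) -> p \mPo q \is (e * d).-homog.
Proof.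
move=> /dhomogP hp hq; rewrite comp_mpolyEX big_seq; apply: rpred_sum => mm mp.
apply: rpredZ; rewrite comp_mpolyX -(hp mm mp) /= mdegE big_distrr /=.
apply: (big_ind2 (fun (r : {mpoly A[m]}) k => r \is k.-homog)).
- exact: dhomog1.
- by move=> r k r' k' hr hr'; apply: dhomogM.
- by move=> i _; apply: dhomogMn.
Qed.

Lemma mmap_eval_comp (A T : comNzRingType) (n m : nat) (f : {rmorphism A -> T})
    (x : 'I_m -> T) (q : n.-tuple {mpoly A[m]}) p :
  mmap f x (p \mPo q) = mmap f (fun i => mmap f x (tnth q i)) p.
Proof.
pose g : {rmorphism {mpoly A[m]} -> T} := mmap f x.
rewrite -[LHS]/(g _); rewrite /comp_mpoly.
by apply: (@mmap_comp _ _ _ _ f g) => a; apply: mmapC.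
Qed.

Lemma rmorph_mmap_point (A S T : comNzRingType) (n : nat) (f : {rmorphism A -> S})
    (h : {rmorphism S -> T}) (x : 'I_n -> S) (p : {mpoly A[n]}) :
  h (mmap f x p) = mmap (h \o f) (h \o x) p.
Proof.
rewrite /mmap rmorph_sum; apply: eq_bigr => m _; rewrite rmorphM; congr (_ * _).
by rewrite /mmap1 rmorph_prod; apply: eq_bigr => i _; rewrite rmorphXn.
Qed.

Section Maps.
Variables (R : realType).
Local Notation F := R[i].

Lemma map_graph_main (n m : nat) (X : 'rV[F]_n.+1 -> Prop) (f : forms R n m) x :
  represents_map X f -> X x -> eval_forms f x != 0 -> map_graph X f x (eval_forms f x).
Proof.
move=> rf Xx fx; split=> //; exists f; split=> //.
  by split=> // y _ i k; rewrite mulrC.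
by exists 1; [exact: oner_neq0 | rewrite scale1r].
Qed.

Lemma eval_forms_neq0 (n m : nat) (f : forms R n m) x :
  eval_forms f x != 0 <-> exists j, (tnth f j).@[x 0] != 0.
Proof.
split=> [fx|[j hj]]; last by apply: contraNneq hj => /rowP/(_ j); rewrite !mxE => ->.
apply: contrapT => none; case/negP: fx; apply/eqP/rowP => j; rewrite !mxE.
by apply/eqP; apply: contrapT => /negP nj; apply: none; exists j.
Qed.

(** At a common zero of the components of [f] the value is that of [p] at [0], which is also
    zero because [0] is a multiple of a point of [Y]. *)
Lemma pullback_vanish (n m : nat) (X : 'rV[F]_n.+1 -> Prop) (Y : 'rV[F]_m.+1 -> Prop)
    (f : forms R n m) p x :
  rational_map X Y f -> homogeneous p -> (forall y, Y y -> p.@[y 0] = 0) ->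
  X x -> (p \mPo f).@[x 0] = 0.
Proof.
move=> [rf fY] [d hp] pY Xx; rewrite comp_mpoly_meval.
have E z : p.@[fun i => (tnth f i).@[(z : 'rV[F]_n.+1) 0]] = p.@[(eval_forms f z) 0].
  by congr (meval _ p); apply: funext => i; rewrite mxE.
rewrite E; have [e|fx] := eqVneq (eval_forms f x) 0; last first.
  by apply: pY; apply: (fY x); apply: map_graph_main.
have [_ [x1 Xx1 fx1]] := rf.
have y1 : Y (eval_forms f x1) by apply: (fY x1); apply: map_graph_main.
by rewrite e -(scale0r (eval_forms f x1)) (meval_scale _ _ hp) pY // mulr0.
Qed.

Section OnChart.
Variables (n : nat) (X : 'rV[F]_n.+1 -> Prop) (i0 : 'I_n.+1) (P : 'rV[F]_n.+1).
Hypotheses (Xc : zariski_closed X) (Xirr : irreducible X) (XP : X P).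
Local Notation kappa := (P 0 i0).
Hypothesis kappa0 : kappa != 0.
Variables (K : fieldType) (iota : {rmorphism F -> K}) (xi : 'I_n.+1 -> K).
Hypothesis xi0 : xi i0 = iota kappa.
Hypothesis xiE : forall p, mmap iota xi p = 0 <->
  forall x, X x -> x 0 i0 = kappa -> p.@[x 0] = 0.
Hypothesis gen : forall z, exists p q, mmap iota xi q != 0 /\
   z = mmap iota xi p / mmap iota xi q.

Local Notation ev := (mmap iota xi).

Let chart : exists2 x, X x & x 0 i0 = kappa. Proof. by exists P. Qed.

Lemma ev_form p : homogeneous p -> ev p = 0 <-> forall x, X x -> p.@[x 0] = 0.
Proof. exact: (generic_form Xc Xirr kappa0 chart xiE). Qed.

Lemma same_map_ev (m : nat) (f g : forms R n m) i j : same_map X f g ->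
  ev (tnth f i) * ev (tnth g j) = ev (tnth f j) * ev (tnth g i).
Proof.
move=> [_ _ fg]; apply/eqP; rewrite -subr_eq0 -!rmorphM -rmorphB; apply/eqP/xiE.
move=> x Xx _; have := fg x Xx i j; rewrite !mxE mevalB !mevalM => ->.
by rewrite subrr.
Qed.

Lemma represents_ev (m : nat) (f : forms R n m) : represents_map X f ->
  exists j, ev (tnth f j) != 0.
Proof.
move=> [[d hd] [x Xx /eval_forms_neq0[j hj]]]; exists j.
apply: contraNneq hj => e; apply/eqP.
by move: x Xx; apply/ev_form => //; exists d.
Qed.

Section Birational.
Variable f : forms R n n.
Hypothesis fbir : birational_map X X f.

(** Two representatives of the identity differ by a factor in [K]. *)
Lemma compose_inverse_ev (g h : forms R n n) : same_map X (comp_forms g h) (id_forms R n) ->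
  exists2 lam, lam != 0 & forall i, mmap iota (fun k => ev (tnth h k)) (tnth g i) = lam * xi i.
Proof.
move=> sm; have [rgh _ _] := sm.
have E i : ev (tnth (comp_forms g h) i) = mmap iota (fun k => ev (tnth h k)) (tnth g i).
  by rewrite tnth_mktuple mmap_eval_comp.
have idE i : ev (tnth (id_forms R n) i) = xi i by rewrite tnth_mktuple mmapX mmap1U.
have k0 : iota kappa != 0 by rewrite fmorph_eq0.
have h1 i : mmap iota (fun k => ev (tnth h k)) (tnth g i) =
   mmap iota (fun k => ev (tnth h k)) (tnth g i0) / iota kappa * xi i.
  have := same_map_ev i i0 sm; rewrite !E !idE xi0 => e.
  by apply: (mulIf k0); rewrite e mulrAC divfK.
exists (mmap iota (fun k => ev (tnth h k)) (tnth g i0) / iota kappa) => //.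
have [j hj] := represents_ev rgh.
by apply: contraNneq hj => e; rewrite E h1 e mul0r.
Qed.

(** [f] is dominant: pulling back once more by the inverse map returns a multiple of the
    original form. *)
Lemma pullback_form_ev p : homogeneous p ->
  mmap iota (fun k => ev (tnth f k)) p = 0 <-> ev p = 0.
Proof.
have [rf [g [rg gf fg]]] := fbir => hp; have [d hd] := hp.
have [e he] := rf.1.1.
split=> [p0|/ev_form p0]; last first.
  rewrite -mmap_eval_comp; apply/xiE => x Xx _.
  by apply: pullback_vanish Xx => //; [exact: rf | exact: p0].
have hpf : homogeneous (p \mPo f) by exists (e * d)%N; apply: dhomog_comp.
have pf : forall x, X x -> (p \mPo f).@[x 0] = 0.
  by apply/ev_form => //; rewrite mmap_eval_comp.
have := fun x => pullback_vanish (x := x) rg hpf pf => pfg.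
have : ev ((p \mPo f) \mPo g) = 0 by apply/xiE => x Xx _; apply: pfg.
have [lam lam0 hlam] := compose_inverse_ev fg.
rewrite mmap_eval_comp mmap_eval_comp.
have -> : (fun k => mmap iota (fun k0 => ev (tnth g k0)) (tnth f k)) = fun k => lam * xi k.
  by apply: funext => k; rewrite hlam.
rewrite (mmap_dhomog _ _ _ hd) => /eqP; rewrite mulf_eq0 expf_eq0 (negPf lam0) andbF /=.
by move/eqP.
Qed.

Lemma chart_component_neq0 : ev (tnth f i0) != 0.
Proof.
apply/negP => /eqP e.
have hX : homogeneous ('X_i0 : {mpoly F[n.+1]}) by exists 1%N; rewrite dhomogX /= mdeg1.
have := (pullback_form_ev hX).1; rewrite !mmapX !mmap1U e xi0 => /(_ erefl)/eqP.
by rewrite fmorph_eq0 (negPf kappa0).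
Qed.

(** The automorphism [h |-> h o f] of the function field, written in the chart
    [x_i0 = kappa].  It is onto because the coordinates of the inverse map are sent to the
    [xi i]. *)
Lemma pullback_automorphism_exists : exists phi : {rmorphism K -> K},
  [/\ forall c, phi (iota c) = iota c,
      forall i, phi (xi i) = iota kappa * ev (tnth f i) / ev (tnth f i0)
    & forall y, exists x, phi x = y].
Proof.
have f0 := chart_component_neq0; have k0 : iota kappa != 0 by rewrite fmorph_eq0.
pose c := iota kappa / ev (tnth f i0).
have c0 : c != 0 by rewrite mulf_neq0 ?invr_eq0.
pose eta i := c * ev (tnth f i).
have eta0 : eta i0 = iota kappa by rewrite /eta /c divfK.
have ker p : ev p = 0 <-> mmap iota eta p = 0.
  have hh := homogenize_homog i0 kappa p.
  have hp : homogeneous (homogenize i0 kappa p) by exists (msize p).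
  rewrite -(homogenizeE kappa0 p xi0) -(homogenizeE kappa0 p eta0).
  rewrite (mmap_dhomog _ _ _ hh) -(pullback_form_ev hp).
  split=> [->|/eqP]; first exact: mulr0.
  by rewrite mulf_eq0 expf_eq0 (negPf c0) andbF /= => /eqP.
have [phi phiE] := @lift_to_fractions _ _ _ ev (mmap iota eta) gen ker.
have phi_iota a : phi (iota a) = iota a.
  by have := phiE a%:MP; rewrite /= !mmapC.
have phi_xi i : phi (xi i) = eta i.
  by have := phiE 'X_i; rewrite /= !mmapX !mmap1U.
exists phi; split=> // [i|y]; first by rewrite phi_xi /eta /c mulrAC.
have [rf [g [rg gf fg]]] := fbir; have [e he] := rg.1.1.
have [mu mu0 hmu] := compose_inverse_ev gf.
have phig i : phi (ev (tnth g i)) = c ^+ e * mu * xi i.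
  have -> : phi (ev (tnth g i)) = mmap iota (fun k => c * ev (tnth f k)) (tnth g i) by exact: phiE.
  by rewrite (mmap_dhomog _ _ _ (he i)) hmu mulrA.
pose x i := iota kappa * ev (tnth g i) / ev (tnth g i0).
have phix i : phi (x i) = xi i.
  rewrite /x fmorph_div rmorphM !phig phi_iota xi0.
  by field; rewrite k0 mu0 expf_neq0.
have phip p : phi (mmap iota x p) = ev p.
  rewrite rmorph_mmap_point /mmap; apply: eq_bigr => m _ /=; rewrite phi_iota.
  by congr (_ * _); apply: mmap1_eq => i /=; rewrite phix.
have [p [q [q0 ->]]] := gen y.
by exists (mmap iota x p / mmap iota x q); rewrite fmorph_div !phip.
Qed.

Variable phi : {rmorphism K -> K}.
Hypothesis phi_iota : forall c, phi (iota c) = iota c.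
Hypothesis phi_xi : forall i, phi (xi i) = iota kappa * ev (tnth f i) / ev (tnth f i0).

Lemma PhiN_comm N x : PhiN phi N (phi x) = phi (PhiN phi N x).
Proof. by elim: N => //= N ->. Qed.

Lemma PhiN_point N p : PhiN phi N (ev p) = mmap iota (fun i => PhiN phi N (xi i)) p.
Proof.
rewrite rmorph_mmap_point /mmap; apply: eq_bigr => m _ /=.
by rewrite (PhiN_iota phi_iota).
Qed.

Lemma iterate_ev N : exists2 lam, lam != 0 &
  forall i, ev (tnth (iter_forms N f) i) = lam * PhiN phi N (xi i).
Proof.
have [[[d hd] _] _] := fbir.1.
have f0 := chart_component_neq0; have k0 : iota kappa != 0 by rewrite fmorph_eq0.
elim: N => [|N [lam lam0 IH]].
  by exists 1; rewrite ?oner_eq0 // => i; rewrite mul1r tnth_mktuple mmapX mmap1U.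
exists (lam ^+ d * PhiN phi N (ev (tnth f i0) / iota kappa)).
  by rewrite mulf_neq0 ?expf_neq0 // fmorph_eq0 mulf_neq0 // invr_eq0.
move=> i; rewrite /iter_forms /= tnth_mktuple mmap_eval_comp.
have -> : (fun k => ev (tnth (iter N (comp_forms f) (id_forms R n)) k)) =
    fun k => lam * PhiN phi N (xi k).
  by apply: funext => k; rewrite -IH.
rewrite (mmap_dhomog _ _ _ (hd i)) -PhiN_point -mulrA; congr (_ * _).
rewrite -PhiN_comm -rmorphM phi_xi; congr (PhiN _ _ _).
by field; rewrite f0 k0.
Qed.
End Birational.
End OnChart.
End Maps.

(** * Contraction of the maximal ideal at a superattracting point *)

Section Contraction.
Variables (R : realType) (n : nat).
Local Notation F := R[i].
Variables (X : 'rV[F]_n.+1 -> Prop) (i0 : 'I_n.+1) (P : 'rV[F]_n.+1).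
Hypotheses (Xc : zariski_closed X) (Xirr : irreducible X) (XP : X P).
Local Notation kappa := (P 0 i0).
Hypothesis kappa0 : kappa != 0.
Variables (K : fieldType) (iota : {rmorphism F -> K}) (xi : 'I_n.+1 -> K).
Hypothesis xi0 : xi i0 = iota kappa.
Hypothesis xiE : forall p, mmap iota xi p = 0 <->
  forall x, X x -> x 0 i0 = kappa -> p.@[x 0] = 0.
Local Notation ev := (mmap iota xi).
Local Notation O := (local_at P iota xi).
Local Notation w := (fun i : 'I_n.+1 => xi i - iota (P 0 i)).

Variable val : K -> F.
Hypothesis valE : forall p q, q.@[P 0] != 0 -> val (ev p / ev q) = p.@[P 0] / q.@[P 0].

Variables (h : forms R n n) (lam : K) (Phi : {rmorphism K -> K}).
Hypotheses (Phi_iota : forall c, Phi (iota c) = iota c) (lam0 : lam != 0).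
Hypothesis hE : forall i, ev (tnth h i) = lam * Phi (xi i).
Hypothesis sup : superattracting_fixed X h P.

Lemma same_map_generic (G : forms R n n) i j : same_map X h G ->
  ev (tnth G j) * Phi (xi i) = ev (tnth G i) * Phi (xi j).
Proof.
move=> sm; have := same_map_ev xiE i j sm; rewrite !hE -!mulrA.
by move/(mulfI lam0); rewrite mulrC => ->; rewrite mulrC.
Qed.

Let Phi0 : Phi (xi i0) = iota kappa. Proof. by rewrite xi0 Phi_iota. Qed.
Let k0 : iota kappa != 0. Proof. by rewrite fmorph_eq0. Qed.

(** A representative of [h] regular at [P], whose value there is [P].  The value and the
    differential are given through two possibly different representatives; the components of
    [h] itself may all vanish at [P], so they are compared in the function field, where both
    are proportional to [Phi (xi i)]. *)
Lemma superattracting_representative : exists G : forms R n n,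
  [/\ (tnth G i0).@[P 0] != 0,
      forall i, Phi (xi i) = iota kappa * ev (tnth G i) / ev (tnth G i0),
      forall i, kappa * (tnth G i).@[P 0] = P 0 i * (tnth G i0).@[P 0]
    & forall v i, cone_tangent X P v -> \sum_j v 0 j *
        (kappa * ((tnth G i)^`M(j)).@[P 0] - P 0 i * ((tnth G i0)^`M(j)).@[P 0]) = 0].
Proof.
have [[_ [G1 [sm1 G1P [c c0 PE]]]] [G [sm GP tang]]] := sup.
have G1G i j : (tnth G1 i).@[P 0] * (tnth G j).@[P 0] =
               (tnth G1 j).@[P 0] * (tnth G i).@[P 0].
  apply/eqP; rewrite -subr_eq0 -!mevalM -mevalB; apply/eqP.
  apply: (proj1 (xiE _)) => //; rewrite rmorphB !rmorphM /=; apply/eqP.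
  rewrite subr_eq0; apply/eqP.
  have E1 l := same_map_generic l i0 sm1; have E l := same_map_generic l i0 sm.
  apply: (mulIf k0); apply: (mulIf k0); rewrite -Phi0.
  transitivity ((ev (tnth G1 i) * Phi (xi i0)) * (ev (tnth G j) * Phi (xi i0))); first by ring.
  by rewrite -E1 -E -[RHS]mulrA [RHS]mulrACA; rewrite -E1 -E; ring.
have PG i j : P 0 i * (tnth G j).@[P 0] = P 0 j * (tnth G i).@[P 0].
  have Pi l : P 0 l = c * (tnth G1 l).@[P 0] by rewrite [in LHS]PE !mxE.
  by rewrite (Pi i) (Pi j) -!mulrA G1G.
have G0 : (tnth G i0).@[P 0] != 0.
  have [j Gj] := (eval_forms_neq0 G P).1 GP.
  apply: contraNneq Gj => e; have := PG i0 j; rewrite e mulr0 => /eqP.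
  by rewrite mulf_eq0 (negPf kappa0).
have evG0 := ev_neq0 XP xiE G0.
exists G; split=> // [i|v i /tang/sub_rVP[a va]].
  apply: (mulIf evG0); rewrite divfK // mulrC (same_map_generic i i0 sm) Phi0.
  exact: mulrC.
have vE l : \sum_j v 0 j * ((tnth G l)^`M(j)).@[P 0] = a * (tnth G l).@[P 0].
  have /rowP/(_ l) := va; rewrite !mxE => <-; apply: eq_bigr => j _; by rewrite !mxE.
transitivity (kappa * (a * (tnth G i).@[P 0]) - P 0 i * (a * (tnth G i0).@[P 0])).
  rewrite -!vE !mulr_sumr -sumrB; apply: eq_bigr => j _; ring.
by rewrite mulrCA (mulrCA (P 0 i)) PG subrr.
Qed.

Lemma local_inv z : O z -> val z != 0 -> O z^-1.
Proof.
move=> [p [q [q0 ->]]]; rewrite valE // mulf_eq0 negb_or => /andP[p0 _].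
by exists q, p; rewrite invf_div.
Qed.

Lemma local_composition (eta : 'I_n.+1 -> K) p :
  (forall i, O (eta i) /\ val (eta i) = P 0 i) ->
  O (mmap iota eta p) /\ val (mmap iota eta p) = p.@[P 0].
Proof.
move=> he; apply: (@mpoly_ring_ind _ _ (fun p => O (mmap iota eta p) /\
   val (mmap iota eta p) = p.@[P 0])) => {p} [c|i|p q [Op vp] [Oq vq]|p q [Op vp] [Oq vq]].
- rewrite mmapC mevalC; split; [exact: local_iota | exact: val_iota valE c].
- by rewrite mmapX mmap1U mevalXU.
- by rewrite rmorphD mevalD -vp -vq; apply: (local_add_val XP xiE valE).
- by rewrite rmorphM mevalM -vp -vq; apply: (local_mul_val valE).
Qed.

(** In the chart, [Phi (w i)] is the function
    [(kappa G_i - P_i G_i0) / G_i0], whose numerator vanishes at [P] together with its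
    derivatives along the tangent space. *)
Lemma superattracting_contraction :
  (forall x, O x -> O (Phi x)) /\ forall i, mpow O w 2 (Phi (w i)).
Proof.
have [G [G0 PhiE GP Gv]] := superattracting_representative.
have evG0 := ev_neq0 XP xiE G0.
have he i : O (Phi (xi i)) /\ val (Phi (xi i)) = P 0 i.
  have E : Phi (xi i) = ev (kappa *: tnth G i) / ev (tnth G i0) by rewrite PhiE mmapZ.
  split; first by exists (kappa *: tnth G i), (tnth G i0).
  by rewrite E valE // mevalZ GP mulfK.
split=> [x [p [q [q0 ->]]]|i].
  rewrite fmorph_div !rmorph_mmap_point.
  have E r : mmap (Phi \o iota) (Phi \o xi) r = mmap iota (Phi \o xi) r.
    by rewrite /mmap; apply: eq_bigr => m _ /=; rewrite Phi_iota.
  rewrite !E; have [Op _] := local_composition p he; have [Oq vq] := local_composition q he.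
  by case: (local_mul_val valE Op (local_inv Oq _)) => //; rewrite vq.
have OM a b : O a -> O b -> O (a * b).
  by move=> Oa Ob; case: (local_mul_val valE Oa Ob).
have -> : Phi (w i) = (ev (tnth G i0))^-1 * ev (kappa *: tnth G i - P 0 i *: tnth G i0).
  rewrite rmorphB Phi_iota PhiE rmorphB /= !mmapZ.
  by field.
apply: (mpow_scale OM).
  have := local_div_ev G0 (local_iota P iota xi 1).
  by rewrite rmorph1 div1r.
apply: (second_order XP xiE valE) => [|v tv].
  by rewrite mevalB !mevalZ GP subrr.
rewrite -[RHS](Gv v i tv); apply: eq_bigr => j _.
by rewrite mderivB !mderivZ mevalB !mevalZ.
Qed.
End Contraction.

(** * The invariant function of a fibration *)

Section Fibration.
Variables (R : realType) (n : nat).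
Local Notation F := R[i].
Variables (X : 'rV[F]_n.+1 -> Prop) (i0 : 'I_n.+1) (P : 'rV[F]_n.+1).
Hypotheses (Xc : zariski_closed X) (Xirr : irreducible X) (XP : X P).
Local Notation kappa := (P 0 i0).
Hypothesis kappa0 : kappa != 0.
Variables (K : fieldType) (iota : {rmorphism F -> K}) (xi : 'I_n.+1 -> K).
Hypothesis xi0 : xi i0 = iota kappa.
Hypothesis xiE : forall p, mmap iota xi p = 0 <->
  forall x, X x -> x 0 i0 = kappa -> p.@[x 0] = 0.
Local Notation ev := (mmap iota xi).

Variables (m : nat) (Y : 'rV[F]_m.+1 -> Prop) (rho : forms R n m) (i1 : 'I_m.+1).
Hypotheses (Ycurve : projective_curve Y) (rhoY : rational_map X Y rho).
Hypotheses (dom : dominant X Y rho) (rho1 : ev (tnth rho i1) != 0).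

Local Notation tau := (fun j => (ev (tnth rho i1))^-1 * ev (tnth rho j)).

Let tau1 : tau i1 = iota 1. Proof. by rewrite /= mulVf // rmorph1. Qed.

Lemma image_form_ev d p : p \is d.-homog ->
  mmap iota tau p = (ev (tnth rho i1))^-1 ^+ d * ev (p \mPo rho).
Proof. by move=> hp; rewrite (mmap_dhomog _ _ _ hp) mmap_eval_comp. Qed.

Lemma locus_image : included (locus iota tau) Y.
Proof.
have [[[S [Sh YE]] _] _] := Ycurve; move=> y [y0 Ly]; apply/YE; split=> // p Sp.
have [d hp] := Sh p Sp; apply: (Ly _ (Sh p Sp)); rewrite (image_form_ev hp).
have -> : ev (p \mPo rho) = 0; last exact: mulr0.
apply/xiE => x Xx _; apply: (pullback_vanish rhoY (Sh p Sp)) Xx => z /YE[_]; exact.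
Qed.

(** By dominance, [tau] is a generic point of [Y]. *)
Lemma dominant_vanish p : homogeneous p -> mmap iota tau p = 0 ->
  forall y, Y y -> p.@[y 0] = 0.
Proof.
move=> hp p0; have [d hd] := hp.
have Zc : zariski_closed (fun y : 'rV[F]_m.+1 => y != 0 /\ p.@[y 0] = 0).
  exists (fun r => r = p); split=> [r ->//|x].
  by split=> [[x0 px]|[x0 px]]; split=> //; [move=> r -> | apply: px].
move=> y Yy; have [] // := dom Zc _ Yy => {Yy y} x y [Xx [G [sm Gx [c c0 ->]]]].
split; first by rewrite scaler_eq0 negb_or c0.
have [_ [[e he] _] _] := sm.
rewrite (meval_scale _ _ hd).
have -> : p.@[(eval_forms G x) 0] = (p \mPo G).@[x 0].
  rewrite comp_mpoly_meval; congr (meval _ p); apply: funext => j; exact: mxE.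
suff -> : (p \mPo G).@[x 0] = 0 by rewrite mulr0.
move: x Xx {Gx}; apply/(ev_form Xc Xirr XP kappa0 xiE).
  by exists (e * d)%N; apply: dhomog_comp.
rewrite mmap_eval_comp.
have -> : (fun j => ev (tnth G j)) = fun j => ev (tnth G i1) * tau j.
  apply: funext => j; apply: (mulfI rho1); rewrite (same_map_ev xiE i1 j sm).
  by field.
by rewrite (mmap_dhomog _ _ _ hd) p0 mulr0.
Qed.

(** If all coordinates were constant, [Y] would be a single point, and would not contain a
    chain of length one. *)
Lemma nonconstant_coordinate : exists j, ~ is_constant iota (tau j).
Proof.
apply: contrapT => none.
have [j|c cE] := @choice _ _ (fun j a => tau j = iota a).
  by apply: contrapT => nj; apply: none; exists j.
have c1 : c i1 = 1 by apply: (fmorph_inj iota); rewrite -cE.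
have hX j : homogeneous ('X_j - c j *: 'X_i1 : {mpoly F[m.+1]}).
  by exists 1%N; rewrite rpredB ?rpredZ // dhomogX /= mdeg1.
have Yline y : Y y -> y = y 0 i1 *: \row_j c j.
  move=> Yy; apply/rowP => j; rewrite !mxE.
  have e0 : mmap iota tau ('X_j - c j *: 'X_i1) = 0.
    by rewrite rmorphB /= mmapZ !mmapX !mmap1U cE tau1 rmorph1 mulr1 subrr.
  have := dominant_vanish (hX j) e0 Yy.
  by rewrite mevalB mevalZ !mevalXU mulrC => /eqP; rewrite subr_eq0 => /eqP.
have [[Yc _] [[W [Wci Winc WY]] _]] := Ycurve.
have [sub nsub] := Winc 0%N isT; apply: nsub => y Wy.
have [W0c [[z Wz] _]] := Wci 0%N isT.
have Yy := WY y Wy; have Yz := WY z (sub z Wz).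
have z1 : z 0 i1 != 0.
  by apply: contraNneq (closed_neq0 Yc Yz) => e; rewrite (Yline z Yz) e scale0r.
have y1 : y 0 i1 != 0.
  by apply: contraNneq (closed_neq0 Yc Yy) => e; rewrite (Yline y Yy) e scale0r.
have -> : y = (y 0 i1 / z 0 i1) *: z.
  by rewrite (Yline y Yy) {2}(Yline z Yz) scalerA !mxE c1 mulr1 divfK.
by apply: closed_scale => //; rewrite mulf_neq0 ?invr_eq0.
Qed.

Variables (f : forms R n n) (g : forms R m m) (phi : {rmorphism K -> K}).
Hypothesis fbir : birational_map X X f.
Hypothesis phi_iota : forall c, phi (iota c) = iota c.
Hypothesis phi_xi : forall i, phi (xi i) = iota kappa * ev (tnth f i) / ev (tnth f i0).
Hypothesis greg : regular_map Y Y g.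
Hypothesis inv : forall x x' y y' z,
  map_graph X f x x' -> map_graph X rho x' y' ->
  map_graph X rho x y -> map_graph Y g y z -> same_point y' z.

Lemma pullback_form_value d p : p \is d.-homog ->
  phi (ev p) = (iota kappa / ev (tnth f i0)) ^+ d * ev (p \mPo f).
Proof.
move=> hp; rewrite rmorph_mmap_point mmap_eval_comp -(mmap_dhomog _ _ _ hp).
rewrite /mmap; apply: eq_bigr => k _ /=; rewrite phi_iota; congr (_ * _).
by apply: mmap1_eq => i /=; rewrite phi_xi mulrAC.
Qed.

(** Both sides agree at every point of the chart where the maps involved are defined, by the
    invariance of the fibration; multiplied by forms vanishing at the other points, the
    difference vanishes on the chart. *)
Lemma generic_invariance j l :
  phi (tau j) * mmap iota tau (tnth g l) = phi (tau l) * mmap iota tau (tnth g j).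
Proof.
have [[e he] _] := rhoY.1; have [[d hd] _] := greg.1.1.
have f0 := chart_component_neq0 Xc Xirr XP kappa0 xi0 xiE fbir.
have k0 : iota kappa != 0 by rewrite fmorph_eq0.
have phirho i : phi (ev (tnth rho i)) =
   (iota kappa / ev (tnth f i0)) ^+ e * ev (tnth rho i \mPo f) := pullback_form_value (he i).
have rhof0 : ev (tnth rho i1 \mPo f) != 0.
  have : phi (ev (tnth rho i1)) != 0 by rewrite fmorph_eq0.
  by rewrite phirho mulf_eq0 negb_or => /andP[].
have gE i := image_form_ev (hd i).
have [l0 gl0] : exists l0, ev (tnth g l0 \mPo rho) != 0.
  have [_ [y Yy /eval_forms_neq0[l0 gy]]] := greg.1.1.
  exists l0; apply: contraNneq gy => e0; apply/eqP.
  by apply: (dominant_vanish _ _ Yy); [exists d | rewrite gE e0 mulr0].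
suff E : ev (tnth rho j \mPo f) * ev (tnth g l \mPo rho) =
         ev (tnth rho l \mPo f) * ev (tnth g j \mPo rho).
  rewrite !rmorphM !phirho !gE /=.
  set A := phi _; set B := _ ^+ e; set C := _ ^+ d.
  transitivity (A * B * C * (ev (tnth rho j \mPo f) * ev (tnth g l \mPo rho))); first by ring.
  by rewrite E; ring.
have [cf cfE] : exists cf, forall i, cf i = tnth rho i \mPo f by exists (fun i => tnth rho i \mPo f).
have [cg cgE] : exists cg, forall i, cg i = tnth g i \mPo rho by exists (fun i => tnth g i \mPo rho).
rewrite -!cfE -!cgE; rewrite -cfE in rhof0; rewrite -cgE in gl0.
have nz : ev (tnth f i0 * tnth rho i1 * cf i1 * cg l0) != 0.
  by rewrite !rmorphM /= !mulf_neq0.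
apply/eqP; rewrite -subr_eq0; apply/eqP; apply: (mulfI nz); rewrite mulr0.
rewrite -!rmorphM -rmorphB -rmorphM; apply/xiE => x Xx _.
have Mf i : (cf i).@[x 0] = (tnth rho i).@[(eval_forms f x) 0].
  by rewrite cfE comp_mpoly_meval; congr (meval _ _); apply: funext => k; rewrite mxE.
have Mr i : (cg i).@[x 0] = (tnth g i).@[(eval_forms rho x) 0].
  by rewrite cgE comp_mpoly_meval; congr (meval _ _); apply: funext => k; rewrite mxE.
rewrite mevalM mevalB !mevalM !Mf !Mr.
set x' := eval_forms f x; set y := eval_forms rho x.
have [->|fx] := eqVneq (tnth f i0).@[x 0] 0; first by rewrite !mul0r.
have [->|rx] := eqVneq (tnth rho i1).@[x 0] 0; first by rewrite mulr0 !mul0r.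
have [->|rx'] := eqVneq (tnth rho i1).@[x' 0] 0; first by rewrite mulr0 !mul0r.
have [->|gy] := eqVneq (tnth g l0).@[y 0] 0; first by rewrite mulr0 !mul0r.
have gx : map_graph X f x x'.
  by apply: map_graph_main fbir.1.1 Xx _; apply/eval_forms_neq0; exists i0.
have gxy : map_graph X rho x y.
  by apply: map_graph_main rhoY.1 Xx _; apply/eval_forms_neq0; exists i1.
have gx' : map_graph X rho x' (eval_forms rho x').
  apply: map_graph_main rhoY.1 (fbir.1.2 _ _ gx) _.
  by apply/eval_forms_neq0; exists i1.
have gyz : map_graph Y g y (eval_forms g y).
  apply: map_graph_main greg.1.1 (rhoY.2 _ _ gxy) _.
  by apply/eval_forms_neq0; exists l0.
have [c c0 cE] := inv gx gx' gxy gyz.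
have cEi i : (tnth g i).@[y 0] = c * (tnth rho i).@[x' 0].
  by have /rowP/(_ i) := cE; rewrite !mxE.
by rewrite !cEi; ring.
Qed.

(** Both [tau j] and [phi (tau j)] are rational functions on the curve [Y], evaluated at
    its generic point. *)
Lemma fibration_dependent : exists2 t, ~ is_constant iota t & dependent iota t (phi t).
Proof.
have [j nj] := nonconstant_coordinate; exists (tau j) => //.
have phi1 : phi (tau i1) = 1 by rewrite tau1 phi_iota rmorph1.
have [[d hd] [y Yy /eval_forms_neq0[l0 gy]]] := greg.1.1.
have gl0 : mmap iota tau (tnth g l0) != 0.
  apply: contraNneq gy => e0; apply/eqP.
  by apply: (dominant_vanish _ e0 Yy); exists d.
have g1 : mmap iota tau (tnth g i1) != 0.
  apply: contraNneq gl0 => e0; have := generic_invariance i1 l0.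
  by rewrite phi1 e0 mul1r mulr0 => ->.
have phij : phi (tau j) = mmap iota tau (tnth g j) / mmap iota tau (tnth g i1).
  by apply: (mulIf g1); rewrite divfK // generic_invariance phi1 mul1r.
have [[_ _] [_ nch]] := Ycurve.
have nch' : ~ chain_in (locus iota tau) 2.
  by move=> [W [h1 h2 h3]]; apply: nch; exists W; split=> // v /h3/locus_image.
have [|b b0 bE] := dependent_of_no_chain (oner_neq0 _) (z := nth 0 [:: tau j; phi (tau j)])
  tau1 nch'; last by exists b.
case=> [|[|//]] _ /=; last by exists (tnth g j), (tnth g i1).
by exists 'X_j, 1; rewrite rmorph1 oner_eq0 divr1 mmapX mmap1U.
Qed.
End Fibration.

(** * Invariant fibrations and superattracting points *)

Section InvariantField.
Variables (F : closedFieldType) (K : fieldType) (iota : {rmorphism F -> K}).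
Variable psi : {rmorphism K -> K}.
Hypothesis psi_iota : forall c, psi (iota c) = iota c.

Lemma dependent_map t x : dependent iota (psi t) (psi x) <-> dependent iota t x.
Proof.
have E1 p : psi (hev iota t p) = hev iota (psi t) p.
  rewrite /hev /= /horner_eval -horner_map; congr (_.[_]).
  by apply/polyP => i; rewrite !coef_map /= psi_iota.
have E2 b : psi (hev2 iota t x b) = hev2 iota (psi t) (psi x) b.
  rewrite !hev2E -horner_map; congr (_.[_]).
  by apply/polyP => i; rewrite !coef_map /= E1.
split=> -[b b0 bE]; exists b => //; last by rewrite -E2 bE rmorph0.
by apply: (fmorph_inj psi); rewrite E2 bE rmorph0.
Qed.

(** The closures of [F(t)] and of [F(psi t)] in [K] coincide. *)
Lemma invariant_field t x : ~ is_constant iota t -> dependent iota t (psi t) ->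
  dependent iota t (psi x) <-> dependent iota t x.
Proof.
move=> nt dt.
have nt' : ~ is_constant iota (psi t).
  by move=> [c e]; apply: nt; exists c; apply: (fmorph_inj psi); rewrite psi_iota.
rewrite -(dependent_map t x); split=> d.
  exact: (dependent_trans nt' nt (dependent_sym dt)).
exact: (dependent_trans nt nt' dt).
Qed.
End InvariantField.

Theorem proposition1p2 (R : realType) (n : nat)
  (X : 'rV[R[i]]_n.+1 -> Prop) (f : forms R n n)
  (hX : smooth_projective_surface X) (hf : birational_map X X f)
  (hP : exists P : 'rV[R[i]]_n.+1, superattracting_periodic X f P) :
  ~ exists (m : nat) (Y : 'rV[R[i]]_m.+1 -> Prop)
      (rho : forms R n m) (g : forms R m m), invariant_fibration X f Y rho g.
Proof.
move=> [m [Y [rho [g [Ycurve rhoY dom greg inv]]]]].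
have [[Xc Xirr] [_ nch] smooth] := hX; have [P [k _ sup]] := hP.
have XP : X P by case: sup => -[].
have [i0 kappa0] : exists i0, P 0 i0 != 0.
  apply: contrapT => none; case/negP: (closed_neq0 Xc XP); apply/eqP/rowP => i.
  by rewrite mxE; apply/eqP; apply: contrapT => /negP ni; apply: none; exists i.
have chart : exists2 x, X x & x 0 i0 = P 0 i0 by exists P.
have [K [iota [xi [xi0 xiE gen]]]] := function_field_exists Xc Xirr kappa0 chart.
have nch' : ~ chain_in (locus iota xi) 3.
  move=> [W [h1 h2 h3]]; apply: nch; exists W; split=> // v /h3.
  exact: (locus_generic Xc Xirr kappa0 chart xiE).
have dep3 l a x : exists2 b : tower R[i] 3, b != 0 &
    tower_eval iota (nth 0 [:: l; a; x]) 3 b = 0.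
  apply: (dependent_of_no_chain kappa0 xi0 nch') => j _.
  by have [p [q pq]] := gen (nth 0 [:: l; a; x] j); exists p, q.
have [phi [phi_iota phi_xi phi_surj]] :=
  pullback_automorphism_exists Xc Xirr XP kappa0 xi0 xiE gen hf.
have [i1 rho1] := represents_ev Xc Xirr XP kappa0 xiE rhoY.1.
have [t nt dt] := fibration_dependent Xc Xirr XP kappa0 xi0 xiE Ycurve rhoY dom rho1
  hf phi_iota phi_xi greg inv.
have Lphi x := invariant_field phi_iota x nt dt.
have [lam lam0 hE] := iterate_ev Xc Xirr XP kappa0 xi0 xiE hf phi_iota phi_xi k.
have [val valE] := local_value_exists XP xiE.
have Phi_iota := PhiN_iota phi_iota k.
have [PhiO Phiw] :=
  superattracting_contraction XP kappa0 xi0 xiE valE Phi_iota lam0 hE sup.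
have [[u [uM uD u_iota uO u1]] [x [z [nx nxz]]]] :=
  local_valuation_exists Xc Xirr XP kappa0 xi0 xiE gen dep3 smooth valE.
have [LC _ LD LM LV] := dependent_subfield nt.
apply: (@no_contracting_automorphism _ K iota dep3 _ xi gen t nt (PhiN phi k) Phi_iota
  _ _ (local_at P iota xi) _ (fun i => xi i - iota (P 0 i)) _ _ _ _ PhiO Phiw _ u uM uD
  u_iota uO).
- exact: PhiN_surj.
- exact: PhiN_L.
- exact: local_iota.
- by move=> a b Oa Ob; case: (local_add_val XP xiE valE Oa Ob).
- by move=> a b Oa Ob; case: (local_mul_val valE Oa Ob).
- by move=> i; apply: local_coordinate.
(* The [w i] generate [K], whose transcendence degree over [F] is two. *)
- apply: contrapT => none; apply: nxz.
  have Lxi i : dependent iota t (xi i).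
    rewrite -(subrK (iota (P 0 i)) (xi i)); apply: (LD _ _) => //.
    by apply: contrapT => ni; apply: none; exists i.
  have Lev p : dependent iota t (mmap iota xi p).
    apply: (@mpoly_ring_ind _ _ (fun p => dependent iota t (mmap iota xi p))) =>
        {p} [c|i|p q hp hq|p q hp hq].
    - by rewrite mmapC; apply: LC.
    - by rewrite mmapX mmap1U; apply: Lxi.
    - by rewrite rmorphD; apply: (LD _ _).
    - by rewrite rmorphM; apply: (LM _ _).
  have Lall y : dependent iota t y.
    by have [p [q [_ ->]]] := gen y; apply: (LM _ _) => //; apply: (LV _).
  exact: (dependent_trans nx nt (dependent_sym (Lall x)) (Lall z)).
- move=> i; apply: u1; first exact: local_coordinate.
  have -> : xi i - iota (P 0 i) = mmap iota xi ('X_i - (P 0 i)%:MP).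
    by rewrite rmorphB /= mmapX mmap1U mmapC.
  by rewrite (val_ev valE) mevalB mevalXU mevalC subrr.
Qed.
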